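(* Let $d\ge 1$, let $(l_n)_{n\ge1}$ be a decreasing sequence of positive reals, let $(\xi_n)_{n\ge1}$ be independent random variables uniformly distributed on $\mathbb{T}^d$, let $E=\limsup_{n\to\infty}B(\xi_n,l_n/2)$ be the associated random covering set, and let $\alpha=\alpha(l_n)$. Let $F\subset\mathbb{T}^d$ be an analytic set. Then $$\mathbb{P}(E\cap F\neq\emptyset)=\begin{cases}0 & \text{if } \dim_P(F)<d-\alpha,\\ 1 & \text{if } \dim_H(F)>d-\alpha.\end{cases}$$ Furthermore, almost surely, $$\dim_H(F)+\alpha-d\le \dim_H(E\cap F)\le \dim_P(F)+\alpha-d.$$
   Context: $\mathbb{T}^d$ is the $d$-dimensional torus with its usual (quotient Euclidean) metric and Lebesgue probability measure. $B(x,r)$ is the ball of centre $x$ and radius $r$ in $\mathbb{T}^d$. ''Decreasing'' means non-increasing. With $g_n=B(0,l_n/2)$ and $G_n=g_n+\xi_n=B(\xi_n,l_n/2)$, the random covering set is $E=\limsup_{n\to\infty}G_n=\bigcap_{n=1}^\infty\bigcup_{k=n}^\infty G_k$. The exponent is $\alpha(l_n)=\sup\{0\le s\le d:\sum_{n=1}^\infty l_n^s=\infty\}$, which is known to be the almost sure Hausdorff dimension of $E$. $\dim_H$ and $\dim_P$ denote Hausdorff and packing dimension.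
   Formalization: The dimension of the empty set is taken as 0, and the almost sure upper bound dim_H(E∩F) ≤ dim_P(F)+α−d is claimed only for outcomes where E∩F is nonempty, since no single value of dim of the empty set makes both bounds hold when E∩F is empty and dim_P(F)<d−α. *)

(* Defs.v *)
From HB Require Import structures.
From mathcomp Require Import all_boot all_order all_algebra finmap.
From mathcomp Require Import generic_quotient ring_quotient.
From mathcomp Require Import ring.
From mathcomp Require Import all_classical all_reals all_analysis.
From mathcomp Require Import measurable_realfun.

Set Implicit Arguments.
Unset Strict Implicit.
Unset Printing Implicit Defensive.

Import Order.TTheory GRing.Theory Num.Theory.
Import numFieldNormedType.Exports.

Local Open Scope classical_set_scope.
Local Open Scope ring_scope.
Local Open Scope quotient_scope.

Section euclidean_norm.
Context (R : realType) (d : nat).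
Implicit Types u v w : 'rV[R]_d.

(* The norm that the library puts on ['rV[R]_d] is the sup norm. *)
Definition enorm u : R := Num.sqrt (\sum_i u 0 i ^+ 2).

Lemma sum_sqr_ge0 u : 0 <= \sum_i u 0 i ^+ 2.
Proof. by apply: sumr_ge0 => i _; rewrite sqr_ge0. Qed.

Lemma enorm_ge0 u : 0 <= enorm u. Proof. exact: sqrtr_ge0. Qed.

Lemma enorm0 : enorm 0 = 0.
Proof.
rewrite /enorm big1 ?sqrtr0// => i _.
by rewrite mxE expr0n.
Qed.

Lemma enormB u v : enorm (u - v) = enorm (v - u).
Proof.
by congr Num.sqrt; apply: eq_bigr => i _; rewrite !mxE -sqrrN opprB.
Qed.

Lemma le_coord_enorm u i : `|u 0 i| <= enorm u.
Proof.
rewrite -sqrtr_sqr ler_sqrt ?sum_sqr_ge0// (bigD1 i)//= lerDl.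
by apply: sumr_ge0 => j _; rewrite sqr_ge0.
Qed.

Lemma sum_mul_le_enorm u v : \sum_i u 0 i * v 0 i <= enorm u * enorm v.
Proof.
set C := \sum_i _; rewrite -sqrtrM ?sum_sqr_ge0//.
set A := \sum_i _; set B := \sum_i _.
have A0 : 0 <= A by exact: sum_sqr_ge0.
have B0 : 0 <= B by exact: sum_sqr_ge0.
have : 0 <= B * (A * B - C ^+ 2).
  have -> : B * (A * B - C ^+ 2) = \sum_i (B * u 0 i - C * v 0 i) ^+ 2.
    transitivity (B ^+ 2 * A - 2 * B * C * C + C ^+ 2 * B); first by ring.
    rewrite (mulr_sumr _ _ _ (B ^+ 2)) (mulr_sumr _ _ _ (2 * B * C)).
    rewrite (mulr_sumr _ _ _ (C ^+ 2)).
    rewrite -sumrB -big_split/=.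
    by apply: eq_bigr => i _; ring.
  by apply: sumr_ge0 => i _; rewrite sqr_ge0.
have [B_eq0 _|B_neq0] := eqVneq B 0.
  have v0 i : v 0 i = 0.
    apply/eqP; rewrite -sqrf_eq0; apply/eqP.
    apply: (@psumr_eq0P _ _ xpredT (fun i => v 0 i ^+ 2)) => //.
    by move=> j _; rewrite sqr_ge0.
  by rewrite /C big1 ?sqrtr_ge0// => i _; rewrite v0 mulr0.
rewrite pmulr_rge0 ?lt0r ?B_neq0// subr_ge0 => CAB.
apply: (le_trans (ler_norm _)).
by rewrite -sqrtr_sqr ler_sqrt// mulr_ge0.
Qed.

Lemma ler_enormD u v : enorm (u + v) <= enorm u + enorm v.
Proof.
rewrite -(@ler_pXn2r _ 2)// ?nnegrE ?addr_ge0 ?enorm_ge0//.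
rewrite sqrrD !sqr_sqrtr ?sum_sqr_ge0//.
have -> : \sum_i (u + v) 0 i ^+ 2 = \sum_i u 0 i ^+ 2 +
    (\sum_i u 0 i * v 0 i) *+ 2 + \sum_i v 0 i ^+ 2.
  rewrite -sumrMnl -!big_split/=; apply: eq_bigr => i _.
  by rewrite mxE sqrrD.
by rewrite lerD2r lerD2l lerMn2r/= sum_mul_le_enorm.
Qed.

Lemma enorm_le_sum u : enorm u <= \sum_i `|u 0 i|.
Proof.
have s0 (P : pred 'I_d) : 0 <= \sum_(i | P i) `|u 0 i| by exact: sumr_ge0.
rewrite -(ger0_norm (s0 xpredT)) -sqrtr_sqr ler_sqrt ?sqr_ge0//.
rewrite [leRHS]expr2 mulr_suml ler_sum// => i _.
rewrite -(real_normK (num_real _)) expr2 ler_wpM2l// (bigD1 i)//= lerDl.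
exact: s0.
Qed.

End euclidean_norm.

Section torus.
Context (R : realType) (d : nat).

Definition int_lattice : {pred 'rV[R]_d} :=
  fun v => [forall i, v 0 i \is a Num.int].

Lemma int_lattice_zmod_closed : zmod_closed int_lattice.
Proof.
split=> [|u v /forallP uZ /forallP vZ]; apply/forallP => i; rewrite !mxE//.
by rewrite rpredB.
Qed.

HB.instance Definition _ :=
  GRing.isZmodClosed.Build 'rV[R]_d int_lattice int_lattice_zmod_closed.

Definition torus : Type := Quotient.quot int_lattice.

HB.instance Definition _ := GRing.Zmodule.on torus.

Definition torus_proj (v : 'rV[R]_d) : torus := \pi_((Quotient.quot int_lattice)) v.

Lemma torus_projP (u v : 'rV[R]_d) :
  torus_proj u = torus_proj v <-> u - v \in int_lattice.
Proof.
rewrite /torus_proj; split=> [uv|].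
  by rewrite Quotient.idealrBE uv.
by rewrite Quotient.idealrBE => /eqP.
Qed.

Lemma torus_proj_surj (x : torus) : exists v, torus_proj v = x.
Proof. by exists (repr (x : (Quotient.quot int_lattice))); rewrite /torus_proj reprK. Qed.

Implicit Types x y z : torus.

Let lifts x y : set R :=
  [set enorm (u - v) | u in torus_proj @^-1` [set x]
                     & v in torus_proj @^-1` [set y]].

Definition torus_dist x y : R := inf (lifts x y).

Let lifts_neq0 x y : lifts x y !=set0.
Proof.
have [u ux] := torus_proj_surj x; have [v vy] := torus_proj_surj y.
by exists (enorm (u - v)), u => //; exists v.
Qed.

Let lifts_lb x y : lbound (lifts x y) 0.
Proof. by move=> _ [u _ [v _ <-]]; exact: enorm_ge0. Qed.

Let lifts_inf x y : has_inf (lifts x y).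
Proof. by split; [exact: lifts_neq0|exists 0; exact: lifts_lb]. Qed.

Lemma torus_dist_le (u v : 'rV[R]_d) :
  torus_dist (torus_proj u) (torus_proj v) <= enorm (u - v).
Proof. by apply: ge_inf; [exists 0; exact: lifts_lb|exists u => //; exists v]. Qed.

Let torus_dist_ge0 x y : 0 <= torus_dist x y.
Proof. by apply: lb_le_inf; [exact: lifts_neq0|exact: lifts_lb]. Qed.

Let torus_distxx x : torus_dist x x = 0.
Proof.
apply/eqP; rewrite eq_le torus_dist_ge0 andbT.
have [u <-] := torus_proj_surj x.
by rewrite (le_trans (torus_dist_le u u))// subrr enorm0.
Qed.

Let torus_dist_sym x y : torus_dist x y = torus_dist y x.
Proof.
congr inf; apply/seteqP; split=> _ [u ux [v vy <-]];
  by exists v => //; exists u => //; rewrite enormB.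
Qed.

Let torus_dist_triangle y x z :
  torus_dist x z <= torus_dist x y + torus_dist y z.
Proof.
apply/ler_addgt0Pr => e e0; have e20 : 0 < e / 2 by rewrite divr_gt0.
have [_ [u ux [v vy <-]] uv] := inf_adherent e20 (lifts_inf x y).
have [_ [v' v'y [w wz <-]] v'w] := inf_adherent e20 (lifts_inf y z).
have ez : torus_proj (w + (v - v')) = z.
  rewrite -wz; apply/torus_projP; rewrite addrAC subrr add0r.
  by apply/torus_projP; rewrite vy.
rewrite -{1}ux -{1}ez (le_trans (torus_dist_le _ _))//.
have -> : u - (w + (v - v')) = (u - v) + (v' - w).
  by apply/rowP => i; rewrite !mxE; ring.
rewrite (le_trans (ler_enormD _ _))//.
rewrite [e in leRHS]splitr addrACA.
by apply: lerD; exact: ltW.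
Qed.

Let torus_dist_positivity x y : torus_dist x y = 0 -> x = y.
Proof.
have [u <-] := torus_proj_surj x; have [v <-] := torus_proj_surj y => uv0.
apply/torus_projP/forallP => i; apply/negPn/negP.
set t := (u - v) 0 i => tZ.
have ft : (Num.floor t)%:~R < t.
  rewrite lt_neqAle floor_le_tmp andbT; apply: contra tZ => /eqP <-.
  exact: intr_int.
have tf : t < (Num.floor t + 1)%:~R by exact: floorD1_gt.
pose e := Num.min (t - (Num.floor t)%:~R) ((Num.floor t + 1)%:~R - t).
have e0 : 0 < e by rewrite lt_min !subr_gt0 ft.
have [_ [u' uu' [v' vv' <-]]] :=
  inf_adherent e0 (lifts_inf (torus_proj u) (torus_proj v)).
rewrite [inf _]uv0 add0r => u'v'.
have /intrP[k kE] : t - (u' - v') 0 i \is a Num.int.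
  have -> : t - (u' - v') 0 i = (u - u') 0 i - (v - v') 0 i.
    by rewrite /t !mxE; ring.
  move/esym/torus_projP/forallP : uu' => /(_ i) uu'.
  move/esym/torus_projP/forallP : vv' => /(_ i) vv'.
  by rewrite rpredB.
have := le_lt_trans (le_coord_enorm (u' - v') i) u'v'.
have -> : (u' - v') 0 i = t - k%:~R by rewrite -kE opprB addrC subrK.
rewrite lt_min => /andP[]; have [kt|kt] := leP k (Num.floor t).
  rewrite ltNge => /negP tk _; apply: tk.
  by rewrite (le_trans _ (ler_norm _))// lerD2l lerN2 ler_int.
move=> _; rewrite ltNge distrC => /negP; apply.
by rewrite (le_trans _ (ler_norm _))// lerD2r ler_int lezD1.
Qed.

HB.instance Definition _ := isMetric.Build R torus
  torus_distxx torus_dist_positivity torus_dist_sym torus_dist_triangle.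

HB.instance Definition _ := isPointed.Build torus 0.

HB.instance Definition _ := @isMeasurable.Build
  (sigma_display (@open torus)) torus <<s @open torus >>
  (@sigma_algebra0 _ setT _) (@sigma_algebraC _ _)
  (@sigma_algebra_bigcup _ setT _).

End torus.

Section torus_measure.
Context (R : realType).
Local Notation mR := (measurableTypeR R).

Definition tuple_cons n (p : mR * n.-tuple mR) : n.+1.-tuple mR :=
  [tuple of p.1 :: p.2].

Lemma measurable_tuple_cons n : measurable_fun setT (@tuple_cons n).
Proof. exact: measurable_cons. Qed.

HB.instance Definition _ n :=
  isMeasurableFun.Build _ _ _ _ (@tuple_cons n) (@measurable_tuple_cons n).

(* The n-fold product of the uniform probability on [0, 1]; the library has
   binary products only. *)
Fixpoint uniform_cube n : probability (n.-tuple mR) R :=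
  match n with
  | 0 => \d_ [tuple]
  | m.+1 => distribution
      (uniform_prob (@ltr01 R) \x uniform_cube m)%E (@tuple_cons m)
  end.

Context (d : nat).

Definition cube_proj (t : d.-tuple mR) : torus R d :=
  torus_proj (\row_i tnth t i).

Lemma measurable_cube_proj : measurable_fun setT cube_proj.
Proof.
apply: (@measurability _ _ _ _ _ _ (@open (torus R d))) => // _ [U oU <-].
rewrite setTI.
pose box (qn : d.-tuple rat * nat) : set (d.-tuple mR) :=
  \bigcap_(i in [set: 'I_d])
    (fun t => tnth t i) @^-1` ball (ratr (tnth qn.1 i) : R) (qn.2.+1%:R^-1).
have mbox qn : measurable (box qn).
  apply: fin_bigcap_measurable => // i _.
  rewrite -[X in measurable X]setTI; apply: measurable_tnth => //.
  exact: measurable_ball.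
have -> : cube_proj @^-1` U =
    \bigcup_qn (if `[< box qn `<=` cube_proj @^-1` U >] then box qn else set0).
  apply/seteqP; split=> [t Ut|t [qn _]]; last by case: asboolP => // sU /sU.
  have /nbhs_ballP[e /= e0 eU] : nbhs (cube_proj t) U by exact: open_nbhs_nbhs.
  have [n ne] : exists n, d%:R * (2 * n.+1%:R^-1) < e.
    have ed : 0 < e / (d%:R * 2 + 1) by rewrite divr_gt0// ltr_wpDl// mulr_ge0.
    have [n _ /(_ n (leqnn n))] := near_infty_natSinv_lt (PosNum ed).
    rewrite /= ltr_pdivlMr ?ltr_wpDl// ?mulr_ge0// => nd.
    exists n; rewrite (le_lt_trans _ nd)// mulrA [leRHS]mulrC ler_wpM2r//.
    by rewrite lerDl.
  have n0 : 0 < n.+1%:R^-1 :> R by rewrite invr_gt0.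
  have qP i : exists q : rat, `|ratr q - (tnth t i : R)| < n.+1%:R^-1.
    have /rat_in_itvoo[q] :
        (tnth t i : R) - n.+1%:R^-1 < (tnth t i : R) + n.+1%:R^-1.
      by rewrite ltrBlDr -addrA ltrDl addr_gt0.
    by rewrite in_itv/= -ltr_distl => qt; exists q.
  pose q i := sval (cid (qP i)).
  exists ([tuple q i | i < d], n) => //.
  case: asboolP => [_|].
    by move=> i _ /=; rewrite /ball/= tnth_mktuple; exact: (svalP (cid (qP i))).
  apply; move=> s sbox; apply: eU; rewrite ballEmdist/=.
  apply: le_lt_trans (torus_dist_le _ _) _.
  apply: le_lt_trans (enorm_le_sum _) _.
  apply: le_lt_trans ne.
  rewrite -[in leRHS](card_ord d) mulr_natl -sumr_const ler_sum// => i _.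
  rewrite !mxE; move: (sbox i Logic.I); rewrite /ball/= tnth_mktuple => si.
  have ti := svalP (cid (qP i)).
  rewrite mulr_natl mulr2n (le_trans (ler_distD (ratr (q i)) _ _))//.
  by rewrite lerD// ltW// distrC.
apply: countable_bigcupT_measurable => [|qn]; first exact: countableP.
by case: ifP.
Qed.

HB.instance Definition _ :=
  isMeasurableFun.Build _ _ _ _ cube_proj measurable_cube_proj.

Definition torus_lebesgue : probability (torus R d) R :=
  distribution (uniform_cube d) cube_proj.

End torus_measure.

Section dimensions.
Context (R : realType) (T : metricType R).
Implicit Types (A U : set T) (s delta : R).
Local Open Scope ereal_scope.

(* The element 0 makes [diam set0 = 0] and changes nothing otherwise. *)
Definition diam U : \bar R :=
  ereal_sup (0 |` [set (mdist x y)%:E | x in U & y in U]).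

(* The case distinction matters only for [s = 0], where [0 `^ 0 = 1]. *)
Definition diam_pow s U : \bar R :=
  if U == set0 then 0 else diam U `^ s.

Definition hausdorff_premeasure s delta A : \bar R :=
  ereal_inf [set \sum_(0 <= i <oo) diam_pow s (U i) | U in
    [set U : nat -> set T | A `<=` \bigcup_i U i /\
                            forall i, diam (U i) <= delta%:E]].

Definition hausdorff_measure s A : \bar R :=
  ereal_sup [set hausdorff_premeasure s delta A | delta in
    [set delta | (0 < delta)%R]].

Definition hausdorff_dim A : \bar R :=
  ereal_inf [set s%:E | s in [set s | (0 <= s)%R /\ hausdorff_measure s A = 0]].

Definition metric_closed_ball (x : T) (r : R) : set T :=
  [set y | (mdist x y <= r)%R].

(* A packing is a countable family, indexed by a subset [D] of [nat], of
   disjoint closed balls centred in [A]. *)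
Definition is_packing delta A (D : set nat) (x : nat -> T) (r : nat -> R) :=
  (forall i, D i -> A (x i) /\ (0 < r i <= delta)%R) /\
  trivIset D (fun i => metric_closed_ball (x i) (r i)).

Definition packing_premeasure_at s delta A : \bar R :=
  ereal_sup [set e | exists D x r, is_packing delta A D x r /\
    e = \esum_(i in D) (((2 * r i) `^ s)%R)%:E].

Definition packing_premeasure s A : \bar R :=
  ereal_inf [set packing_premeasure_at s delta A | delta in
    [set delta | (0 < delta)%R]].

Definition packing_measure s A : \bar R :=
  ereal_inf [set \sum_(0 <= i <oo) packing_premeasure s (B i) | B in
    [set B : nat -> set T | A `<=` \bigcup_i B i]].

Definition packing_dim A : \bar R :=
  ereal_inf [set s%:E | s in [set s | (0 <= s)%R /\ packing_measure s A = 0]].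

End dimensions.

(* Empty, or a continuous image of the Baire space. *)
Definition analytic_set (T : topologicalType) (A : set T) : Prop :=
  A = set0 \/
  exists f : prod_topology (fun _ : nat => nat) -> T,
    continuous f /\ range f = A.

Section random_covering.
Context (R : realType) (d : nat) (disp : measure_display).
Context (Omega : measurableType disp) (P : probability Omega R).

(* Mutual independence: the product rule for every finite subfamily. *)
Definition independent_seq (xi : nat -> {RV P >-> torus R d}) : Prop :=
  forall (J : {fset nat}) (A : nat -> set (torus R d)),
    (forall j, measurable (A j)) ->
    P (\bigcap_(j in [set` J]) (xi j @^-1` A j)) =
    (\prod_(j <- J) P (xi j @^-1` A j))%E.

Definition uniform_on_torus (X : {RV P >-> torus R d}) : Prop :=
  forall A, measurable A -> distribution P X A = torus_lebesgue R d A.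

(* Sequences are indexed from 0: [l n] and [xi n] are the (n+1)-st terms of the
   sequences indexed from 1. [ball] is the open ball. *)
Definition covering_set (l : nat -> R) (xi : nat -> {RV P >-> torus R d})
    (w : Omega) : set (torus R d) :=
  lim_sup_set (fun n => ball (xi n w) (l n / 2)).

(* [A] belongs to the completion of [P] and has measure [p] there. Hitting
   events of an analytic set need not be measurable before completion. *)
Definition completed_prob (A : set Omega) (p : \bar R) : Prop :=
  exists B N, [/\ measurable B, P.-negligible N, A = B `|` N & P B = p].

End random_covering.

Definition covering_exponent (R : realType) (d : nat) (l : nat -> R) : R :=
  sup [set s | 0 <= s <= d%:R /\ (\sum_(0 <= n <oo) (l n `^ s)%:E = +oo)%E].

(* Main.v *)
Require Import Defs.
From mathcomp Require Import all_boot all_order all_algebra finmap.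
From mathcomp Require Import ring lra zify.
From mathcomp Require Import all_classical all_reals all_analysis measurable_realfun.

Set Implicit Arguments.
Unset Strict Implicit.
Unset Printing Implicit Defensive.

Import Order.TTheory GRing.Theory Num.Theory.
Import numFieldNormedType.Exports.

Local Open Scope classical_set_scope.
Local Open Scope ring_scope.

(** The torus is cut into dyadic cells; a cell of side 2^-k is coded by the word
    of its k binary digits (one digit is a vector of d bits), the most recent
    digit first, so that a cell contains another one when its word is a suffix
    of the word of the other. Two elementary facts link words and metric: a
    cell of side 2^-k has diameter at most d 2^-k, and a ball of radius 2^-k
    meets at most 3^d of these cells. Hausdorff measures are therefore replaced
    by the dyadic content, the infimum of the sums of 2^(-ks) over the covers by
    cells, which has the same null sets.

    Upper bound. If dim_P F < s, then F is a countable union of sets A such that,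
    for each k, at most C 2^(ks) cells of side 2^-k meet A
    ([packing_dim_box_counted]). The n-th ball then meets A with probability at
    most C' l_n^(d - s), so the sum of l_n^t over the balls that meet A has finite
    expectation when the series of the l_n^(d - s + t) converges, in particular
    when alpha < d - s + t <= d. Almost surely the tails of that sum cover E
    meet A, whose t-dimensional content vanishes; for t = 0 only finitely many
    balls meet A and E misses A ([hits_ae]). If d - s + t > d, the set A itself
    has null t-dimensional content.

    Lower bound. Let 0 < t < dim_H F + alpha - d and choose s < dim_H F such that
    u = d - s + t is smaller than some exponent at which the series of the l_n
    diverges. Then F has positive s-content, and
    - it contains a compact set K of positive s-content ([analytic_compact]),
      because the content is continuous along increasing sequences of arbitrary
      sets ([content_increasing]);
    - distributing the content of K from each cell to its children gives an
      additive mass on the cells, carried by K, with mass at most 2^(-ks) on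
      the cells of side 2^-k ([exists_mass_below_content]);
    - let Z_j be a cell of side 2^-(m_j), comparable with l_j, that contains
      the j-th centre and lies in the j-th ball. Replace a mass by the average,
      over a block of indices j, of its normalised restrictions to the Z_j, with
      weights proportional to 2^(-u m_j). This does not change the mean of any
      cell, and the expected energy of the perturbation, for the energy that
      sums 2^(kt) nu(v)^2 over all levels k and all cells v of level k, is at
      most a constant divided by the sum of the weights 2^(-u m_j) over the
      block ([mean_reweight_energy]). This sum diverges, so a long block moves
      the mass by as little as desired;
    - only countably many masses can be reached by finitely many such steps, so
      almost surely the procedure can be continued for ever, with total mass
      bounded below and energy bounded above ([random_masses]);
    - the k-th mass is carried by K and by finitely many of the balls in each of
      the first k blocks. By compactness a cover of E meet K covers the carrier
      of one of these masses, and the Cauchy-Schwarz inequality bounds the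
      t-dimensional sum of the cover from below by the square of the total mass
      over the energy ([content_of_intersection]).
    Hence E meet F has positive t-dimensional content almost surely. This gives
    the lower bound for its dimension and, when dim_H F > d - alpha, that it is
    not empty. *)

(** * Dyadic content *)

Lemma ler_sum_uniq_sub (R : numDomainType) (I : eqType) (s r : seq I) (F : I -> R) :
  (forall i, 0 <= F i) -> uniq s -> uniq r -> {subset s <= r} ->
  \sum_(i <- s) F i <= \sum_(i <- r) F i.
Proof.
move=> F0 us ur sr; rewrite [leRHS](bigID (fun i => i \in s))/= -[X in _ <= X + _]big_filter.
rewrite (perm_big [seq i <- r | i \in s]); first by rewrite lerDl sumr_ge0.
apply: uniq_perm => //; first exact: filter_uniq.
by move=> i; rewrite mem_filter andb_idr//; exact: sr.
Qed.

Section dyadic_content.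
Context (R : realType) (B : finType) (T : Type) (digit : T -> nat -> B).
Context (rho : R).
Hypothesis rho01 : 0 < rho < 1.
Local Notation word := (seq B).
Implicit Types (A S : set T) (u v : word) (C : set word).

(** The digits come in reverse order: children are obtained by [cons], and
    the cells containing a given one are its suffixes. *)
Fixpoint prefix_word k (x : T) : word :=
  if k is k'.+1 then digit x k' :: prefix_word k' x else [::].

Definition cell u : set T := [set x | prefix_word (size u) x = u].

Lemma size_prefix_word k x : size (prefix_word k x) = k.
Proof. by elim: k => //= k ->. Qed.

Lemma drop_prefix_word k j x : drop j (prefix_word k x) = prefix_word (k - j) x.
Proof. by elim: k j => [|k IH] [|j] //=; rewrite IH subSS. Qed.

Lemma cell_prefix_word k x : cell (prefix_word k x) x.
Proof. by rewrite /cell/= size_prefix_word. Qed.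

Lemma suffix_prefix_word j k x : (j <= k)%N -> suffix (prefix_word j x) (prefix_word k x).
Proof. by move=> jk; rewrite suffixE !size_prefix_word drop_prefix_word subKn. Qed.

Lemma cell_suffix u v : suffix u v -> cell v `<=` cell u.
Proof.
move=> /suffixP[w ->] x; rewrite /cell/= size_cat => xw.
have := drop_prefix_word (size w + size u) (size w) x.
by rewrite xw drop_size_cat// addKn => <-.
Qed.

Lemma cell_nested u v x : cell u x -> cell v x -> (size u <= size v)%N -> suffix u v.
Proof. by move=> <- <-; rewrite !size_prefix_word => /suffix_prefix_word. Qed.

Lemma cell_child u x : cell u x -> cell (digit x (size u) :: u) x.
Proof. by rewrite /cell/= => ->. Qed.

Lemma cell_nil : cell [::] = setT.
Proof. by apply/seteqP; split=> // x _. Qed.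

(** Phrased with finite sublists so that no infinite sum is needed. With
    [rho = 2^-s] the sum is the s-dimensional sum of a cover. *)
Definition weight_le C (c : R) := forall s : seq word, uniq s ->
  (forall u, u \in s -> C u) -> \sum_(u <- s) rho ^+ size u <= c.

Definition covers C A := forall x, A x -> exists2 u, C u & cell u x.

Definition cover_weight A : set R := [set c | exists2 C, covers C A & weight_le C c].

Definition content A : R := inf (cover_weight A).

Let rho0 : 0 <= rho. Proof. by case/andP: rho01 => /ltW. Qed.

Lemma cover_weight_ge0 A c : cover_weight A c -> 0 <= c.
Proof. by case=> C _ /(_ [::] isT); rewrite big_nil; apply. Qed.

Lemma weight_le_set1 u : weight_le [set u] (rho ^+ size u).
Proof.
move=> s us su; case: s us su => [|v [|w s]] us su.
- by rewrite big_nil exprn_ge0.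
- by rewrite big_seq1 (su v) ?mem_head.
- have vu := su v (mem_head _ _); have wu : w = u by apply: su; rewrite !inE eqxx orbT.
  by move: us; rewrite vu wu /= inE eqxx.
Qed.

Lemma cover_weight_has_lbound A : has_lbound (cover_weight A).
Proof. by exists 0 => c /cover_weight_ge0. Qed.

Lemma cover_weight_cell A u : A `<=` cell u -> cover_weight A (rho ^+ size u).
Proof. by move=> Au; exists [set u]; [move=> x /Au xu; exists u|exact: weight_le_set1]. Qed.

Lemma cover_weight_has_inf A : has_inf (cover_weight A).
Proof.
split; last exact: cover_weight_has_lbound.
by exists (rho ^+ size ([::] : word)); apply: cover_weight_cell; rewrite cell_nil.
Qed.

Lemma content_ge0 A : 0 <= content A.
Proof. by apply: lb_le_inf; [case: (cover_weight_has_inf A)|move=> c /cover_weight_ge0]. Qed.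

Lemma content_le_cover A c : cover_weight A c -> content A <= c.
Proof. by move=> Ac; apply: ge_inf => //; exact: cover_weight_has_lbound. Qed.

Lemma content_le_cell A u : A `<=` cell u -> content A <= rho ^+ size u.
Proof. by move=> /cover_weight_cell/content_le_cover. Qed.

Lemma content_lt_cover A c : content A < c -> exists C c', [/\ covers C A, weight_le C c' & c' < c].
Proof.
move=> Ac; have [c' [C CA Cc'] c'c] := @inf_lt _ (cover_weight A) c (cover_weight_has_inf A).1 Ac.
by exists C, c'.
Qed.

Lemma content_mono A S : A `<=` S -> content A <= content S.
Proof.
move=> AS; apply: lb_le_inf; first by case: (cover_weight_has_inf S).
by move=> c [C CS Cc]; apply: content_le_cover; exists C => // x /AS /CS.
Qed.

Lemma content0 : content set0 = 0.
Proof.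
apply/eqP; rewrite eq_le content_ge0 andbT; apply: content_le_cover.
exists set0 => // -[|u s] us su; first by rewrite big_nil.
by have := su u (mem_head _ _).
Qed.

(** Each word of a finite sublist is charged to one index whose family
    contains it. *)
Lemma weight_le_bigcup (I : choiceType) (D : set I) (C : I -> set word) (c : I -> R) (e : R) :
  (forall i, D i -> weight_le (C i) (c i)) ->
  (forall s : seq I, uniq s -> (forall i, i \in s -> D i) -> \sum_(i <- s) c i <= e) ->
  weight_le (\bigcup_(i in D) C i) e.
Proof.
move=> wC ce s us sC.
case: s us sC => [|v0 s0] us sC.
  by have := ce [::] isT; rewrite !big_nil; apply.
have [i0 _ _] := sC v0 (mem_head _ _); move: {s0}(v0 :: s0) us sC => s us sC.
have [f fP] : exists f : word -> I, forall u, u \in s -> D (f u) /\ C (f u) u.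
  suff /choice[f fP] : forall u, exists i, u \in s -> D i /\ C i u by exists f.
  move=> u; have [us'|_] := boolP (u \in s); last by exists i0.
  by have [i Di Ciu] := sC u us'; exists i.
have -> : \sum_(u <- s) rho ^+ size u =
   \sum_(i <- undup (map f s)) \sum_(u <- s | f u == i) rho ^+ size u.
  rewrite (exchange_big_dep xpredT)//= big_seq [RHS]big_seq.
  apply: eq_bigr => u us'; rewrite (big_rem (f u))/=; last by rewrite mem_undup map_f.
  rewrite eqxx big1_seq ?addr0// => i /andP[/eqP <-].
  by rewrite mem_rem_uniq ?undup_uniq// inE eqxx.
apply: (@le_trans _ _ (\sum_(i <- undup (map f s)) c i)).
  rewrite big_seq [leRHS]big_seq; apply: ler_sum => i; rewrite mem_undup => /mapP[u us' ->].
  rewrite -big_filter; apply: wC; first by case: (fP u us').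
    exact: filter_uniq.
  by move=> v; rewrite mem_filter => /andP[/eqP <- /fP[]].
apply: ce; rewrite ?undup_uniq// => i; rewrite mem_undup => /mapP[u us' ->].
by case: (fP u us').
Qed.

Lemma sum_half_pickle (I : countType) (s : seq I) : uniq s ->
  \sum_(i <- s) (2^-1 : R) ^+ (choice.pickle i).+1 <= 1.
Proof.
move=> us; rewrite -(big_map (@choice.pickle I) xpredT (fun n => (2^-1 : R) ^+ n.+1)).
have : uniq (map (@choice.pickle I) s) by rewrite map_inj_uniq//; exact: pcan_inj pickleK.
move: (map _ s) => {us}{}s us; pose m := (\max_(i <- s) i).+1.
apply: (@le_trans _ _ (\sum_(i < m) (2^-1 : R) ^+ i.+1)).
  rewrite -(big_mkord xpredT (fun i => (2^-1 : R) ^+ i.+1)).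
  apply: ler_sum_uniq_sub => //; rewrite ?iota_uniq// => i si.
  by rewrite mem_index_iota; exact: leq_bigmax_seq.
have -> : \sum_(i < m) (2^-1 : R) ^+ i.+1 = 1 - 2^-1 ^+ m.
  elim: (m) => [|k IH]; first by rewrite big_ord0 expr0 subrr.
  by rewrite big_ord_recr/= IH exprS; field.
by rewrite lerBlDr lerDl; apply: exprn_ge0; lra.
Qed.

(** Countable subadditivity: near-optimal covers of the [A i] with errors
    that sum to at most [n]. *)
Lemma content_bigcup (I : countType) (D : set I) (A : I -> set T) e :
  (forall s : seq I, uniq s -> (forall i, i \in s -> D i) -> \sum_(i <- s) content (A i) <= e) ->
  content (\bigcup_(i in D) A i) <= e.
Proof.
move=> Ae; apply/ler_addgt0Pr => n n0.
have /choice[C CP] : forall i, exists C, covers C (A i) /\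
    weight_le C (content (A i) + n * 2^-1 ^+ (choice.pickle i).+1).
  move=> i; have [|C [c [CA Cc ci]]] := @content_lt_cover (A i) (content (A i) + n * 2^-1 ^+ (choice.pickle i).+1).
    by rewrite ltrDl mulr_gt0// exprn_gt0.
  by exists C; split=> // s us sC; rewrite (le_trans (Cc s us sC))// ltW.
apply: content_le_cover; exists (\bigcup_(i in D) C i).
  move=> x [i Di /(proj1 (CP i))[u Cu ux]]; exists u => //; by exists i.
apply: (weight_le_bigcup (c := fun i => content (A i) + n * 2^-1 ^+ (choice.pickle i).+1)).
  by move=> i _; case: (CP i).
move=> s us sD; rewrite big_split/= -mulr_sumr lerD ?Ae//.
by rewrite ler_piMr ?sum_half_pickle// ltW.
Qed.

Lemma content_null_bigcup (A : nat -> set T) : (forall n, content (A n) <= 0) ->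
  content (\bigcup_n A n) <= 0.
Proof.
move=> A0; apply: content_bigcup => s _ _; exact: sumr_le0.
Qed.

Lemma contentU A S : content (A `|` S) <= content A + content S.
Proof.
rewrite -bigcup2E.
have -> : \bigcup_i bigcup2 A S i = \bigcup_(i in [set b : bool | true]) (if i then A else S).
  apply/seteqP; split=> x.
    by case=> [[|[|]]] //= _ Ax; [exists true|exists false].
  by case=> [[]] _ Ax; [exists 0%N|exists 1%N].
apply: content_bigcup => s us _.
rewrite -(addr0 (content S)); have -> : content A + (content S + 0) = \sum_(i <- [:: true; false]) content (if i then A else S).
  by rewrite !big_cons big_nil.
have -> : \sum_(i <- s) content (if i then A else S) = \sum_(i <- [:: true; false] | i \in s) content (if i then A else S).
  rewrite -[RHS]big_filter; apply: perm_big; apply: uniq_perm => //.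
    by rewrite filter_uniq.
  by move=> b; rewrite mem_filter; case: b; rewrite ?inE ?andbT.
by rewrite big_mkcond/=; apply: ler_sum => b _; case: ifP => // _; exact: content_ge0.
Qed.

(** A cover cheaper than the cell [u] itself uses no cell containing [u], so it
    splits into covers of the pieces of [A] in the children of [u]. *)
Lemma content_children A u : content (A `&` cell u) < rho ^+ size u ->
  \sum_b content (A `&` cell (b :: u)) <= content (A `&` cell u).
Proof.
move=> Au; apply/ler_addgt0Pr => n n0.
have [|C [c [CA Cc cu]]] := @content_lt_cover (A `&` cell u) (Num.min (rho ^+ size u) (content (A `&` cell u) + n)).
  by rewrite lt_min Au ltrDl.
move: cu; rewrite lt_min => /andP[cu cn]; apply: le_trans (ltW cn).
have nosuf v : C v -> ~~ suffix v u.
  move=> Cv; apply/negP => /suffixP[w E].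
  have vc : rho ^+ size v <= c.
    by have := Cc [:: v] isT; rewrite big_seq1; apply=> z; rewrite inE => /eqP ->.
  move: (le_lt_trans vc cu); rewrite E size_cat exprD.
  rewrite ltNge => /negP; apply; rewrite ler_piMl ?exprn_ge0// exprn_ile1//.
  by case/andP: rho01 => _ /ltW.
pose Cb b := [set v | C v /\ suffix (b :: u) v].
have covb b : covers (Cb b) (A `&` cell (b :: u)).
  move=> x [Ax xbu]; have xu : cell u x by apply: cell_suffix xbu; exact: suffix_cons.
  have [v Cv vx] := CA x (conj Ax xu); exists v => //; split=> //.
  apply: (cell_nested xbu vx) => /=; rewrite ltnNge; apply: contra (nosuf v Cv).
  exact: cell_nested vx xu.
have near_b e : 0 < e -> forall b, exists s : seq word, [/\ uniq s, forall v, v \in s -> Cb b v &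
    content (A `&` cell (b :: u)) - e < \sum_(v <- s) rho ^+ size v].
  move=> e0 b; apply: contrapT => ns.
  have : content (A `&` cell (b :: u)) <= content (A `&` cell (b :: u)) - e.
    apply: content_le_cover; exists (Cb b) => // s us sC; rewrite leNgt; apply/negP => sc.
    by apply: ns; exists s.
  by rewrite lerBrDl gerDr leNgt e0.
apply/ler_addgt0Pr => e e0.
have e1 : 0 < e / (#|B|.+1)%:R by rewrite divr_gt0.
have [s sP] := choice (near_b _ e1).
apply: (@le_trans _ _ (\sum_b (\sum_(v <- s b) rho ^+ size v + e / (#|B|.+1)%:R))).
  by apply: ler_sum => b _; case: (sP b) => _ _ /ltW; rewrite lerBlDr.
rewrite big_split/=; apply: lerD; last first.
  rewrite sumr_const -mulrnAr -[leRHS]mulr1 ler_wpM2l ?(ltW e0)// -mulr_natr.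
  by rewrite mulrC ler_pdivrMr// mul1r ler_nat cardE.
have -> : \sum_b \sum_(v <- s b) rho ^+ size v =
    \sum_(v <- [seq v | b <- enum B, v <- s b]) rho ^+ size v.
  by rewrite big_allpairs_dep/= big_enum.
apply: Cc; last by move=> v /allpairsPdep[b [w [_ wb ->]]]; case: (sP b) => _ /(_ w wb)[].
apply: allpairs_uniq_dep; first exact: enum_uniq; first by move=> b _; case: (sP b).
move=> [b v] [b' v'] /allpairsPdep[b1 [v1 [_ v1s [-> ->]]]] /allpairsPdep[b2 [v2 [_ v2s [-> ->]]]] /= vv.
move: v1s v2s; rewrite vv => v1s v2s.
have [_ /(_ _ v1s)[_ S1] _] := sP b1.
have [_ /(_ _ v2s)[_ S2] _] := sP b2.
by move: S1 S2; rewrite !suffixE/= => /eqP -> /eqP[->].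
Qed.

(** ** Increasing unions *)

Section increasing.
Variable A : nat -> set T.
Hypothesis A_ndecr : forall n k, (n <= k)%N -> A n `<=` A k.

Let m u := sup (range (fun n => content (A n `&` cell u))).

Let m_ub u n : content (A n `&` cell u) <= m u.
Proof.
apply: ub_le_sup; last by exists n.
by exists (rho ^+ size u) => _ [k _ <-]; apply: content_le_cell => x [].
Qed.

Let m_lt u c : c < m u -> exists n, c < content (A n `&` cell u).
Proof.
move=> cm; have [|_ [n _ <-] cn] := @sup_gt _ (range (fun n => content (A n `&` cell u))) c _ cm.
  by exists (content (A 0%N `&` cell u)); exists 0%N.
by exists n.
Qed.

Let m_ge0 u : 0 <= m u.
Proof. by apply: le_trans (m_ub u 0); exact: content_ge0. Qed.

Let m_children u : m u < rho ^+ size u -> \sum_b m (b :: u) <= m u.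
Proof.
move=> mu; apply/ler_addgt0Pr => e e0.
have e1 : 0 < e / (#|B|.+1)%:R by rewrite divr_gt0.
have /choice[n nP] : forall b, exists n, m (b :: u) - e / (#|B|.+1)%:R < content (A n `&` cell (b :: u)).
  by move=> b; apply: m_lt; rewrite gtrDl oppr_lt0.
pose N := \max_b n b.
apply: (@le_trans _ _ (\sum_b (content (A N `&` cell (b :: u)) + e / (#|B|.+1)%:R))).
  apply: ler_sum => b _; rewrite -lerBlDr (le_trans (ltW (nP b)))//.
  by apply: content_mono; apply: setSI; apply: A_ndecr; exact: leq_bigmax.
rewrite big_split/=; apply: lerD; last first.
  rewrite sumr_const -mulrnAr -[leRHS]mulr1 ler_wpM2l ?(ltW e0)// -mulr_natr.
  by rewrite mulrC ler_pdivrMr// mul1r ler_nat cardE.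
apply: le_trans (m_ub u N); apply: content_children; exact: le_lt_trans (m_ub u N) mu.
Qed.

Variable e : R.
Hypotheses (e_gt0 : 0 < e) (e_lt1 : e < 1).

Let sat u := (1 - e) * rho ^+ size u <= m u.
Let min_sat u := sat u /\ forall v, sat v -> suffix v u -> v = u.

Let wle_min_sat_aux k u (s : seq word) : uniq s ->
  (forall v, v \in s -> [/\ min_sat v, suffix u v & (size v <= size u + k)%N]) ->
  (1 - e) * \sum_(v <- s) rho ^+ size v <= m u.
Proof.
elim: k u s => [|k IH] u s us sP.
  have sE : s = [::] \/ s = [:: u].
    have su v : v \in s -> v = u.
      move=> /sP[_ /suffixP[w ->]]; rewrite size_cat addn0 -[leqRHS]add0n leq_add2r leqn0.
      by move=> /nilP ->.
    case: s us su {sP} => [|v [|w s]] us su; [by left|by right; rewrite (su v (mem_head _ _))|].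
    have vu := su v (mem_head _ _); have wu : w = u by apply: su; rewrite !inE eqxx orbT.
    by move: us; rewrite vu wu /= inE eqxx.
  case: sE sP => -> sP; first by rewrite big_nil mulr0.
  by rewrite big_seq1; case: (sP u (mem_head _ _)) => -[].
have [us'|us'] := boolP (u \in s).
  have [[satu _] _ _] := sP u us'.
  rewrite (_ : \sum_(v <- s) _ = rho ^+ size u)//.
  rewrite (big_rem u)//= big1_seq ?addr0// => v /andP[_]; rewrite mem_rem_uniq// inE => /andP[vu vs].
  have [[_ /(_ u satu) minv] uv _] := sP v vs.
  by move: vu; rewrite (minv uv) eqxx.
have [s0|[v0 v0s]] : s = [::] \/ exists v, v \in s.
  by case: (s) => [|v s']; [left|right; exists v; rewrite mem_head].
  by rewrite s0 big_nil mulr0.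
have nsat : ~ sat u.
  move=> satu; have [[_ /(_ u satu) minv] uv _] := sP v0 v0s.
  by move: us'; rewrite (minv uv) v0s.
(* [u] is not saturated, so the content passes to its children. *)
have mu : m u < rho ^+ size u.
  move/negP: nsat; rewrite -ltNge => /lt_le_trans; apply.
  by rewrite ler_piMl ?exprn_ge0// gerBl ltW.
apply: le_trans (m_children mu).
have child v : v \in s -> exists b, suffix (b :: u) v.
  move=> vs; have [_ /suffixP[w vE] _] := sP v vs; move: vE vs.
  case/lastP: w => [/= -> us''|w b ->]; first by rewrite us'' in us'.
  by exists b; apply/suffixP; exists w; rewrite cat_rcons.
have -> : \sum_(v <- s) rho ^+ size v = \sum_b \sum_(v <- s | suffix (b :: u) v) rho ^+ size v.
  rewrite (exchange_big_dep xpredT)//= big_seq [RHS]big_seq; apply: eq_bigr => v vs.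
  have [b bv] := child v vs; rewrite (bigD1 b)//= big1 ?addr0// => b' /andP[].
  by move: bv; rewrite !suffixE/= => /eqP -> /eqP[->]; rewrite eqxx.
rewrite mulr_sumr; apply: ler_sum => b _; rewrite -big_filter.
apply: IH; first exact: filter_uniq.
move=> v; rewrite mem_filter => /andP[bv /sP[mv uv sv]]; split=> //.
by rewrite (leq_trans sv)//= addSnnS.
Qed.

Let wle_min_sat : weight_le [set u | min_sat u] (m [::] / (1 - e)).
Proof.
move=> s us sP; rewrite ler_pdivlMr; last by rewrite subr_gt0.
rewrite mulrC; apply: (@wle_min_sat_aux (\max_(v <- s) size v)) => // v vs.
by split; [exact: sP|exact: suffix0s|rewrite add0n; exact: leq_bigmax_seq].
Qed.

Let min_sat_ex u x : sat u -> cell u x -> exists2 v, min_sat v & cell v x.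
Proof.
have [k] := ubnP (size u); elim: k u => // k IH u uk satu xu.
have [[v [satv vu nvu]]|nv] := pselect (exists v, [/\ sat v, suffix v u & v <> u]).
  apply: (IH v) => //; last exact: cell_suffix vu _ xu.
  rewrite ltnS in uk; apply: leq_trans uk; rewrite ltn_neqAle size_suffix// andbT.
  apply/eqP => E; apply: nvu; move/suffixP: vu => [w uE]; move: E.
  by rewrite uE size_cat -{1}[size v]add0n => /addIn/esym/size0nil ->.
exists u => //; split=> // v satv vu; apply: contrapT => nvu; apply: nv; by exists v.
Qed.

Let rest n := A n `\` \bigcup_(u in [set u | min_sat u]) cell u.

Let rest_null n : content (rest n) <= 0.
Proof.
have key u : content (rest n `&` cell u) <= (1 - e) * rho ^+ size u.
  have [satu|nsat] := boolP (sat u).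
    rewrite (_ : rest n `&` cell u = set0) ?content0 ?mulr_ge0 ?exprn_ge0//; first (move: (e_gt0) (e_lt1) => *; lra).
    rewrite -subset0 => x [[_ nx] xu]; apply: nx.
    by have [v mv vx] := min_sat_ex satu xu; exists v.
  move: nsat; rewrite /sat -ltNge => /ltW; apply: le_trans.
  apply: le_trans (m_ub u n); apply: content_mono => x [[]] //.
have : forall d, 0 < d -> content (rest n) <= (1 - e) * (content (rest n) + d).
  move=> d d0; have [|C [c [CA Cc ci]]] := @content_lt_cover (rest n) (content (rest n) + d).
    by rewrite ltrDl.
  apply: (@le_trans _ _ ((1 - e) * c)); last by rewrite ler_wpM2l ?(ltW ci)//; (move: (e_gt0) (e_lt1) => *; lra).
  have -> : rest n = \bigcup_(u in C) (rest n `&` cell u).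
    apply/seteqP; split=> [x rx|x [u _ []]//].
    by have [u Cu ux] := CA x rx; exists u.
  apply: content_bigcup => s us sC; apply: le_trans (ler_sum _ (fun u _ => key u)) _.
  by rewrite -mulr_sumr ler_wpM2l ?Cc//; (move: (e_gt0) (e_lt1) => *; lra).
(* Contradiction for a small enough [d] if the content is positive. *)
move=> h; rewrite leNgt; apply/negP => c0.
have := h (e * content (rest n) / 2); move: (e_gt0) (e_lt1) => *; nra.
Qed.

(** Call a cell saturated when the limit of the contents of its pieces of the
    [A n] is at least [(1 - e)] times its weight. Outside the saturated cells
    the content passes additively to the children, so the maximal saturated
    cells weigh at most [c / (1 - e)]. What they leave uncovered in [A n] has
    content at most [(1 - e)] times the weight of any cell in that cell, hence
    at most [(1 - e)] times its own content, hence zero. *)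
Lemma content_increasing_slack c : (forall n, content (A n) <= c) ->
  content (\bigcup_n A n) <= c / (1 - e).
Proof.
move=> Ac.
have mc : m [::] <= c.
  apply: ge_sup; first by exists (content (A 0%N `&` cell [::])); exists 0%N.
  by move=> _ [n _ <-]; apply: le_trans (Ac n); exact: content_mono.
apply: (@le_trans _ _ (content (\bigcup_n rest n `|` \bigcup_(u in [set u | min_sat u]) cell u))).
  apply: content_mono => x [n _ Anx].
  have [h|h] := pselect ((\bigcup_(u in [set u | min_sat u]) cell u) x); first by right.
  by left; exists n.
apply: (le_trans (contentU _ _)); rewrite -[leRHS]add0r; apply: lerD.
  exact: content_null_bigcup.
apply: (@le_trans _ _ (m [::] / (1 - e))); last by rewrite ler_wpM2r// invr_ge0; (move: (e_gt0) (e_lt1) => *; lra).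
apply: content_le_cover; exists [set u | min_sat u] => //.
Qed.
End increasing.

(** Continuity along increasing unions, for arbitrary sets. This is what lets a
    compact set be extracted from an analytic one. *)
Lemma content_increasing (A : nat -> set T) c :
  (forall n k, (n <= k)%N -> A n `<=` A k) ->
  c < content (\bigcup_n A n) -> exists n, c < content (A n).
Proof.
move=> Aincr cA; apply: contrapT => nA.
have Ac n : content (A n) <= c by rewrite leNgt; apply/negP => cn; apply: nA; exists n.
have c0 : 0 <= c by apply: le_trans (Ac 0%N); exact: content_ge0.
have := @content_increasing_slack A Aincr.
set M := content _ in cA *.
have M0 : 0 < M by exact: le_lt_trans cA.
move=> /(_ ((M - c) / (2 * M))); rewrite divr_gt0 ?subr_gt0 ?mulr_gt0// ltr_pdivrMr ?mulr_gt0// => /(_ isT).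
have -> : M - c < 1 * (2 * M) by lra.
move=> /(_ isT c Ac); rewrite -/M.
have -> : 1 - (M - c) / (2 * M) = (M + c) / (2 * M).
  by field; rewrite gt_eqF.
rewrite invf_div mulrA ler_pdivlMr; last by lra.
nra.
Qed.

End dyadic_content.

(** * Masses on the tree of cells *)

Section words.
Context (B : finType).
Fixpoint words k : seq (seq B) :=
  if k is k'.+1 then [seq b :: u | u <- words k', b <- enum B] else [:: [::]].

Lemma mem_words k u : (u \in words k) = (size u == k).
Proof.
elim: k u => [|k IH] [|b u] //=; first by apply/negbTE/allpairsP => -[[v c]] [].
rewrite eqSS -IH; apply/allpairsP/idP => [[[v c]] /= [vk _ [_ ->]]//|uk].
by exists (u, b); rewrite mem_enum.
Qed.

Lemma uniq_words k : uniq (words k).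
Proof.
elim: k => //= k IH; apply: allpairs_uniq => //; first exact: enum_uniq.
by move=> [u b] [v c] _ _ [-> ->].
Qed.

Lemma big_wordsS (R : nmodType) k (F : seq B -> R) :
  \sum_(u <- words k.+1) F u = \sum_(u <- words k) \sum_b F (b :: u).
Proof. by rewrite big_allpairs_dep; apply: eq_bigr => u _; rewrite big_enum. Qed.
End words.

Section mass.
Context (R : realType) (B : finType).
Local Notation word := (seq B).
Implicit Types (nu : word -> R) (u v z : word).

(** Finitely additive masses on cells; the partial sums over a level play the
    part of the measure, and no limit measure is built. *)
Definition tree_mass nu := (forall u, 0 <= nu u) /\ (forall u, nu u = \sum_b nu (b :: u)).

Lemma tree_mass_total nu k : tree_mass nu -> \sum_(u <- words B k) nu u = nu [::].
Proof.
case=> _ nuS; elim: k => [|k IH]; first by rewrite /= big_seq1.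
by rewrite big_wordsS -IH; apply: eq_bigr => u _; rewrite -nuS.
Qed.

Lemma tree_mass_descendants nu k u : tree_mass nu -> \sum_(w <- words B k) nu (w ++ u) = nu u.
Proof.
move=> [nu0 nuS]; rewrite (@tree_mass_total (fun w => nu (w ++ u)))//.
Qed.

Lemma tree_mass_le nu u v : tree_mass nu -> suffix u v -> nu v <= nu u.
Proof.
move=> [nu0 nuS] /suffixP[w ->]; elim: w => //= b w; apply: le_trans.
by rewrite [leRHS]nuS (bigD1 b)//= lerDl; apply: sumr_ge0.
Qed.

(** A discrete Frostman lemma. The mass of a cell is shared among its children
    in proportion to their contents; by subadditivity of the content the mass
    of a cell never exceeds its content. *)
Lemma exists_mass_below_content (T : Type) (digit : T -> nat -> B) (rho : R) (A : set T) :
  0 < rho < 1 ->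
  exists nu, [/\ tree_mass nu, nu [::] = content digit rho A &
    forall u, nu u <= content digit rho (A `&` cell digit u)].
Proof.
move=> rho01; pose M u := content digit rho (A `&` cell digit u).
have M0 u : 0 <= M u by exact: content_ge0.
have MS u : M u <= \sum_b M (b :: u).
  have -> : M u = content digit rho (\bigcup_(b in [set: B]) (A `&` cell digit (b :: u))).
    congr content; apply/seteqP; split=> [x [Ax xu]|x [b _ [Ax xbu]]].
      by exists (digit x (size u)) => //; split=> //; exact: cell_child.
    by split=> //; apply: cell_suffix xbu; exact: suffix_cons.
  apply: content_bigcup => // s us _; rewrite [leRHS](bigID (fun b => b \in s))/=.
  by rewrite -big_uniq// lerDl sumr_ge0.
pose S u := \sum_b M (b :: u).
(* When all children have content 0, division by zero gives them mass 0, and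
   the mass of [u] is 0 as well since it is bounded by [M u <= S u]. *)
pose nu := fix nu u := if u is b :: v then nu v * (M u / S v) else M [::].
have S0 u : 0 <= S u by apply: sumr_ge0.
have nu0 u : 0 <= nu u by elim: u => //= b u IH; rewrite !mulr_ge0// invr_ge0.
have nuM u : nu u <= M u.
  elim: u => //= b u IH; have [S00|Sn0] := eqVneq (S u) 0.
    by rewrite S00 invr0 !mulr0.
  rewrite mulrCA -[leRHS]mulr1 ler_wpM2l// ler_pdivrMr ?lt_def ?Sn0 ?S0// mul1r.
  exact: le_trans IH (MS u).
exists nu; split=> //.
  split=> // u; rewrite /= -mulr_sumr -mulr_suml -/(S u).
  have [S00|Sn0] := eqVneq (S u) 0; last by rewrite divff// mulr1.
  rewrite S00 invr0 !mulr0; apply/eqP; rewrite eq_le nu0 andbT (le_trans (nuM u))//.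
  by rewrite -S00; exact: MS.
by rewrite /nu/M cell_nil setIT.
Qed.

(** The mass of the intersection of the cells [z] and [v], two cells being
    nested or disjoint. *)
Definition restrict_mass nu z v : R :=
  if suffix z v then nu v else if suffix v z then nu z else 0.

Lemma restrict_mass_ge0 nu z v : tree_mass nu -> 0 <= restrict_mass nu z v.
Proof. by case=> nu0 _; rewrite /restrict_mass; case: ifP => // _; case: ifP. Qed.

Lemma suffix_size_eq u v : suffix u v -> size u = size v -> u = v.
Proof.
move=> /suffixP[w ->]; rewrite size_cat -{1}[size u]add0n => /addIn/esym/size0nil.
by move=> ->.
Qed.

Lemma restrict_mass_small nu z v : (size v <= size z)%N ->
  restrict_mass nu z v = if suffix v z then nu z else 0.
Proof.
rewrite /restrict_mass => vz; case: ifPn => // zv.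
have E : z = v by apply: suffix_size_eq => //; apply/eqP; rewrite eqn_leq vz size_suffix.
by rewrite E suffix_refl.
Qed.

Lemma restrict_mass_large nu z v : (size z <= size v)%N ->
  restrict_mass nu z v = if suffix z v then nu v else 0.
Proof.
rewrite /restrict_mass => vz; case: ifPn => // zv; case: ifPn => // vz'.
by move: zv; rewrite (@suffix_size_eq v z) ?suffix_refl//; apply/eqP; rewrite eqn_leq vz size_suffix.
Qed.

Lemma tree_mass_restrict nu z : tree_mass nu -> tree_mass (restrict_mass nu z).
Proof.
move=> tnu; split=> [v|v]; first exact: restrict_mass_ge0.
have [nu0 nuS] := tnu.
have [vz|zv] := ltnP (size v) (size z); last first.
  rewrite restrict_mass_large//; under eq_bigr do rewrite restrict_mass_large ?leqW//=.
  case: ifPn => zv'.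
    rewrite [LHS]nuS; apply: eq_bigr => b _; rewrite ifT//.
    by apply: suffix_trans zv' _; exact: suffix_cons.
  rewrite big1// => b _; rewrite ifN//; apply: contra zv' => /suffixP[[|c w]].
    by move=> /= zE; move: zv; rewrite -zE/= ltnn.
  by move=> [_ ->]; exact: suffix_suffix.
rewrite restrict_mass_small 1?ltnW//; under eq_bigr do rewrite restrict_mass_small//=.
case: ifPn => vz'; last first.
  rewrite big1// => b _; rewrite ifN//; apply: contra vz'; apply: suffix_trans.
  exact: suffix_cons.
have [w zE] := suffixP vz'; move: zE.
case/lastP: w => [/= zE|w b zE]; first by rewrite zE ltnn in vz.
rewrite (bigD1 b)//= ifT; last by apply/suffixP; exists w; rewrite zE cat_rcons.
rewrite big1 ?addr0// => c cb; rewrite ifN//; apply: contra cb.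
by rewrite zE suffixE cat_rcons !size_cat/= addnK drop_size_cat// => /eqP[->].
Qed.

Lemma sum_restrict_mass nu v m : tree_mass nu -> \sum_(z <- words B m) restrict_mass nu z v = nu v.
Proof.
move=> tnu; have [vm|mv] := leqP (size v) m.
  rewrite -[RHS](tree_mass_descendants (m - size v) v tnu).
  rewrite big_seq_cond (eq_bigr (fun z => if suffix v z then nu z else 0)); last first.
    by move=> z /andP[]; rewrite mem_words => /eqP zm _; rewrite restrict_mass_small ?zm.
  rewrite -big_seq_cond -big_mkcond/= -big_filter.
  rewrite -(big_map (fun w => w ++ v) xpredT nu); apply: perm_big; apply: uniq_perm.
  - by rewrite filter_uniq ?uniq_words.
  - by rewrite map_inj_uniq ?uniq_words// => w1 w2 /eqP; rewrite -(inj_eq (can_inj (@revK B))) !rev_cat eqseq_cat// eqxx/= => /eqP/(can_inj (@revK B)).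
  move=> z; rewrite mem_filter mem_words; apply/andP/mapP.
    move=> [/suffixP[w ->] /eqP wm]; exists w => //; rewrite mem_words.
    by rewrite -wm size_cat addnK.
  move=> [w]; rewrite mem_words => /eqP wm ->; rewrite suffix_suffix; split=> //.
  by rewrite size_cat wm subnK.
pose z0 := drop (size v - m) v.
have z0m : size z0 = m by rewrite size_drop subKn// ltnW.
rewrite (big_rem z0)/=; last by rewrite mem_words z0m.
rewrite big1_seq ?addr0 => [|z /andP[_]]; last first.
  rewrite mem_rem_uniq ?uniq_words// inE mem_words => /andP[zz0 /eqP zm].
  rewrite restrict_mass_large ?zm 1?ltnW// suffixE zm ifN//; apply: contra zz0 => /eqP <-.
  by rewrite /z0.
by rewrite restrict_mass_large ?z0m 1?ltnW// suffixE z0m /z0 eqxx.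
Qed.

(** The condition of Frostman with exponent s, for [rho = 2^-s]. *)
Definition frostman nu rho C := forall u, nu u <= C * rho ^+ size u.

Lemma restrict_mass_frostman nu rho C z v : 0 <= C -> 0 <= rho -> frostman nu rho C ->
  restrict_mass nu z v <= C * rho ^+ maxn (size z) (size v).
Proof.
move=> C0 rho0 fnu; rewrite /restrict_mass; case: ifPn => [/size_suffix/maxn_idPr -> //|_].
by case: ifPn => [/size_suffix/maxn_idPl -> //|_]; rewrite mulr_ge0// exprn_ge0.
Qed.

(** One of the two factors of each square is bounded by the mass condition,
    and the other one sums to [nu v]. *)
Lemma sum_restrict_mass_sqr nu rho C v m : 0 <= C -> 0 <= rho -> tree_mass nu -> frostman nu rho C ->
  \sum_(z <- words B m) restrict_mass nu z v ^+ 2 <= C * rho ^+ maxn m (size v) * nu v.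
Proof.
move=> C0 rho0 tnu fnu; rewrite -(sum_restrict_mass v m tnu) mulr_sumr big_seq [leRHS]big_seq.
apply: ler_sum => z; rewrite mem_words => /eqP zm; rewrite expr2.
by rewrite ler_wpM2r ?restrict_mass_ge0// -zm restrict_mass_frostman.
Qed.

End mass.

(** * Energy of a mass *)

Section energy.
Context (R : realType) (B : finType).
Local Notation word := (seq B).
Implicit Types (nu : word -> R) (u v z : word) (rho theta : R).

Lemma size_words k : size (words B k) = (#|B| ^ k)%N.
Proof.
by elim: k => //= k IH; rewrite size_allpairs IH expnSr cardE.
Qed.

(** With [theta = 2^-t], a dyadic version of the t-energy of a measure. *)
Definition energy theta K nu :=
  \sum_(k < K) theta ^- k * \sum_(v <- words B k) nu v ^+ 2.

(** Triangle inequality for the energy seminorm, in a form that avoids square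
    roots. *)
Lemma energy_perturb theta K nu mu (d : R) : 0 < theta -> 0 < d ->
  energy theta K mu <= (1 + d) * energy theta K nu
    + (1 + d^-1) * energy theta K (fun v => mu v - nu v).
Proof.
move=> t0 d0; rewrite /energy !mulr_sumr -big_split/=; apply: ler_sum => k _.
rewrite mulrCA (mulrCA (1 + d^-1)) -mulrDr ler_wpM2l//.
  by rewrite invr_ge0 exprn_ge0// ltW.
rewrite !mulr_sumr -big_split/=; apply: ler_sum => v _.
rewrite -subr_ge0.
have -> : (1 + d) * nu v ^+ 2 + (1 + d^-1) * (mu v - nu v) ^+ 2 - mu v ^+ 2 =
   d^-1 * (mu v - nu v - d * nu v) ^+ 2.
  by field; rewrite gt_eqF.
by rewrite mulr_ge0 ?sqr_ge0// invr_ge0 ltW.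
Qed.

Lemma geom_le (x : R) n : 0 <= x < 1 -> \sum_(k < n) x ^+ k <= (1 - x)^-1.
Proof.
move=> /andP[x0 x1]; rewrite -[leRHS]mul1r ler_pdivlMr ?subr_gt0// mulrC.
have := subrX1 x n; have := exprn_ge0 n x0; lra.
Qed.

(** The sum is geometric on both sides of [k = m], where it peaks: below [m] it
    grows like [theta^-k], above it decays like [(rho / theta)^k]. *)
Lemma scale_sum_le rho theta K m : 0 < rho -> rho < theta -> theta < 1 ->
  \sum_(k < K) theta ^- k * rho ^+ maxn m k <=
    ((1 - theta)^-1 + (1 - rho / theta)^-1) * (rho / theta) ^+ m.
Proof.
move=> r0 rt t1; have t0 : 0 < theta by exact: lt_trans rt.
have q0 : 0 < rho / theta by rewrite divr_gt0.
have q1 : rho / theta < 1 by rewrite ltr_pdivrMr// mul1r.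
have tk k : 0 < theta ^- k by rewrite invr_gt0 exprn_gt0.
apply: (@le_trans _ _ (\sum_(k < m + K) theta ^- k * rho ^+ maxn m k)).
  rewrite -(big_mkord xpredT (fun k => theta ^- k * rho ^+ maxn m k)).
  rewrite -(big_mkord xpredT (fun k => theta ^- k * rho ^+ maxn m k)).
  rewrite [leRHS](big_cat_nat (leq0n K) (leq_addl m K))/= lerDl.
  by apply: sumr_ge0 => k _; rewrite mulr_ge0 ?exprn_ge0 ?ltW.
rewrite big_split_ord/= mulrDl; apply: lerD.
  rewrite (reindex_inj rev_ord_inj)/=.
  apply: (@le_trans _ _ (\sum_(i < m) (rho / theta) ^+ m * theta ^+ i)); last first.
    rewrite -mulr_sumr mulrC ler_wpM2r ?exprn_ge0 ?(ltW q0)//.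
    by apply: geom_le; rewrite (ltW t0).
  apply: ler_sum => i _; rewrite (maxn_idPl (leq_subr _ _)) expr_div_n.
  rewrite mulrC -mulrA ler_wpM2l ?exprn_ge0 ?(ltW r0)//.
  rewrite -(@ler_pM2l _ (theta ^+ m)) ?exprn_gt0// mulrA divff ?mul1r ?gt_eqF ?exprn_gt0//.
  rewrite ler_pdivrMr ?exprn_gt0//.
  have -> : theta ^+ m = theta ^+ i.+1 * theta ^+ (m - i.+1) by rewrite -exprD subnKC.
  rewrite ler_wpM2r ?exprn_ge0 ?(ltW t0)// exprS ler_piMl ?exprn_ge0 ?ltW//.
rewrite (eq_bigr (fun i : 'I_K => (rho / theta) ^+ m * (rho / theta) ^+ i)).
  rewrite -mulr_sumr mulrC ler_wpM2r ?exprn_ge0 ?(ltW q0)//.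
  by apply: geom_le; rewrite (ltW q0).
move=> i _; rewrite (maxn_idPr (leq_addr _ _)) -exprD expr_div_n mulrC//.
Qed.

Lemma frostman_energy nu rho theta C K : tree_mass nu -> frostman nu rho C -> 0 <= C ->
  0 < rho -> rho < theta ->
  energy theta K nu <= C * nu [::] / (1 - rho / theta).
Proof.
move=> tnu fnu C0 r0 rt; have t0 : 0 < theta by exact: lt_trans rt.
have [nu0 _] := tnu.
have q0 : 0 < rho / theta by rewrite divr_gt0.
have q1 : rho / theta < 1 by rewrite ltr_pdivrMr// mul1r.
apply: (@le_trans _ _ (\sum_(k < K) (C * nu [::]) * (rho / theta) ^+ k)).
  apply: ler_sum => k _.
  apply: (@le_trans _ _ (theta ^- k * (C * rho ^+ k * nu [::]))).
    rewrite ler_wpM2l ?invr_ge0 ?exprn_ge0 ?(ltW t0)//.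
    rewrite -(tree_mass_total k tnu) mulr_sumr big_seq [leRHS]big_seq.
    apply: ler_sum => v; rewrite mem_words => /eqP vk.
    by rewrite expr2 ler_wpM2r// -vk.
  rewrite expr_div_n; lra.
rewrite -mulr_sumr ler_wpM2l ?mulr_ge0// geom_le//.
by rewrite (ltW q0).
Qed.

Lemma energy_seq nu theta K (U : seq word) : 0 < theta -> uniq U ->
  (forall u, u \in U -> (size u < K)%N) ->
  \sum_(u <- U) theta ^- size u * nu u ^+ 2 <= energy theta K nu.
Proof.
move=> t0 uU UK.
have -> : \sum_(u <- U) theta ^- size u * nu u ^+ 2 =
   \sum_(k < K) \sum_(u <- U | size u == k) theta ^- size u * nu u ^+ 2.
  rewrite (exchange_big_dep xpredT)//= big_seq [RHS]big_seq; apply: eq_bigr => u uin.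
  rewrite (bigD1 (Ordinal (UK u uin)))//= big1 ?addr0// => k /andP[/eqP uk /eqP].
  by case; apply: val_inj.
apply: ler_sum => k _; rewrite mulr_sumr.
rewrite (eq_bigr (fun u => theta ^- k * nu u ^+ 2)); last by move=> u /eqP ->.
rewrite [leRHS](bigID (fun u => u \in U))/=.
rewrite -big_filter -[X in X + _]big_filter.
rewrite (perm_big [seq u <- words B k | u \in U]).
  by rewrite lerDl sumr_ge0// => u _; rewrite mulr_ge0 ?sqr_ge0// invr_ge0 exprn_ge0 ?ltW.
apply: uniq_perm; rewrite ?filter_uniq ?uniq_words// => u.
by rewrite !mem_filter mem_words andbC.
Qed.

(** A family of cells that carries mass [b] cannot be small: by the
    Cauchy-Schwarz inequality its weight for [theta] is at least [b^2 / E]. *)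
Lemma energy_cover nu theta K (U : seq word) (E b : R) : 0 < theta -> 0 < b -> 0 < E ->
  uniq U -> (forall u, u \in U -> (size u < K)%N) ->
  energy theta K nu <= E -> b <= \sum_(u <- U) nu u ->
  b ^+ 2 <= E * \sum_(u <- U) theta ^+ size u.
Proof.
move=> t0 b0 E0 uU UK eE bU.
set S := \sum_(u <- U) theta ^+ size u.
have e1 := le_trans (energy_seq nu t0 uU UK) eE.
have : 2 * \sum_(u <- U) nu u <= b / E * \sum_(u <- U) theta ^- size u * nu u ^+ 2
    + E / b * S.
  rewrite !mulr_sumr -big_split/=; apply: ler_sum => u _.
  have tu : 0 < theta ^+ size u by rewrite exprn_gt0.
  rewrite -subr_ge0.
  have -> : b / E * (theta ^- size u * nu u ^+ 2) + E / b * theta ^+ size u - 2 * nu u =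
    (b * E * theta ^+ size u)^-1 * (b * nu u - E * theta ^+ size u) ^+ 2.
    by field; rewrite !gt_eqF.
  by rewrite mulr_ge0 ?sqr_ge0// invr_ge0 !mulr_ge0 ?ltW.
have : b / E * \sum_(u <- U) theta ^- size u * nu u ^+ 2 <= b.
  by rewrite mulrAC ler_pdivrMr// ler_wpM2l// ltW.
move=> h1 h2; have h3 : b <= E / b * S by lra.
by rewrite expr2 -ler_pdivlMr// mulrAC.
Qed.
End energy.

(** * Means of random variables *)

Section mean.
Context (R : realType) (disp : measure_display) (Omega : measurableType disp)
  (P : probability Omega R).
Implicit Types (g h : Omega -> R) (e : R) (A : set Omega).

(** Integrability and value of the integral together, so that finite linear
    combinations of indicators are handled by a few closure rules. *)
Definition mean g e :=
  P.-integrable setT (EFin \o g) /\ (\int[P]_w (g w)%:E = e%:E)%E.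

Lemma mean_indic A e : measurable A -> P A = e%:E -> mean (\1_A) e.
Proof.
by move=> mA PA; split; [exact: integrable_indic|rewrite integral_indic// setIT].
Qed.

Lemma eq_mean g h e : g =1 h -> mean g e -> mean h e.
Proof. by move=> /funext ->. Qed.

Lemma meanZ g e (c : R) : mean g e -> mean (fun w => c * g w) (c * e).
Proof.
move=> [ig eg]; split.
  by have := integrableZl measurableT c ig; apply: eq_integrable.
under eq_integral do rewrite EFinM.
by rewrite (integralZl measurableT ig) eg.
Qed.

Lemma meanD g h e e' : mean g e -> mean h e' -> mean (fun w => g w + h w) (e + e').
Proof.
move=> [ig eg] [ih eh]; split.
  by have := integrableD measurableT ig ih; apply: eq_integrable.
by rewrite (integralD_EFin measurableT ig ih) eg eh.
Qed.

Lemma mean0 : mean (fun=> 0) 0.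
Proof. by split; [exact: integrable0|rewrite integral0]. Qed.

Lemma mean_sum (I : Type) (s : seq I) (Q : pred I) (g : I -> Omega -> R) (e : I -> R) :
  (forall i, Q i -> mean (g i) (e i)) ->
  mean (fun w => \sum_(i <- s | Q i) g i w) (\sum_(i <- s | Q i) e i).
Proof.
move=> ge; elim: s => [|i s IH].
  by rewrite big_nil; apply: eq_mean mean0 => w; rewrite big_nil.
rewrite big_cons; case: ifPn => [Qi|nQ].
  by apply: (eq_mean _ (meanD (ge i Qi) IH)) => w; rewrite big_cons Qi.
by apply: eq_mean IH => w; rewrite big_cons (negbTE nQ).
Qed.

Lemma mean_measurable g e : mean g e -> measurable_fun setT g.
Proof. by move=> [/integrableP[/measurable_EFinP]]. Qed.

Lemma mean_markov g e (c : R) : 0 < c -> mean g e -> (forall w, (0 <= g w)%R) ->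
  (P [set w | (c <= g w)%R] <= (e / c)%:E)%E.
Proof.
move=> c0 [ig eg] g0.
have mg : measurable_fun setT g by have /integrableP[/measurable_EFinP] := ig.
have mA : measurable [set w | c <= g w].
  have -> : [set w | c <= g w] = setT `&` g @^-1` `[c, +oo[%classic.
    by rewrite setTI; apply/seteqP; split=> w /=; rewrite in_itv/= andbT.
  by apply: mg => //; exact: measurable_itv.
rewrite mulrC EFinM -eg -(integralZl measurableT ig).
rewrite -(setIT [set w | _]) -(integral_indic P measurableT mA).
apply: le_integral => //=.
- exact: integrable_indic.
- by have := integrableZl measurableT c^-1 ig; apply: eq_integrable.
move=> w _; rewrite -EFinM lee_fin indicE; case: (boolP (w \in _)) => [|_].
  by rewrite inE/= => cg; rewrite mulrC ler_pdivlMr// mul1r.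
by rewrite mulr_ge0// invr_ge0 ltW.
Qed.
End mean.

(** * Averaging restrictions to random cells *)

Section reweighting.
Context (R : realType) (B : finType).
Local Notation word := (seq B).
Implicit Types (nu : word -> R) (u v : word) (a : nat -> R) (z : nat -> word).

(** The factor [#|B| ^ size (z j)] is the inverse of the probability of the cell
    [z j]: when the [z j] are uniform and the [a j] sum to 1, each cell keeps its
    mass in mean. *)
Definition reweight a n0 n1 z nu v :=
  \sum_(n0 <= j < n1) a j * (#|B|%:R ^+ size (z j) * restrict_mass nu (z j) v).

Lemma tree_mass_reweight a n0 n1 z nu : (forall j, 0 <= a j) -> tree_mass nu ->
  tree_mass (reweight a n0 n1 z nu).
Proof.
move=> a0 tnu; split=> [v|v].
  by apply: sumr_ge0 => j _; rewrite !mulr_ge0 ?exprn_ge0 ?restrict_mass_ge0.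
rewrite /reweight exchange_big/=; apply: eq_bigr => j _.
by rewrite -!mulr_sumr; congr (_ * (_ * _)); have [_ ->] := tree_mass_restrict (z j) tnu.
Qed.

Lemma restrict_mass_le nu u v : tree_mass nu -> restrict_mass nu u v <= nu v.
Proof.
move=> tnu; rewrite /restrict_mass; case: ifPn => // _; have [nu0 _] := tnu.
by case: ifPn => // vz; exact: tree_mass_le.
Qed.

Lemma frostman_reweight a n0 n1 z nu rho C : (forall j, 0 <= a j) -> tree_mass nu ->
  frostman nu rho C ->
  frostman (reweight a n0 n1 z nu) rho ((\sum_(n0 <= j < n1) a j * #|B|%:R ^+ size (z j)) * C).
Proof.
move=> a0 tnu fnu v; rewrite -mulrA mulr_suml; apply: ler_sum => j _.
rewrite -mulrA ler_wpM2l// ler_wpM2l ?exprn_ge0//.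
exact: le_trans (restrict_mass_le _ _ tnu) (fnu v).
Qed.

Lemma reweight_gt0 a n0 n1 z nu v : tree_mass nu -> 0 < reweight a n0 n1 z nu v ->
  (forall j, (n0 <= j < n1)%N -> (size (z j) <= size v)%N) ->
  0 < nu v /\ exists2 j, (n0 <= j < n1)%N & suffix (z j) v.
Proof.
move=> tnu mv zv.
have [j /andP[jn mj]] : exists j, (n0 <= j < n1)%N && (restrict_mass nu (z j) v != 0).
  apply: contrapT => nj; move: mv; rewrite /reweight big_seq big1 ?ltxx// => j.
  rewrite mem_index_iota => jn; have [->|m0] := eqVneq (restrict_mass nu (z j) v) 0.
    by rewrite !mulr0.
  by exfalso; apply: nj; exists j; rewrite jn.
move: mj; rewrite restrict_mass_large ?zv//; case: ifPn => zjv nv0; last by rewrite eqxx in nv0.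
split; last by exists j.
by rewrite lt_def nv0; case: tnu => nu0 _; exact: nu0.
Qed.

Lemma eq_reweight a n0 n1 z z' nu : (forall j, (n0 <= j < n1)%N -> z j = z' j) ->
  reweight a n0 n1 z nu = reweight a n0 n1 z' nu.
Proof. by move=> zz; apply/funext => v; apply: eq_big_nat => j jn; rewrite zz. Qed.
End reweighting.

Section random_mix.
Context (R : realType) (B : finType) (disp : measure_display)
  (Omega : measurableType disp) (P : probability Omega R).
Local Notation word := (seq B).
Local Notation N := (#|B|%:R : R).
Variables (m : nat -> nat) (Z : nat -> Omega -> word).
Hypothesis B_gt0 : (0 < #|B|)%N.
Hypothesis sizeZ : forall j w, size (Z j w) = m j.
Hypothesis mZ : forall j z, measurable [set w | Z j w = z].
Hypothesis PZ : forall j z, size z = m j -> P [set w | Z j w = z] = (N ^- m j)%:E.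
Hypothesis PZZ : forall i j z z', i != j -> size z = m i -> size z' = m j ->
  P ([set w | Z i w = z] `&` [set w | Z j w = z']) = (N ^- m i * N ^- m j)%:E.

Let sum_words_eq k u (h : word -> R) : size u = k ->
  \sum_(z <- words B k) h z * \1_[set u] z = h u.
Proof.
move=> uk; rewrite (big_rem u)/=; last by rewrite mem_words uk.
rewrite indicE mem_set// mulr1 big1_seq ?addr0// => z /andP[_].
rewrite mem_rem_uniq ?uniq_words// inE => /andP[zu _].
by rewrite indicE memNset ?mulr0// => zu'; rewrite zu' eqxx in zu.
Qed.

Let indic_word j z w : \1_[set w | Z j w = z] w = \1_[set Z j w] z :> R.
Proof.
rewrite !indicE (_ : (w \in _) = (z \in [set Z j w]))//.
by apply/idP/idP; rewrite !inE/= => ->.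
Qed.

Definition word_mean k (h : word -> R) := N ^- k * \sum_(z <- words B k) h z.

Lemma mean_word j (h : word -> R) : mean P (fun w => h (Z j w)) (word_mean (m j) h).
Proof.
rewrite /word_mean mulr_sumr.
apply: (@eq_mean _ _ _ _ (fun w => \sum_(z <- words B (m j)) h z * \1_[set w | Z j w = z] w)).
  move=> w; rewrite -[RHS](sum_words_eq h (sizeZ j w)); apply: eq_bigr => z _.
  by rewrite indic_word.
rewrite big_seq.
apply: (@eq_mean _ _ _ _ (fun w => \sum_(z <- words B (m j) | z \in words B (m j)) h z * \1_[set w | Z j w = z] w)).
  by move=> w; rewrite -big_seq.
apply: mean_sum => z; rewrite mem_words => /eqP zm; rewrite mulrC.
by apply: meanZ; apply: mean_indic => //; exact: PZ.
Qed.

Lemma mean_word2 i j (g h : word -> R) : i != j ->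
  mean P (fun w => g (Z i w) * h (Z j w)) (word_mean (m i) g * word_mean (m j) h).
Proof.
move=> ij.
have -> : word_mean (m i) g * word_mean (m j) h = \sum_(z <- words B (m i) | z \in words B (m i))
   \sum_(z' <- words B (m j) | z' \in words B (m j)) (g z * h z') * (N ^- m i * N ^- m j).
  rewrite /word_mean mulrACA mulrC mulr_suml mulr_suml -big_seq; apply: eq_bigr => z _.
  by rewrite mulr_sumr mulr_suml -big_seq; apply: eq_bigr => z' _.
apply: (@eq_mean _ _ _ _ (fun w => \sum_(z <- words B (m i) | z \in words B (m i))
   \sum_(z' <- words B (m j) | z' \in words B (m j)) (g z * h z') *
     \1_([set w | Z i w = z] `&` [set w | Z j w = z']) w)).
  move=> w; rewrite -(sum_words_eq g (sizeZ i w)) -(sum_words_eq h (sizeZ j w)).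
  rewrite mulr_suml -big_seq; apply: eq_bigr => z _.
  rewrite mulr_sumr -big_seq; apply: eq_bigr => z' _.
  by rewrite indicI/= mulrACA !indic_word.
apply: mean_sum => z; rewrite mem_words => /eqP zm.
apply: mean_sum => z'; rewrite mem_words => /eqP zm'.
by apply: meanZ; apply: mean_indic; [exact: measurableI|exact: PZZ].
Qed.

Lemma word_mean_restrict nu k v : tree_mass nu -> word_mean k (fun z => N ^+ size z * restrict_mass nu z v) = nu v.
Proof.
move=> tnu; rewrite /word_mean big_seq (eq_bigr (fun z => N ^+ k * restrict_mass nu z v)); last first.
  by move=> z; rewrite mem_words => /eqP ->.
rewrite -big_seq -mulr_sumr sum_restrict_mass// mulrA mulVf ?mul1r// expf_neq0//.
by rewrite pnatr_eq0 -lt0n.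
Qed.

Lemma word_mean_cst k (c : R) : word_mean k (fun=> c) = c.
Proof.
rewrite /word_mean big_const_seq count_predT size_words iter_addr_0 -(mulr_natr c) natrX mulrC.
rewrite -mulrA divff ?mulr1// expf_neq0// pnatr_eq0 -lt0n//.
Qed.

Lemma word_meanB k g h : word_mean k (fun z => g z - h z) = word_mean k g - word_mean k h.
Proof. by rewrite /word_mean sumrB mulrBr. Qed.

Lemma word_mean_sqr_restrict nu rho C k v : 0 <= C -> 0 <= rho -> tree_mass nu -> frostman nu rho C ->
  word_mean k (fun z => (N ^+ size z * restrict_mass nu z v - nu v) ^+ 2) <=
    N ^+ k * (C * rho ^+ maxn k (size v) * nu v).
Proof.
move=> C0 rho0 tnu fnu.
have N0 : 0 < N ^+ k by rewrite exprn_gt0// ltr0n.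
have -> : (fun z => (N ^+ size z * restrict_mass nu z v - nu v) ^+ 2) =
   (fun z => (N ^+ size z * restrict_mass nu z v) ^+ 2 - ((2 * nu v) * (N ^+ size z * restrict_mass nu z v) - nu v ^+ 2)).
  by apply/funext => z; ring.
rewrite word_meanB word_meanB word_mean_cst.
have -> : word_mean k (fun z => 2 * nu v * (N ^+ size z * restrict_mass nu z v)) = 2 * nu v * nu v.
  by rewrite /word_mean -mulr_sumr mulrCA -[X in _ * X]/(word_mean k _) word_mean_restrict.
rewrite (_ : 2 * nu v * nu v - nu v ^+ 2 = nu v ^+ 2); last by ring.
rewrite lerBlDr; apply: (@le_trans _ _ (N ^+ k * (C * rho ^+ maxn k (size v) * nu v))).
  rewrite /word_mean big_seq (eq_bigr (fun z => N ^+ k ^+ 2 * restrict_mass nu z v ^+ 2)); last first.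
    by move=> z; rewrite mem_words => /eqP ->; rewrite exprMn.
  rewrite -big_seq -mulr_sumr mulrA expr2 mulrA mulVf ?gt_eqF// mul1r.
  by rewrite ler_pM2l// sum_restrict_mass_sqr.
by rewrite lerDl sqr_ge0.
Qed.

(** By pairwise independence the variance of the new mass of [v] is the sum of
    the variances of the terms of the block. The variance of a term is bounded
    through [sum_restrict_mass_sqr], and the sum over all cells [v] through
    [scale_sum_le]. *)
Lemma mean_reweight_energy a n0 n1 nu rho theta C K :
  (forall j, 0 <= a j) -> \sum_(n0 <= j < n1) a j = 1 -> 0 <= C ->
  0 < rho -> rho < theta -> theta < 1 -> tree_mass nu -> frostman nu rho C ->
  exists2 e, mean P (fun w => energy theta K
      (fun v => reweight a n0 n1 (fun j => Z j w) nu v - nu v)) e &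
    e <= C * nu [::] * ((1 - theta)^-1 + (1 - rho / theta)^-1) *
      \sum_(n0 <= j < n1) a j ^+ 2 * (N * rho / theta) ^+ m j.
Proof.
move=> a0 a1 C0 r0 rt t1 tnu fnu.
have t0 : 0 < theta by exact: lt_trans rt.
pose g v z := N ^+ size z * restrict_mass nu z v - nu v.
pose V v := \sum_(n0 <= j < n1) a j ^+ 2 * word_mean (m j) (fun z => g v z ^+ 2).
have mixE w v : reweight a n0 n1 (fun j => Z j w) nu v - nu v =
    \sum_(n0 <= j < n1) a j * g v (Z j w).
  rewrite -[X in _ - X]mul1r -a1 mulr_suml -sumrB; apply: eq_bigr => j _.
  by rewrite -mulrBr.
have meanV v : mean P (fun w => (reweight a n0 n1 (fun j => Z j w) nu v - nu v) ^+ 2) (V v).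
  apply: (@eq_mean _ _ _ _ (fun w => \sum_(n0 <= j < n1) \sum_(n0 <= i < n1)
     a j * a i * (g v (Z j w) * g v (Z i w)))).
    move=> w; rewrite mixE expr2 mulr_suml; apply: eq_bigr => j _.
    by rewrite mulr_sumr; apply: eq_bigr => i _; rewrite mulrACA.
  rewrite /V.
  have -> : \sum_(n0 <= j < n1) a j ^+ 2 * word_mean (m j) (fun z => g v z ^+ 2) =
    \sum_(n0 <= j < n1 | j \in index_iota n0 n1) \sum_(n0 <= i < n1)
      a j * a i * (if i == j then word_mean (m j) (fun z => g v z ^+ 2) else 0).
    rewrite -big_seq [LHS]big_seq [RHS]big_seq; apply: eq_bigr => j jn.
    rewrite (big_rem j)//= eqxx big1_seq ?addr0 ?expr2// => i /andP[_].
    by rewrite mem_rem_uniq ?iota_uniq// inE => /andP[/negbTE -> _]; rewrite mulr0.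
  apply: (@eq_mean _ _ _ _ (fun w => \sum_(n0 <= j < n1 | j \in index_iota n0 n1) \sum_(n0 <= i < n1)
     a j * a i * (g v (Z j w) * g v (Z i w)))).
    by move=> w; rewrite -big_seq.
  apply: mean_sum => j _; apply: mean_sum => i _; apply: meanZ.
  case: eqVneq => [->|ij].
    apply: (eq_mean _ (mean_word j (fun z => g v z ^+ 2))) => w.
    by rewrite expr2.
  have -> : 0 = word_mean (m j) (g v) * word_mean (m i) (g v).
    by rewrite [word_mean (m j) _]word_meanB word_mean_cst word_mean_restrict// subrr mul0r.
  by apply: mean_word2; rewrite eq_sym.
exists (\sum_(k < K) theta ^- k * \sum_(v <- words B k) V v).
  apply: mean_sum => k _; apply: meanZ; apply: mean_sum => v _; exact: meanV.
have [nu0 _] := tnu.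
apply: (@le_trans _ _ (\sum_(k < K) theta ^- k * \sum_(v <- words B k)
   \sum_(n0 <= j < n1) a j ^+ 2 * (N ^+ m j * (C * rho ^+ maxn (m j) k * nu v)))).
  apply: ler_sum => k _; rewrite ler_wpM2l ?invr_ge0 ?exprn_ge0 ?(ltW t0)//.
  rewrite big_seq [leRHS]big_seq; apply: ler_sum => v; rewrite mem_words => /eqP vk.
  apply: ler_sum => j _; rewrite ler_wpM2l ?sqr_ge0// -vk.
  by apply: word_mean_sqr_restrict => //; exact: ltW.
rewrite (eq_bigr (fun k : 'I_K => \sum_(n0 <= j < n1) C * nu [::] * (a j ^+ 2 * N ^+ m j) *
    (theta ^- k * rho ^+ maxn (m j) k))); last first.
  move=> k _; rewrite exchange_big/= mulr_sumr; apply: eq_bigr => j _.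
  rewrite -(tree_mass_total k tnu) -mulr_sumr -mulr_sumr -mulr_sumr; ring.
rewrite exchange_big/= mulr_sumr; apply: ler_sum => j _.
rewrite -mulr_sumr.
apply: (@le_trans _ _ (C * nu [::] * (a j ^+ 2 * N ^+ m j) *
   (((1 - theta)^-1 + (1 - rho / theta)^-1) * (rho / theta) ^+ m j))).
  apply: ler_wpM2l; last exact: scale_sum_le.
  by rewrite !mulr_ge0 ?sqr_ge0 ?exprn_ge0.
by rewrite -(mulrA N) (exprMn _ N); lra.
Qed.
End random_mix.

(** * Almost sure iteration *)

Section measure_facts.
Context (R : realType) (disp : measure_display) (Omega : measurableType disp)
  (P : probability Omega R).

Lemma negligible_small (A : set Omega) :
  (forall e : R, 0 < e -> exists2 E, measurable E /\ A `<=` E & (P E <= e%:E)%E) ->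
  P.-negligible A.
Proof.
move=> h; have /choice[E EP] : forall n : nat, exists E, [/\ measurable E, A `<=` E &
    (P E <= (n.+1%:R^-1)%:E)%E].
  by move=> n; have [E [mE AE] PE] := h n.+1%:R^-1 ltac:(by rewrite invr_gt0); exists E.
have mE : measurable (\bigcap_n E n) by apply: bigcap_measurable => // n _; case: (EP n).
exists (\bigcap_n E n); split => //; last by move=> w Aw n _; case: (EP n) => _ /(_ w Aw).
apply/eqP; rewrite eq_le measure_ge0 andbT; apply/lee_addgt0Pr => e e0; rewrite add0e.
have [n _ /(_ n (leqnn n)) ne] := near_infty_natSinv_lt (PosNum e0).
apply: le_trans (_ : P (E n) <= _)%E; last first.
  by case: (EP n) => _ _ /le_trans; apply; rewrite lee_fin ltW.
by apply: le_measure; rewrite ?inE//; [case: (EP n)|move=> w; apply].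
Qed.

Lemma measure_bigcup_le (A : nat -> set Omega) (c : \bar R) :
  (forall n, measurable (A n)) -> (forall n k, (n <= k)%N -> A n `<=` A k) ->
  (forall n, (P (A n) <= c)%E) -> (P (\bigcup_n A n) <= c)%E.
Proof.
move=> mA Ain Ac.
have mU : measurable (\bigcup_n A n) by exact: bigcupT_measurable.
have cv : P \o A @ \oo --> P (\bigcup_n A n).
  by apply: nondecreasing_cvg_mu => // n k nk; apply/subsetPset; exact: Ain.
rewrite -(cvg_lim _ cv)//; apply: lime_le; first by apply/cvg_ex; eexists; exact: cv.
by apply: nearW => n; exact: Ac.
Qed.
End measure_facts.

Section iteration.
Context (R : realType) (B : finType) (disp : measure_display)
  (Omega : measurableType disp) (P : probability Omega R).
Local Notation word := (seq B).
Local Notation N := (#|B|%:R : R).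
Variables (m : nat -> nat) (Z : nat -> Omega -> word).
Variables (rho theta : R).
Hypothesis B_gt0 : (0 < #|B|)%N.
Hypothesis sizeZ : forall j w, size (Z j w) = m j.
Hypothesis mZ : forall j z, measurable [set w | Z j w = z].
Hypothesis PZ : forall j z, size z = m j -> P [set w | Z j w = z] = (N ^- m j)%:E.
Hypothesis PZZ : forall i j z z', i != j -> size z = m i -> size z' = m j ->
  P ([set w | Z i w = z] `&` [set w | Z j w = z']) = (N ^- m i * N ^- m j)%:E.
Hypotheses (rho_gt0 : 0 < rho) (rho_theta : rho < theta) (theta_lt1 : theta < 1).

Let kap := N * rho / theta.

Hypothesis divergence : forall (M : R) n0, exists n1, M <= \sum_(n0 <= j < n1) kap ^- m j.

Let theta_gt0 : 0 < theta. Proof. exact: lt_trans rho_theta. Qed.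
Let kap_gt0 : 0 < kap.
Proof. by rewrite divr_gt0// mulr_gt0// ltr0n. Qed.

(** With [kap = 2^u] these weights minimise the bound of
    [mean_reweight_energy]: see [sum_block_weight_sqr]. *)
Definition block_weight n0 n1 j : R := kap ^- m j / \sum_(n0 <= i < n1) kap ^- m i.

Let sum_ge0 n0 n1 : 0 <= \sum_(n0 <= i < n1) kap ^- m i.
Proof. by apply: sumr_ge0 => j _; rewrite invr_ge0 exprn_ge0// ltW. Qed.

Lemma block_weight_ge0 n0 n1 j : 0 <= block_weight n0 n1 j.
Proof. by rewrite divr_ge0// invr_ge0 exprn_ge0// ltW. Qed.

Lemma sum_block_weight n0 n1 : 0 < \sum_(n0 <= i < n1) kap ^- m i ->
  \sum_(n0 <= j < n1) block_weight n0 n1 j = 1.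
Proof. by move=> S0; rewrite -mulr_suml divff// gt_eqF. Qed.

Lemma sum_block_weight_sqr n0 n1 : 0 < \sum_(n0 <= i < n1) kap ^- m i ->
  \sum_(n0 <= j < n1) block_weight n0 n1 j ^+ 2 * kap ^+ m j = (\sum_(n0 <= i < n1) kap ^- m i)^-1.
Proof.
move=> S0; rewrite /block_weight; set S := \sum_(n0 <= i < n1) _ in S0 *.
rewrite (eq_bigr (fun j => kap ^- m j * S ^- 2)); last first.
  by move=> j _; have k0 := exprn_gt0 (m j) kap_gt0; field; rewrite !gt_eqF.
by rewrite -mulr_suml -/S; field; rewrite gt_eqF.
Qed.

Definition block_step n0 n1 (z : nat -> word) nu := reweight (block_weight n0 n1) n0 n1 z nu.

Lemma energy_nondecreasing (nu : word -> R) K K' : (K <= K')%N ->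
  energy theta K nu <= energy theta K' nu.
Proof.
move=> KK'; rewrite /energy -(big_mkord xpredT (fun k => theta ^- k * \sum_(v <- words B k) nu v ^+ 2)).
rewrite -(big_mkord xpredT (fun k => theta ^- k * \sum_(v <- words B k) nu v ^+ 2)).
rewrite [leRHS](big_cat_nat (leq0n K) KK')/= lerDl sumr_ge0// => k _.
rewrite mulr_ge0 ?invr_ge0 ?exprn_ge0 ?(ltW theta_gt0)// sumr_ge0// => v _.
exact: sqr_ge0.
Qed.

Lemma energy_ge0 (nu : word -> R) K : 0 <= energy theta K nu.
Proof.
rewrite sumr_ge0// => k _.
rewrite mulr_ge0 ?invr_ge0 ?exprn_ge0 ?(ltW theta_gt0)// sumr_ge0// => v _.
exact: sqr_ge0.
Qed.

Definition small_perturbation n0 n1 nu (e : R) w := forall K,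
  energy theta K (fun v => block_step n0 n1 (fun j => Z j w) nu v - nu v) <= e.

(** Markov inequality for the energy of the perturbation. The levels up to [K]
    give increasing events, and the bound does not depend on [K]. *)
Lemma block_step_ae nu C n0 e : 0 <= C -> tree_mass nu -> frostman nu rho C -> 0 < e ->
  P.-negligible [set w | forall n1, ~ small_perturbation n0 n1 nu e w].
Proof.
move=> C0 tnu fnu e0; apply: negligible_small => d d0.
set c := C * nu [::] * ((1 - theta)^-1 + (1 - rho / theta)^-1).
have c0 : 0 <= c.
  have [nu0 _] := tnu; rewrite !mulr_ge0// addr_ge0// invr_ge0 subr_ge0 ?ltW//.
  by rewrite ltr_pdivrMr// mul1r.
have [n1 Mn1] := divergence ((c + 1) / (d * e)) n0.
have S0 : 0 < \sum_(n0 <= i < n1) kap ^- m i.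
  by apply: lt_le_trans Mn1; rewrite divr_gt0 ?mulr_gt0// ltr_wpDl.
pose D K w := energy theta K (fun v => block_step n0 n1 (fun j => Z j w) nu v - nu v).
have DP K : exists2 x, mean P (D K) x & x <= d * e.
  have [x Dx xc] := mean_reweight_energy B_gt0 sizeZ mZ PZ PZZ K (block_weight_ge0 n0 n1)
    (sum_block_weight S0) C0 rho_gt0 rho_theta theta_lt1 tnu fnu.
  exists x => //; apply: le_trans xc _; rewrite -/c -/kap sum_block_weight_sqr//.
  rewrite ler_pdivrMr// -ler_pdivrMl ?mulr_gt0//; apply: le_trans Mn1.
  by rewrite mulrC ler_pM2r ?invr_gt0 ?mulr_gt0// lerDl.
exists (\bigcup_K [set w | e <= D K w]).
  split; last first.
    move=> w /(_ n1) ng; apply: contrapT => nU; apply: ng => K; rewrite leNgt.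
    by apply/negP => /ltW eD; apply: nU; exists K.
  apply: bigcupT_measurable => K; have [x /mean_measurable mD _] := DP K.
  have -> : [set w | e <= D K w] = setT `&` D K @^-1` `[e, +oo[%classic.
    by rewrite setTI; apply/seteqP; split=> w /=; rewrite in_itv/= andbT.
  by apply: mD => //; exact: measurable_itv.
apply: measure_bigcup_le.
- move=> K; have [x /mean_measurable mD _] := DP K.
  have -> : [set w | e <= D K w] = setT `&` D K @^-1` `[e, +oo[%classic.
    by rewrite setTI; apply/seteqP; split=> w /=; rewrite in_itv/= andbT.
  by apply: mD => //; exact: measurable_itv.
- by move=> K K' KK' w /= /le_trans; apply; exact: energy_nondecreasing.
move=> K; have [x Dx xd] := DP K.
apply: le_trans (mean_markov e0 Dx (fun w => energy_ge0 _ _)) _.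
by rewrite lee_fin ler_pdivrMr.
Qed.

Variables (lam : word -> R) (C : R).
Hypotheses (lam_mass : tree_mass lam) (C_ge0 : 0 <= C) (lam_frost : frostman lam rho C).

(** The cells are recorded as lists of words and the weights are determined by
    the block, so that the masses reachable by finitely many steps are indexed
    by a countable type and a countable union of null sets suffices, although
    the mass used at a step depends on the outcome. *)
Definition reachable_mass : seq (nat * nat * seq word) -> word -> R :=
  foldr (fun p nu => block_step p.1.1 p.1.2 (nth [::] p.2) nu) lam.

Lemma reachable_mass_tree i : tree_mass (reachable_mass i).
Proof. by elim: i => //= p i IH; apply: tree_mass_reweight => //; exact: block_weight_ge0. Qed.

Lemma reachable_mass_frostman i : exists2 c, 0 <= c & frostman (reachable_mass i) rho c.
Proof.
elim: i => [|p i [c c0 fc]]; first by exists C.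
eexists; last first.
  by apply: frostman_reweight (reachable_mass_tree i) fc => j; exact: block_weight_ge0.
by rewrite mulr_ge0// sumr_ge0// => j _; rewrite mulr_ge0 ?block_weight_ge0 ?exprn_ge0.
Qed.

Definition good_outcome w := forall i n0 q, exists n1, small_perturbation n0 n1 (reachable_mass i) q.+1%:R^-1 w.

Lemma good_outcome_ae : P.-negligible (~` good_outcome).
Proof.
pose bad (x : seq (nat * nat * seq word) * nat * nat) :=
  [set w | forall n1, ~ small_perturbation x.1.2 n1 (reachable_mass x.1.1) x.2.+1%:R^-1 w].
pose badn n := if choice.unpickle n is Some x then bad x else set0.
apply: (@negligibleS _ _ _ _ (\bigcup_n badn n)).
  move=> w ng; apply: contrapT => nb; apply: ng => i n0 q; apply: contrapT => nn.
  apply: nb; exists (choice.pickle (i, n0, q)) => //; rewrite /badn choice.pickleK.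
  by move=> n1 gn; apply: nn; exists n1.
apply: negligible_bigcup => n; rewrite /badn; case: choice.unpickle => [[[i n0] q]|].
  by have [c c0 fc] := reachable_mass_frostman i; rewrite /bad/=; apply: (block_step_ae _ c0 _ fc) => //; exact: reachable_mass_tree.
exact: negligible_set0.
Qed.

Let b := lam [::] / 2.
Let E := C * lam [::] / (1 - rho / theta) + 1.
Hypothesis lam_gt0 : 0 < lam [::].

Let inv i := b < reachable_mass i [::] /\ exists2 e, e < E & forall K, energy theta K (reachable_mass i) <= e.

Let inv0 : inv [::].
Proof.
split; first by rewrite /b ltr_pdivrMr// mulr_natr mulr2n ltrDl.
exists (C * lam [::] / (1 - rho / theta)); first by rewrite ltrDl.
by move=> K; exact: frostman_energy.
Qed.

Let energy1 (nu : word -> R) : energy theta 1 nu = nu [::] ^+ 2.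
Proof. by rewrite /energy big_ord1 expr0 invr1 mul1r/= big_seq1. Qed.

Let inv_step w i n0 : good_outcome w -> inv i ->
  exists n1, inv ((n0, n1, mkseq (fun j => Z j w) n1) :: i).
Proof.
move=> gw [bi [e eE ei]].
have e0 : 0 <= e by apply: le_trans (ei 0%N); exact: energy_ge0.
pose s := reachable_mass i [::] - b; have s0 : 0 < s by rewrite subr_gt0.
(* [d] and [t] use up at most three quarters of the slack [E - e]. *)
pose d := (E - e) / (2 * (e + 1)).
have d0 : 0 < d by rewrite divr_gt0 ?subr_gt0// mulr_gt0// ltr_wpDl.
pose t := Num.min (s ^+ 2 / 4) ((E - e) / (4 * (1 + d^-1))).
have t0 : 0 < t.
  rewrite lt_min divr_gt0 ?exprn_gt0//= divr_gt0 ?subr_gt0//.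
  by rewrite mulr_gt0// addr_gt0// invr_gt0.
have [q _ /(_ q (leqnn q)) qt] := near_infty_natSinv_lt (PosNum t0).
have [n1 gs] := gw i n0 q; exists n1.
have massE : reachable_mass ((n0, n1, mkseq (fun j => Z j w) n1) :: i) =
    block_step n0 n1 (fun j => Z j w) (reachable_mass i).
  by apply: eq_reweight => j /andP[_ jn]; rewrite nth_mkseq.
have {}gs K : energy theta K (fun v => block_step n0 n1 (fun j => Z j w) (reachable_mass i) v - reachable_mass i v) <= t.
  by apply: le_trans (gs K) (ltW qt).
rewrite /inv massE; move: (block_step _ _ _ _) gs => mu gs; split.
  have := gs 1%N; rewrite energy1/= le_min => /andP[h _].
  have : s ^+ 2 / 4 < s ^+ 2 by rewrite ltr_pdivrMr//; have := exprn_gt0 2 s0; lra.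
  move=> /(le_lt_trans h); rewrite /s => h2.
  rewrite ltNge; apply/negP => mb; move: h2; rewrite ltNge => /negP; apply.
  rewrite -[leRHS]sqrrN opprB ler_sqr ?nnegrE; lra.
exists ((1 + d) * e + (1 + d^-1) * t).
  have h1 : d * e <= (E - e) / 2.
    rewrite /d mulrAC ler_pdivrMr; last by rewrite mulr_gt0// ltr_wpDl.
    by nra.
  have h2 : (1 + d^-1) * t <= (E - e) / 4.
    have dd : 0 < 1 + d^-1 by rewrite addr_gt0// invr_gt0.
    apply: (@le_trans _ _ ((1 + d^-1) * ((E - e) / (4 * (1 + d^-1))))).
      by rewrite ler_wpM2l ?(ltW dd)// /t ge_min lexx orbT.
    by rewrite le_eqVlt; apply/orP; left; apply/eqP; field; rewrite !gt_eqF//= ltr_wpDr.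
  lra.
move=> K; apply: le_trans (energy_perturb K (reachable_mass i) mu theta_gt0 d0) _.
apply: lerD; rewrite ler_wpM2l//; first by rewrite addr_ge0// ltW.
by rewrite addr_ge0// invr_ge0 ltW.
Qed.

(** Lower bound on the total mass and upper bound on the energy are kept as
    strict inequalities; the perturbation of each step is chosen small enough
    to preserve them. *)
Theorem random_masses w : good_outcome w -> exists (nu : nat -> word -> R) (n : nat -> nat),
  forall k, [/\ tree_mass (nu k), lam [::] / 2 <= nu k [::],
    forall K, energy theta K (nu k) <= C * lam [::] / (1 - rho / theta) + 1 &
    exists L, forall v, (L <= size v)%N -> 0 < nu k v ->
      0 < lam v /\ forall k', (k' < k)%N -> exists2 j, (k' <= j < n k')%N & suffix (Z j w) v].
Proof.
move=> gw.
pose T := {i : seq (nat * nat * seq word) | inv i}.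
have /choice[f fP] : forall x : nat * T, exists n1,
    inv ((x.1, n1, mkseq (fun j => Z j w) n1) :: sval x.2).
  by move=> [n0 [i ii]]; exact: inv_step.
pose nxt (k : nat) (x : T) : T := exist _ _ (fP (k, x)).
pose st := fix st k : T := if k is k'.+1 then nxt k' (st k') else exist _ _ inv0.
exists (fun k => reachable_mass (sval (st k))), (fun k => f (k, st k)).
elim=> [|k [_ _ _ [L LP]]].
  have [bb [e eE ee]] := inv0; split.
  - exact: lam_mass.
  - exact: ltW.
  - by move=> K; apply: le_trans (ee K) (ltW eE).
  - by exists 0%N.
have [bb [e eE ee]] := svalP (st k.+1); split.
- exact: reachable_mass_tree.
- exact: ltW.
- by move=> K; apply: le_trans (ee K) (ltW eE).
set n1 := f (k, st k).
(* A cell below this level is contained in, or disjoint from, each cell of the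
   new block. *)
exists (maxn L (\max_(j < n1) m j)) => v; rewrite geq_max => /andP[Lv mv] /=.
rewrite -/n1 => /reweight_gt0[|j /andP[kj jn]|nu0 [j /andP[kj jn]]].
- exact: reachable_mass_tree.
- rewrite nth_mkseq// sizeZ; apply: leq_trans mv.
  exact: (leq_bigmax (Ordinal jn)).
rewrite nth_mkseq// => zv; have [lv h] := LP v Lv nu0; split=> // k'.
rewrite ltnS leq_eqVlt => /orP[/eqP ->|/h//].
by exists j => //; rewrite kj.
Qed.

End iteration.

(** * Dyadic cells of the torus *)

Section torus_digits.
Context (R : realType) (d : nat).
Local Notation T := (torus R d).
Local Notation B := {ffun 'I_d -> bool}.
Local Notation word := (seq B).
Implicit Types (x y : T) (u : word).

(** Coordinates in [0, 1) of a lift. *)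
Definition frac_coord x i : R :=
  let v := sval (cid (torus_proj_surj x)) in v 0 i - (Num.floor (v 0 i))%:~R.

Lemma frac_coord_itv x i : 0 <= frac_coord x i < 1.
Proof.
rewrite /frac_coord subr_ge0 floor_le_tmp/= ltrBlDl.
by have := floorD1_gt (sval (cid (torus_proj_surj x)) 0 i); rewrite intrD.
Qed.

Lemma torus_proj_frac_coord x : torus_proj (\row_i frac_coord x i) = x.
Proof.
rewrite -[RHS](svalP (cid (torus_proj_surj x))).
apply/torus_projP/forallP => i; rewrite !mxE /frac_coord addrC addKr.
by rewrite rpredN; exact: intr_int.
Qed.

Lemma frac_coord_torus_proj (v : 'rV[R]_d) : (forall i, 0 <= v 0 i < 1) ->
  forall i, frac_coord (torus_proj v) i = v 0 i.
Proof.
move=> v01 i; set x := torus_proj v.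
have /torus_projP/forallP/(_ i) : torus_proj (\row_i frac_coord x i) = torus_proj v by exact: torus_proj_frac_coord.
rewrite !mxE => /intrP[k kE].
have /andP[a b] := frac_coord_itv x i; have /andP[a' b'] := v01 i.
have k0 : k = 0.
  have : (k%:~R : R) < 1%:~R by rewrite -kE; lra.
  have : ((-1)%:~R : R) < k%:~R by rewrite -kE; lra.
  rewrite !ltr_int; lia.
by apply/eqP; rewrite -subr_eq0 kE k0.
Qed.

Definition grid_label k x i : nat := Num.truncn (2 ^+ k * frac_coord x i).

Lemma grid_label_itv k x i : (grid_label k x i)%:R <= 2 ^+ k * frac_coord x i < (grid_label k x i).+1%:R.
Proof.
by apply: truncn_itv; rewrite mulr_ge0 ?exprn_ge0//; case/andP: (frac_coord_itv x i).
Qed.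

Lemma grid_label_lt k x i : (grid_label k x i < 2 ^ k)%N.
Proof.
have /andP[l _] := grid_label_itv k x i; have /andP[f0 f1] := frac_coord_itv x i.
rewrite -(ltr_nat R) natrX; apply: le_lt_trans l _.
by rewrite -[ltRHS]mulr1 ltr_pM2l// exprn_gt0.
Qed.

Lemma grid_label_half k x i : grid_label k x i = (grid_label k.+1 x i)./2.
Proof.
apply: truncn_def; have /andP[] := grid_label_itv k.+1 x i; rewrite exprS.
set n := grid_label k.+1 x i => a b.
have nE : n%:R = (odd n)%:R + 2 * n./2%:R :> R.
  by rewrite -{1}(odd_double_half n) -mul2n natrD natrM.
move: a b; rewrite -!natr1 nE -!mulrA; set t := 2 ^+ k * frac_coord x i.
case: (odd n) => /= a b; apply/andP; split; lra.
Qed.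

Definition digit x k : B := [ffun i => odd (grid_label k.+1 x i)].

(** The integer vector whose binary digits are listed in [u]. *)
Fixpoint word_label (u : word) (i : 'I_d) : nat :=
  if u is b :: v then (b i + (word_label v i).*2)%N else 0%N.

Fixpoint label_word k (n : 'I_d -> nat) : word :=
  if k is k'.+1 then [ffun i => odd (n i)] :: label_word k' (fun i => (n i)./2)
  else [::].

Lemma word_label_prefix_word k x i : word_label (prefix_word digit k x) i = grid_label k x i.
Proof.
elim: k => [|k IH] /=; last by rewrite IH ffunE (grid_label_half k) odd_double_half.
by apply/esym/eqP; rewrite -leqn0 -ltnS; exact: grid_label_lt.
Qed.

Lemma label_word_grid_label k x : label_word k (grid_label k x) = prefix_word digit k x.
Proof.
elim: k => //= k IH; congr cons; rewrite -IH; congr label_word.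
by apply/funext => i; rewrite (grid_label_half k).
Qed.

Lemma word_label_inj u v : size u = size v -> word_label u =1 word_label v -> u = v.
Proof.
elim: u v => [|b u IH] [|c v] //= [uv] h.
have bc i : (b i : bool) = c i by have := h i; case: (b i) (c i) => -[] //=; lia.
congr cons; first by apply/ffunP.
by apply: IH => // i; have := h i; rewrite bc; lia.
Qed.

Lemma word_label_lt u i : (word_label u i < 2 ^ size u)%N.
Proof. by elim: u => //= b u IH; rewrite expnS; case: (b i); lia. Qed.

Lemma cell_labelP u x : cell digit u x <-> forall i, grid_label (size u) x i = word_label u i.
Proof.
split=> [<- i|h]; first by rewrite size_prefix_word word_label_prefix_word.
by apply: word_label_inj; rewrite ?size_prefix_word// => i; rewrite word_label_prefix_word h.
Qed.

Lemma cell_coordP u x : cell digit u x <-> forall i,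
  (word_label u i)%:R <= 2 ^+ size u * frac_coord x i < (word_label u i).+1%:R.
Proof.
split=> [/cell_labelP h i|h]; first by rewrite -h; exact: grid_label_itv.
by apply/cell_labelP => i; exact: truncn_def.
Qed.

Lemma mdist_torus_proj (u v : 'rV[R]_d) :
  mdist (torus_proj u) (torus_proj v) <= enorm (u - v).
Proof. exact: torus_dist_le. Qed.

Lemma cell_mdist u x y : cell digit u x -> cell digit u y ->
  mdist x y <= d%:R * 2^-1 ^+ size u.
Proof.
move=> /cell_coordP xu /cell_coordP yu; rewrite -(torus_proj_frac_coord x) -(torus_proj_frac_coord y).
apply: le_trans (mdist_torus_proj _ _) _; apply: le_trans (enorm_le_sum _) _.
apply: (@le_trans _ _ (\sum_(i < d) (2^-1 ^+ size u : R))).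
  apply: ler_sum => i _; rewrite !mxE.
  have p2 : 0 < 2 ^+ size u :> R by rewrite exprn_gt0.
  rewrite -(ler_pM2l p2) exprVn divff ?gt_eqF// -[X in X * _]ger0_norm ?(ltW p2)//.
  rewrite -normrM mulrBr ler_norml.
  move: (xu i) (yu i); rewrite -natr1 => /andP[a b] /andP[a' b'].
  apply/andP; split; lra.
by rewrite sumr_const card_ord mulr_natl.
Qed.

(** The cells whose integer labels differ from that of [u] by -1, 0 or 1 in
    each coordinate, modulo [2 ^ size u]. *)
Definition neighbours u : seq word :=
  [seq label_word (size u)
     (fun i => ((word_label u i + 2 ^ size u + e i).-1 %% 2 ^ size u)%N)
  | e : {ffun 'I_d -> 'I_3}].

Lemma size_neighbours u : size (neighbours u) = (3 ^ d)%N.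
Proof. by rewrite size_map -cardE card_ffun !card_ord. Qed.

Lemma size_label_word k n : size (label_word k n) = k.
Proof. by elim: k n => //= k IH n; rewrite IH. Qed.

Lemma size_in_neighbours u v : v \in neighbours u -> size v = size u.
Proof. by move=> /mapP[e _ ->]; rewrite size_label_word. Qed.

(** Some lifts of [x] and [y] differ by less than [2^-k] in each coordinate, so
    the integer parts of their coordinates scaled by [2^k] differ by at most 1. *)
Lemma neighbours_prefix_word k x y : mdist x y < 2^-1 ^+ k -> prefix_word digit k y \in neighbours (prefix_word digit k x).
Proof.
rewrite /mdist/= /torus_dist => /inf_lt.
case=> [|_ [u ux [v vy <-]] uv].
  have [u ux] := torus_proj_surj x; have [v vy] := torus_proj_surj y.
  by exists (enorm (u - v)), u => //; exists v.
have p2 : 0 < 2 ^+ k :> R by rewrite exprn_gt0.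
suff h i : exists e : 'I_3,
    grid_label k y i = ((grid_label k x i + 2 ^ k + e).-1 %% 2 ^ k)%N.
  have [e eE] := choice h; apply/mapP; exists [ffun i => e i]; first exact: mem_enum.
  rewrite -(label_word_grid_label k y) size_prefix_word; congr label_word.
  by apply/funext => i; rewrite ffunE word_label_prefix_word.
have fru (w : 'rV[R]_d) z : torus_proj w = z -> exists n : int, w 0 i = frac_coord z i + n%:~R.
  move=> wz; have /torus_projP/forallP/(_ i) : torus_proj w = torus_proj (\row_i frac_coord z i).
    by rewrite torus_proj_frac_coord.
  by rewrite !mxE => /intrP[n nE]; exists n; rewrite -nE addrCA subrr addr0.
have [n nE] := fru u x ux; have [n' n'E] := fru v y vy.
have := le_lt_trans (le_coord_enorm (u - v) i) uv.
rewrite !mxE nE n'E -(ltr_pM2l p2) exprVn divff ?gt_eqF//.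
rewrite -[X in X * _]ger0_norm ?(ltW p2)// -normrM ltr_norml => /andP[lb ub].
have /andP[xa xb] := grid_label_itv k x i; have /andP[ya yb] := grid_label_itv k y i.
have xl := grid_label_lt k x i; have yl := grid_label_lt k y i.
move: (grid_label k x i) (grid_label k y i) xa xb ya yb xl yl => A C xa xb ya yb xl yl.
pose z : int := n - n'.
have E : 2 ^+ k * (frac_coord x i + n%:~R - (frac_coord y i + n'%:~R)) =
   2 ^+ k * frac_coord x i - 2 ^+ k * frac_coord y i + ((2 ^ k)%:Z * z)%:~R.
  by rewrite intrM rmorphB/= -[(2 ^ k)%:Z%:~R]/((2 ^ k)%:R) natrX; ring.
rewrite E in lb ub.
have lt2 : (A%:Z - C%:Z + (2 ^ k)%:Z * z < 2)%R.
  rewrite -(ltr_int R) !rmorphD rmorphN/= -![(_%:Z)%:~R]/(_%:R); rewrite -natr1 in yb; lra.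
have gt2 : (- 2 < A%:Z - C%:Z + (2 ^ k)%:Z * z)%R.
  rewrite -(ltr_int R) !rmorphD !rmorphN/= -![(_%:Z)%:~R]/(_%:R); rewrite -natr1 in xb; lra.
have p0 : (0 < 2 ^ k)%N by rewrite expn_gt0.
move: (2 ^ k)%N p0 xl yl lt2 gt2 => p p0 xl yl lt2 gt2 {E lb ub xa xb ya yb}.
have [w wE] : exists w : nat, 1 - z = w%:Z.
  by exists `|1 - z|%N; rewrite gez0_abs//; nia.
have zE : z = 1 - w%:Z by rewrite -wE; ring.
have [e eE] : exists e : nat, (A%:Z - C%:Z + p%:Z * z)%R = (1 - e%:Z)%R :> int.
  by exists (absz (1 - (A%:Z - C%:Z + p%:Z * z))%R); rewrite gez0_abs; lia.
have e3 : (e < 3)%N by lia.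
exists (Ordinal e3) => /=.
(* The label of [y] is recovered modulo [2^k] from that of [x]. *)
have -> : ((A + p + e).-1 = w * p + C)%N by rewrite zE in eE; nia.
by rewrite modnMDl modn_small.
Qed.

Lemma torus_proj_continuous : continuous (@torus_proj R d).
Proof.
move=> v A /nbhs_ballP[e /= e0 eA].
have e1 : 0 < e / d.+1%:R by rewrite divr_gt0.
apply/nbhs_ballP; exists (e / d.+1%:R) => //= u vu; apply: eA.
rewrite ballEmdist/=; apply: le_lt_trans (mdist_torus_proj _ _) _.
apply: le_lt_trans (enorm_le_sum _) _.
apply: (@le_lt_trans _ _ (\sum_(i < d) (e / d.+1%:R))).
  apply: ler_sum => i _; rewrite !mxE; apply: ltW.
  by case: vu => _ /(_ ord0 i).
rewrite sumr_const card_ord -(mulr_natr (e / _)) -mulrA gtr_pMr// mulrC ltr_pdivrMr// mul1r.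
by rewrite ltr_nat.
Qed.

Lemma measurable_open_torus (A : set T) : open A -> measurable A.
Proof. by move=> oA; apply: sub_sigma_algebra. Qed.

Lemma measurable_closed_torus (A : set T) : closed A -> measurable A.
Proof.
move=> cA; rewrite -(setCK A); apply: measurableC; apply: measurable_open_torus.
exact: closed_openC.
Qed.

(** The image of a compact box of lifts. *)
Lemma closed_box (a b : 'I_d -> R) : (forall i, 0 <= a i) -> (forall i, b i < 1) ->
  closed [set x : T | forall i, a i <= frac_coord x i <= b i].
Proof.
move=> a0 b1.
have -> : [set x : T | forall i, a i <= frac_coord x i <= b i] =
   @torus_proj R d @` [set v : 'rV[R]_d | forall i, `[a i, b i]%classic (v ord0 i)].
  apply/seteqP; split=> [x xab|_ [v vab <-] i].
    exists (\row_i frac_coord x i); last exact: torus_proj_frac_coord.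
    by move=> i; rewrite /= mxE in_itv/=.
  have vv j : a j <= v 0 j <= b j by have := vab j; rewrite /= in_itv.
  rewrite frac_coord_torus_proj// => j; have /andP[h1 h2] := vv j.
  by rewrite (le_trans (a0 j) h1) (le_lt_trans h2 (b1 j)).
apply: compact_closed; first exact: metric_hausdorff.
apply: (@continuous_compact _ _ (@torus_proj R d)).
  by apply: continuous_subspaceT; exact: torus_proj_continuous.
apply: (@rV_compact R d (fun i => `[a i, b i]%classic)) => i; exact: segment_compact.
Qed.

(** A half-open cell is a countable union of closed boxes. *)
Lemma measurable_cell u : measurable (cell digit u : set T).
Proof.
have p2 : 0 < 2 ^+ size u :> R by rewrite exprn_gt0.
pose a i : R := (word_label u i)%:R / 2 ^+ size u.
pose b n i : R := (word_label u i).+1%:R / 2 ^+ size u - n.+1%:R^-1.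
have -> : cell digit u = \bigcup_n [set x : T | forall i, a i <= frac_coord x i <= b n i].
  apply/seteqP; split=> [x /cell_coordP xu|x [n _ xab]].
    have /choice[n nP] : forall i, exists n : nat,
        n.+1%:R^-1 < (word_label u i).+1%:R / 2 ^+ size u - frac_coord x i.
      move=> i; have /andP[_ h] := xu i.
      have h0 : 0 < (word_label u i).+1%:R / 2 ^+ size u - frac_coord x i.
        by rewrite subr_gt0 ltr_pdivlMr// mulrC.
      have [n _ /(_ n (leqnn n)) hn] := near_infty_natSinv_lt (PosNum h0).
      by exists n.
    exists (\max_i n i)%N => // i; have /andP[h _] := xu i.
    rewrite /a /b ler_pdivrMr// mulrC h/= lerBrDl -lerBrDr; apply: ltW.
    apply: le_lt_trans (nP i); rewrite lef_pV2 ?posrE// ler_nat ltnS.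
    exact: leq_bigmax.
  apply/cell_coordP => i; have /andP[h1 h2] := xab i.
  rewrite mulrC -ler_pdivrMr// h1 -ltr_pdivlMr//= (le_lt_trans h2)//.
  by rewrite gtrDl oppr_lt0 invr_gt0.
apply: bigcupT_measurable => n; apply: measurable_closed_torus.
apply: closed_box => i; first by rewrite divr_ge0// ltW.
apply: (@lt_le_trans _ _ ((word_label u i).+1%:R / 2 ^+ size u)).
  by rewrite gtrDl oppr_lt0 invr_gt0.
by rewrite ler_pdivrMr// mul1r -natrX ler_nat word_label_lt.
Qed.
End torus_digits.

(** ** Measure of a cell *)

Section cell_measure.
Context (R : realType).
Local Notation mR := (measurableTypeR R).

Lemma uniform_prob_itv (a b : R) : 0 <= a -> a <= b -> b <= 1 ->
  uniform_prob (@ltr01 R) `[a, b[%classic = (b - a)%:E.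
Proof.
move=> a0 ab b1; rewrite /uniform_prob integral_uniform_pdf.
rewrite (_ : `[a, b[%classic `&` `[0, 1]%classic = `[a, b[%classic); last first.
  apply/setIidPl => x /=; rewrite !in_itv/= => /andP[h1 h2].
  by rewrite (le_trans a0 h1) (le_trans (ltW h2) b1).
rewrite (eq_integral (fun=> 1%:E)); last first.
  move=> x; rewrite inE/= in_itv/= => /andP[h1 h2].
  by rewrite /uniform_pdf (le_trans a0 h1) (le_trans (ltW h2) b1)/= subr0 invr1.
rewrite integral_cst//= mul1e lebesgue_measure_itv/= lte_fin.
case: ltP => // ba; have -> : a = b by apply/eqP; rewrite eq_le ab.
by rewrite subrr.
Qed.

Lemma uniform_cube_box n (a b : 'I_n -> R) :
  (forall i, [/\ 0 <= a i, a i <= b i & b i <= 1]) ->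
  uniform_cube R n [set t | forall i, a i <= tnth t i < b i] = (\prod_i (b i - a i))%:E.
Proof.
elim: n a b => [|n IH] a b ab.
  rewrite big_ord0 /=.
  rewrite diracE mem_set//. by case.
rewrite /= /distribution /pushforward.
set A := _ @^-1` _.
have -> : A = `[a ord0, b ord0[%classic `*` [set t | forall i, a (lift ord0 i) <= tnth t i < b (lift ord0 i)].
  apply/seteqP; split=> [[x t] /= h|[x t] [/= h1 h2] i].
    split; first by have := h ord0; rewrite tnth0 /= in_itv.
    by move=> i; have := h (lift ord0 i); rewrite tnthS.
  case: (unliftP ord0 i) => [j ->|->]; first by rewrite tnthS; exact: h2.
  by rewrite tnth0; move: h1; rewrite in_itv.
have mbox : measurable [set t : n.-tuple mR | forall i, a (lift ord0 i) <= tnth t i < b (lift ord0 i)].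
  have -> : [set t : n.-tuple mR | forall i, a (lift ord0 i) <= tnth t i < b (lift ord0 i)] =
    \bigcap_(i in [set: 'I_n]) ((fun t : n.-tuple mR => tnth t i) @^-1` `[a (lift ord0 i), b (lift ord0 i)[%classic).
    apply/seteqP; split=> [t h i _ /=|t h i]; first by rewrite in_itv /= h.
    by have := h i Logic.I; rewrite /= in_itv.
  apply: fin_bigcap_measurable => // i _.
  rewrite -[X in measurable X]setTI; apply: measurable_tnth => //.
have ab' i : [/\ 0 <= a (lift ord0 i), a (lift ord0 i) <= b (lift ord0 i) & b (lift ord0 i) <= 1].
  exact: ab.
have IHab := IH (fun i => a (lift ord0 i)) (fun i => b (lift ord0 i)) ab'.
have [a0 ab0 b0] := ab ord0.
apply: (eq_trans (product_measure1E (uniform_prob (@ltr01 R)) (uniform_cube R n) _ mbox)).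
  exact: measurable_itv.
apply: (eq_trans (f_equal2 (fun x y => x * y)%E (uniform_prob_itv a0 ab0 b0) IHab)).
by rewrite -EFinM big_ord_recl.
Qed.

Context (d : nat).
Local Notation T := (torus R d).
Local Notation B := {ffun 'I_d -> bool}.
Local Notation N := (#|{: B}|%:R : R).

Lemma card_digits : N = 2 ^+ d.
Proof. by rewrite card_ffun card_bool card_ord natrX. Qed.

Let cell_ge (u : seq B) : ((N ^- size u)%:E <= torus_lebesgue R d (cell (@digit R d) u))%E.
Proof.
have p2 : 0 < 2 ^+ size u :> R by rewrite exprn_gt0.
pose a i : R := (word_label u i)%:R / 2 ^+ size u.
pose b i : R := (word_label u i).+1%:R / 2 ^+ size u.
have ab i : [/\ 0 <= a i, a i <= b i & b i <= 1].
  split; first by rewrite divr_ge0// ltW.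
    by rewrite ler_pM2r ?invr_gt0// ler_nat.
  by rewrite ler_pdivrMr// mul1r -natrX ler_nat word_label_lt.
have <- : uniform_cube R d [set t | forall i, a i <= tnth t i < b i] = (N ^- size u)%:E.
  rewrite uniform_cube_box//; congr EFin.
  rewrite (eq_bigr (fun=> 2 ^- size u)).
    by rewrite prodr_const card_ord card_digits -!exprVn exprAC.
  by move=> i _; rewrite /a /b -mulrBl -natr1 addrAC subrr add0r mul1r.
rewrite /torus_lebesgue /distribution /pushforward.
apply: le_measure; rewrite ?inE.
- have -> : [set t | forall i, a i <= tnth t i < b i] =
    \bigcap_(i in [set: 'I_d]) ((fun t : d.-tuple mR => tnth t i) @^-1` `[a i, b i[%classic).
    apply/seteqP; split=> [t h i _ /=|t h i]; first by rewrite in_itv /= h.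
    by have := h i Logic.I; rewrite /= in_itv.
  apply: fin_bigcap_measurable => // i _.
  rewrite -[X in measurable X]setTI; apply: measurable_tnth => //.
- rewrite -[X in measurable X]setTI; apply: measurable_cube_proj => //.
  exact: measurable_cell.
move=> t h; apply/cell_coordP => i; rewrite /cube_proj frac_coord_torus_proj.
  rewrite mxE; have /andP[h1 h2] := h i.
  by rewrite mulrC -ler_pdivrMr// h1 -ltr_pdivlMr.
move=> j; rewrite mxE; have /andP[h1 h2] := h j; have [a0 _ b1] := ab j.
by rewrite (le_trans a0 h1) (lt_le_trans h2 b1).
Qed.

(** Each of the [#|B| ^ k] cells of level [k] has measure at least [#|B| ^- k],
    since it contains the projection of a half-open box; their measures sum to
    1, so none can have more. *)
Lemma torus_lebesgue_cell (u : seq B) :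
  torus_lebesgue R d (cell (@digit R d) u) = (N ^- size u)%:E.
Proof.
pose mu := torus_lebesgue R d; pose k := size u.
have N0 : 0 < N ^+ k by rewrite exprn_gt0// card_digits exprn_gt0.
pose f v := fine (mu (cell (@digit R d) v)).
have fE v : mu (cell (@digit R d) v) = (f v)%:E.
  by rewrite /f fineK// fin_num_measure//; exact: measurable_cell.
have f_ge v : size v = k -> N ^- k <= f v.
  by move=> <-; rewrite -lee_fin -fE; exact: cell_ge.
have sum1 : \sum_(v <- words B k) f v = 1.
  have : (\sum_(v <- words B k) mu (cell (@digit R d) v) = 1)%E.
    rewrite -(probability_setT mu) fsbig_seq ?uniq_words//=.
    rewrite -measure_fin_bigcup//=.
    - congr (mu _); apply/seteqP; split=> // x _.
      by exists (prefix_word (@digit R d) k x); [rewrite /= mem_words size_prefix_word|exact: cell_prefix_word].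
    - exact: finite_seq.
    - move=> v v'; rewrite /= !mem_words => /eqP vk /eqP v'k [x [vx v'x]].
      by rewrite -vx -v'x vk v'k.
    - by move=> v _; exact: measurable_cell.
  rewrite (eq_bigr (fun v => (f v)%:E)); last by move=> v _; exact: fE.
  by rewrite sumEFin => -[].
rewrite -/mu fE; congr EFin; apply/eqP; rewrite eq_le f_ge// andbT leNgt; apply/negP => fu.
have : \sum_(v <- words B k) N ^- k < \sum_(v <- words B k) f v.
  rewrite (big_rem u) ?mem_words//= [ltRHS](big_rem u) ?mem_words//=.
  apply: ltr_leD => //; rewrite big_seq [leRHS]big_seq; apply: ler_sum => v.
  by move=> /mem_rem; rewrite mem_words => /eqP/f_ge.
rewrite sum1 big_const_seq count_predT size_words iter_addr_0 -(mulr_natr (N ^- k)) natrX.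
by rewrite mulVf ?ltxx// gt_eqF.
Qed.
End cell_measure.

(** * Compact subsets of analytic sets *)

Section baire.
Local Notation baire := (prod_topology (fun _ : nat => nat)).

(** The sets of sequences that agree with [s] up to some rank generate a filter
    that converges pointwise to [s], hence is finer than the neighbourhoods. *)
Lemma nbhs_baire (s : baire) (U : set baire) : nbhs s U ->
  exists j, forall t : baire, (forall i, (i < j)%N -> t i = s i) -> U t.
Proof.
pose F := filter_from [set: nat] (fun j => [set t : baire | forall i, (i < j)%N -> t i = s i]).
have FF : Filter F.
  apply: filter_from_filter; first by exists 0%N.
  move=> i j _ _; exists (maxn i j) => // t h; split=> k kj; apply: h.
    by rewrite (leq_trans kj)// leq_maxl.
  by rewrite (leq_trans kj)// leq_maxr.
have : {ptws, F --> (s : nat -> nat)}.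
  apply/pointwise_cvgP => i A /nbhs_singleton As; exists i.+1 => // t h.
  by rewrite /= h.
by move=> /(_ U) h /h[j _ jU]; exists j => t; exact: jU.
Qed.

Lemma nbhs_baire_prefix (s : baire) j : nbhs s [set t : baire | forall i, (i < j)%N -> t i = s i].
Proof.
elim: j => [|j IH]; first by apply: filterS filterT.
have h : nbhs s ((fun t : baire => t j) @^-1` [set s j]).
  by apply: (@proj_continuous _ (fun _ : nat => nat) j s); apply: discrete_set1.
apply: filterS (filterI IH h) => t [h1 h2] i; rewrite ltnS leq_eqVlt.
by case/orP=> [/eqP ->|/h1].
Qed.

(** Only the first [k] coordinates are bounded. These sets decrease to the
    compact set [coord_box n]. *)
Definition prefix_box (n : nat -> nat) k : set baire := [set t | forall i, (i < k)%N -> (t i <= n i)%N].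
Definition coord_box (n : nat -> nat) : set baire := [set t | forall i, (t i <= n i)%N].

Lemma compact_coord_box n : compact (coord_box n).
Proof.
apply: (@tychonoff nat (fun _ => nat) (fun i => [set k | (k <= n i)%N])) => i.
apply: finite_compact; apply: (sub_finite_set _ (finite_II (n i).+1)) => k /=.
by rewrite ltnS.
Qed.

(** Otherwise, cutting points of [prefix_box n k] outside [U] after rank [k]
    gives points of the compact [coord_box n] whose cluster points lie in [U],
    which a neighbourhood of finitely many coordinates already excludes. *)
Lemma prefix_box_sub_open n (U : set baire) : open U -> coord_box n `<=` U -> exists k, prefix_box n k `<=` U.
Proof.
move=> oU nU; apply: contrapT => nk.
have /choice[t tP] : forall k, exists t, prefix_box n k t /\ ~ U t.
  move=> k; apply: contrapT => h; apply: nk; exists k => t bt; apply: contrapT => Ut.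
  by apply: h; exists t.
pose t' k : baire := fun i => if (i < k)%N then t k i else 0%N.
have t'n k : coord_box n (t' k).
  by move=> i; rewrite /t'; case: ifPn => // ik; case: (tP k) => /(_ i ik).
have Ft' : (t' @ \oo) (coord_box n) by exists 0%N => // k _; exact: t'n.
have [s [ns cs]] := @compact_coord_box n (t' @ \oo) _ Ft'.
have [j jU] : exists j, forall r : baire, (forall i, (i < j)%N -> r i = s i) -> U r.
  by apply: nbhs_baire; apply: open_nbhs_nbhs; split=> //; exact: nU.
have tail : (t' @ \oo) [set r | exists2 k, (j <= k)%N & r = t' k].
  by exists j => // k jk; exists k.
have [r [[k jk ->] h]] := cs _ _ tail (nbhs_baire_prefix s j).
case: (tP k) => _; apply; apply: jU => i ij; rewrite -(h i ij) /t'.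
by rewrite (leq_trans ij jk).
Qed.
End baire.

Section neighbours.
Context (R : realType) (d : nat) (rho : R).
Hypothesis rho01 : 0 < rho < 1.
Local Notation T := (torus R d).
Local Notation B := {ffun 'I_d -> bool}.
Local Notation word := (seq B).
Local Notation dg := (@digit R d).

(** An open neighbourhood of the cell that is covered by its neighbours: open
    sets replace the half-open cells in compactness arguments at the cost of a
    factor [3 ^ d]. *)
Definition fattened_cell (u : word) : set T :=
  \bigcup_(x in cell dg u) (ball x (2^-1 ^+ size u))°.

Lemma open_fattened_cell u : open (fattened_cell u).
Proof. by apply: bigcup_open => x _; exact: open_interior. Qed.

Lemma cell_fattened u : cell dg u `<=` fattened_cell u.
Proof. by move=> x xu; exists x => //; apply: nbhsx_ballx; rewrite exprn_gt0. Qed.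

Lemma fattened_neighbours u x : fattened_cell u x -> prefix_word dg (size u) x \in neighbours u.
Proof.
move=> [y yu] /interior_subset; rewrite ballEmdist/= => /neighbours_prefix_word.
by rewrite [prefix_word _ _ y]yu.
Qed.

Definition neighbour_cells (C : set word) : set word := \bigcup_(u in C) [set` neighbours u].

Lemma weight_le_neighbours C c : weight_le rho C c -> weight_le rho (neighbour_cells C) ((3 ^ d)%:R * c).
Proof.
move=> Cc; apply: (weight_le_bigcup (c := fun u => (3 ^ d)%:R * rho ^+ size u)).
  move=> u _ s us su.
  apply: (@le_trans _ _ (\sum_(v <- s) rho ^+ size u)).
    rewrite big_seq [leRHS]big_seq; apply: ler_sum => v /su.
    by rewrite /= => /size_in_neighbours ->.
  rewrite big_const_seq count_predT iter_addr_0 -(mulr_natl (rho ^+ _)).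
  rewrite ler_wpM2r ?exprn_ge0//; first by case/andP: rho01 => /ltW.
  by rewrite ler_nat -(size_neighbours u) uniq_leq_size.
by move=> s us sC; rewrite -mulr_sumr ler_wpM2l// Cc.
Qed.

Lemma content_fattened C c (A : set T) : weight_le rho C c -> A `<=` \bigcup_(u in C) fattened_cell u ->
  content dg rho A <= (3 ^ d)%:R * c.
Proof.
move=> Cc AC; apply: content_le_cover => //; exists (neighbour_cells C); last exact: weight_le_neighbours.
move=> x /AC[u Cu /fattened_neighbours xu]; exists (prefix_word dg (size u) x); last exact: cell_prefix_word.
by exists u.
Qed.

(** Parametrise [F] by sequences of integers and bound the coordinates one after
    the other, keeping the content of the image above [c] by
    [content_increasing]. The compact image that remains when all coordinates
    are bounded cannot be covered cheaply by open sets, since these would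
    contain the image of some [prefix_box]. *)
Lemma analytic_compact (F : set T) : analytic_set F -> 0 < content dg rho F ->
  exists K, [/\ compact K, K `<=` F & 0 < content dg rho K].
Proof.
case=> [->|[f [fc <-]]]; first by rewrite content0// ltxx.
move=> F0; pose c := content dg rho (range f) / 2.
have c0 : 0 < c by rewrite divr_gt0.
have cF : c < content dg rho (range f) by rewrite /c; lra.
pose L (s : seq nat) : set (prod_topology (fun _ : nat => nat)) :=
  [set t | forall i, (i < size s)%N -> (t i <= nth 0 s i)%N].
have /choice[g gP] : forall s, exists n, c < content dg rho (f @` L s) ->
    c < content dg rho (f @` L (rcons s n)).
  move=> s; have [cs|] := ltP c (content dg rho (f @` L s)); last by exists 0%N.
  suff [n cn] : exists n, c < content dg rho (f @` L (rcons s n)) by exists n.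
  apply: content_increasing => //.
    move=> n k nk _ [t tn <-]; exists t => // i; rewrite size_rcons => ik.
    apply: leq_trans (tn i _) _; rewrite ?size_rcons// !nth_rcons.
    by case: ifP => // _; case: ifP.
  apply: lt_le_trans cs _; apply: content_mono => // _ [t ts <-].
  exists (t (size s)) => //; exists t => // i; rewrite size_rcons nth_rcons ltnS leq_eqVlt.
  by case/orP=> [/eqP ->|ik]; rewrite ?ltnn ?eqxx// ik ts.
pose st := fix st k := if k is k'.+1 then rcons (st k') (g (st k')) else [::].
pose n k := g (st k).
have stE k : st k = mkseq n k by elim: k => //= k IH; rewrite mkseqS -IH.
have cst k : c < content dg rho (f @` L (st k)).
  elim: k => [|k IH] /=; last exact: gP.
  apply: lt_le_trans cF _; apply: content_mono => // _ [t _ <-]; by exists t.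
exists (f @` coord_box n); split.
- apply: continuous_compact; last exact: compact_coord_box.
  exact: continuous_subspaceT.
- by move=> _ [t _ <-]; exists t.
rewrite ltNge; apply/negP => K0.
have d0 : 0 < c / (3 ^ d)%:R by rewrite divr_gt0// ltr0n expn_gt0.
have [C [c' [CK Cc' c'c]]] := content_lt_cover rho01 (le_lt_trans K0 d0).
have [k kU] : exists k, prefix_box n k `<=` f @^-1` (\bigcup_(u in C) fattened_cell u).
  apply: prefix_box_sub_open.
    apply: open_comp; first by move=> x _; exact: fc.
    by apply: bigcup_open => u _; exact: open_fattened_cell.
  move=> t tn; have [|u Cu tu] := CK (f t); first by exists t.
  by exists u => //; exact: cell_fattened.
have := cst k; rewrite ltNge => /negP; apply.
apply: le_trans (_ : (3 ^ d)%:R * c' <= _); last first.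
  by rewrite mulrC -ler_pdivlMr ?ltW// ltr0n expn_gt0.
apply: content_fattened Cc' _ => _ [t tL <-]; apply: kU => i ik.
by have := tL i; rewrite stE size_mkseq nth_mkseq//; apply.
Qed.
End neighbours.

(** * Content of the random intersection *)

Section cells_of_variables.
Context (R : realType) (d : nat) (disp : measure_display) (Omega : measurableType disp)
  (P : probability Omega R) (xi : nat -> {RV P >-> torus R d}).
Hypothesis xi_indep : independent_seq xi.
Hypothesis xi_unif : forall n, uniform_on_torus (xi n).
Local Notation T := (torus R d).
Local Notation B := {ffun 'I_d -> bool}.
Local Notation word := (seq B).
Local Notation dg := (@digit R d).
Local Notation N := (#|{: B}|%:R : R).

Lemma measurable_xi_cell j u : measurable (xi j @^-1` cell dg u).
Proof.
rewrite -[X in measurable X]setTI; apply: measurable_funPT => //; exact: measurable_cell.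
Qed.

Lemma prob_xi_cell j u : P (xi j @^-1` cell dg u) = (N ^- size u)%:E.
Proof.
by rewrite -torus_lebesgue_cell; exact: (xi_unif j (measurable_cell u)).
Qed.

Lemma prob_xi_cell2 i j u v : i != j ->
  P (xi i @^-1` cell dg u `&` xi j @^-1` cell dg v) = (N ^- size u * N ^- size v)%:E.
Proof.
move=> ij; have := @xi_indep [fset i; j]%fset (fun k => if k == i then cell dg u else cell dg v).
have mA k : measurable (if k == i then cell dg u else cell dg v).
  by case: ifP => _; exact: measurable_cell.
move=> /(_ mA); rewrite big_fsetU1/= ?big_seq_fset1; last by rewrite inE.
rewrite eqxx [j == i]eq_sym (negbTE ij) EFinM -(prob_xi_cell i u) -(prob_xi_cell j v) => <-.
congr (P _); apply/seteqP; split=> [w [wi wj] k /=|w h].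
  by rewrite !inE => /orP[] /eqP ->; rewrite ?eqxx// [j == i]eq_sym (negbTE ij).
split.
  by have := h i; rewrite /= !inE eqxx; apply.
by have := h j; rewrite /= !inE eqxx orbT [j == i]eq_sym (negbTE ij); apply.
Qed.
End cells_of_variables.

Section lower_bound.
Context (R : realType) (d : nat) (disp : measure_display) (Omega : measurableType disp)
  (P : probability Omega R) (l : nat -> R) (xi : nat -> {RV P >-> torus R d}).
Hypothesis xi_indep : independent_seq xi.
Hypothesis xi_unif : forall n, uniform_on_torus (xi n).
Local Notation T := (torus R d).
Local Notation B := {ffun 'I_d -> bool}.
Local Notation word := (seq B).
Local Notation dg := (@digit R d).
Local Notation N := (#|{: B}|%:R : R).
Variables (m : nat -> nat) (rho theta : R).
Hypothesis ml : forall j, d%:R * 2^-1 ^+ m j < l j / 2.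
Hypotheses (rho_gt0 : 0 < rho) (rho_theta : rho < theta) (theta_lt1 : theta < 1).
Hypothesis divergence : forall (M : R) n0,
  exists n1, M <= \sum_(n0 <= j < n1) (N * rho / theta) ^- m j.

Let Z j w := prefix_word dg (m j) (xi j w).

Let theta01 : 0 < theta < 1.
Proof. by rewrite theta_lt1 (lt_trans rho_gt0 rho_theta). Qed.
Let rho01 : 0 < rho < 1.
Proof. by rewrite rho_gt0 (lt_trans rho_theta theta_lt1). Qed.

Let cball j w : set T := [set y | mdist (xi j w) y <= d%:R * 2^-1 ^+ m j].

Let cball_closed j w : closed (cball j w).
Proof.
rewrite -openC openE/= => y /negP; rewrite -ltNge => ry.
apply/nbhs_ballP; exists (mdist (xi j w) y - d%:R * 2^-1 ^+ m j); first by rewrite /= subr_gt0.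
move=> z; rewrite ballEmdist/= ltrBrDr => yz; apply/negP; rewrite -ltNge.
have := metric_triangle (xi j w) z y; rewrite (metric_sym z y); lra.
Qed.

Let cball_sub j w : cball j w `<=` ball (xi j w) (l j / 2).
Proof. by move=> y yr; rewrite ballEmdist/=; exact: le_lt_trans yr (ml j). Qed.

Let cyl_cball j w v y : suffix (Z j w) v -> cell dg v y -> cball j w y.
Proof.
move=> zv yv; have yZ := cell_suffix zv yv; rewrite /cball/=.
by rewrite -(size_prefix_word dg (m j) (xi j w)); apply: (@cell_mdist _ _ (Z j w)); first exact: cell_prefix_word.
Qed.

Lemma sum_suffix (nu : word -> R) u n : tree_mass nu -> (size u <= n)%N ->
  \sum_(v <- words B n | suffix u v) nu v = nu u.
Proof.
move=> tnu un; rewrite big_mkcond -[RHS](sum_restrict_mass u n tnu) big_seq [RHS]big_seq.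
by apply: eq_bigr => v; rewrite mem_words => /eqP vn; rewrite restrict_mass_small ?vn.
Qed.

(** The cover of [K] used for compactness consists of the fattened cells of a
    cheap cover of the intersection and of the complements of the finite unions
    of closed balls attached to the blocks. A finite subcover involves finitely
    many blocks, so the fattened cells in it carry the whole of one of the
    masses of [random_masses], against [energy_cover]. *)
Theorem content_of_intersection (F : set T) : analytic_set F -> 0 < content dg rho F ->
  P.-negligible [set w | ~ 0 < content dg theta (covering_set l xi w `&` F)].
Proof.
move=> anF F0; have [K [cK KF K0]] := analytic_compact rho01 anF F0.
have [lam [tlam lam0 lamK]] := exists_mass_below_content dg K rho01.
have frl : frostman lam rho 1.
  by move=> u; rewrite mul1r; apply: le_trans (lamK u) _; apply: content_le_cell => // x [].
have lam_gt0 : 0 < lam [::] by rewrite lam0.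
have B_gt0 : (0 < #|{: B}|)%N by rewrite card_ffun card_bool expn_gt0.
have sizeZ j w : size (Z j w) = m j by rewrite size_prefix_word.
have ZE j z : size z = m j -> [set w | Z j w = z] = xi j @^-1` cell dg z.
  by move=> zm; apply/seteqP; split=> w; rewrite /Z /= /cell/= zm.
have mZ j z : measurable [set w | Z j w = z].
  have [zm|/eqP zm] := eqVneq (size z) (m j).
    by rewrite ZE//; exact: measurable_xi_cell.
  rewrite (_ : mkset _ = set0)// -subset0 => w /= zw; apply: zm.
  by rewrite -zw sizeZ.
have PZ j z : size z = m j -> P [set w | Z j w = z] = (N ^- m j)%:E.
  by move=> zm; rewrite ZE// prob_xi_cell// zm.
have PZZ i j z z' : i != j -> size z = m i -> size z' = m j ->
    P ([set w | Z i w = z] `&` [set w | Z j w = z']) = (N ^- m i * N ^- m j)%:E.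
  by move=> ij zm z'm; rewrite !ZE// prob_xi_cell2// zm z'm.
apply: negligibleS (good_outcome_ae B_gt0 sizeZ mZ PZ PZZ rho_gt0 rho_theta theta_lt1 divergence tlam ler01 frl).
move=> w; apply: contra_not.
move=> /(random_masses B_gt0 sizeZ rho_gt0 rho_theta tlam ler01 frl lam_gt0).
set E0 := _ + 1 : R; move=> [nu [n nuP]].
have E0_gt0 : 0 < E0.
  rewrite ltr_wpDl// divr_ge0// ?mul1r ?ltW// subr_gt0.
  by rewrite ltr_pdivrMr ?mul1r// (lt_trans rho_gt0).
pose b := lam [::] / 2; have b0 : 0 < b by rewrite divr_gt0.
have D0 : 0 < E0 * (3 ^ d)%:R by rewrite mulr_gt0// ltr0n expn_gt0.
rewrite ltNge; apply/negP => c0.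
have c1 : content dg theta (covering_set l xi w `&` K) < b ^+ 2 / (E0 * (3 ^ d)%:R).
  apply: le_lt_trans (_ : _ <= 0) _; last by rewrite divr_gt0// exprn_gt0.
  by apply: le_trans c0; apply: content_mono => //; exact: setIS.
have [C [c [CE Cc cb]]] := content_lt_cover theta01 c1.
pose H k : set T := \bigcup_(j in [set j | (k <= j < n k)%N]) cball j w.
have cH k : closed (H k).
  apply: closed_bigcup => [|j _]; last exact: cball_closed.
  by apply: (sub_finite_set _ (finite_II (n k))) => j /andP[].
(* Points of [K] lying in all [H k] belong to the random set, hence to the cover. *)
pose f (i : word + nat) := match i with inl u => fattened_cell u | inr k => ~` H k end.
have : cover_compact K by rewrite -compact_cover.
move=> /(_ _ [set i : word + nat | match i with inl u => C u | inr _ => True end] f).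
case.
- by move=> [u|k] _ /=; [exact: open_fattened_cell|exact: closed_openC].
- move=> x Kx; have [xH|] := pselect (forall k, H k x); last first.
    by move=> /existsNP[k xk]; exists (inr k).
  have [|u Cu xu] := CE x; last by exists (inl u) => //; exact: cell_fattened.
  split=> // k _; have [j /andP[kj _] xj] := xH k.
  by exists j => //; exact: cball_sub.
move=> D DC KD.
pose us : seq word := pmap (fun i : word + nat => if i is inl u then Some u else None) (enum_fset D).
pose ks : seq nat := pmap (fun i : word + nat => if i is inr k then Some k else None) (enum_fset D).
have usP u : (u \in us) = (inl u \in D).
  rewrite mem_pmap; apply/mapP/idP => [[[v|k] vD //= [->]]//|uD].
  by exists (inl u).
pose k := (\max_(i <- ks) i).+1.
have kP i : inr i \in D -> (i < k)%N.
  move=> iD; rewrite ltnS; apply: leq_bigmax_seq => //.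
  by rewrite mem_pmap; apply/mapP; exists (inr i).
have [tnu bnu Enu [L LP]] := nuP k.
(* A level fine enough to be below all the cells in play. *)
pose n0 := maxn L (\max_(u <- us) size u).
pose U := undup (flatten [seq neighbours u | u <- us]).
have UP v : reflect (exists2 u, u \in us & v \in neighbours u) (v \in U).
  rewrite mem_undup; apply: (iffP flatten_mapP) => -[u uus vu]; by exists u.
have Usize v : v \in U -> (size v <= n0)%N.
  move=> /UP[u uus /size_in_neighbours ->]; rewrite leq_max orbC; apply/orP; left.
  exact: leq_bigmax_seq.
have bU : b <= \sum_(v <- U) nu k v.
  apply: le_trans bnu _; rewrite -(tree_mass_total n0 tnu).
  rewrite [leRHS]big_seq [leRHS](eq_bigr (fun v => \sum_(z <- words B n0 | suffix v z) nu k z)); last first.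
    by move=> v vU; rewrite sum_suffix//; exact: Usize.
  rewrite -big_seq (exchange_big_dep xpredT)//= big_seq [leRHS]big_seq; apply: ler_sum => z.
  rewrite mem_words => /eqP zn; have [nu0 _] := tnu.
  have [nz|nz] := leP (nu k z) 0.
    by apply: le_trans nz _; apply: sumr_ge0.
  have Lz : (L <= size z)%N by rewrite zn leq_maxl.
  have [lz hz] := LP z Lz nz.
  have [x [Kx xz]] : exists x, K x /\ cell dg z x.
    apply: contrapT => nx; move: lz; rewrite ltNge => /negP; apply.
    apply: le_trans (lamK z) _; rewrite (_ : K `&` cell dg z = set0) ?content0//.
    by rewrite -subset0 => x [Kx xz]; apply: nx; exists x.
  have [[u|k'] iD] := KD x Kx; last first.
    case; have [j jn jz] := hz k' (kP _ iD).
    by exists j => //; exact: cyl_cball jz xz.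
  move=> /= /fattened_neighbours xu.
  have vU : prefix_word dg (size u) x \in U by apply/UP; exists u; rewrite ?usP.
  rewrite (big_rem _ vU)/= ifT; last first.
    by rewrite -xz zn; apply: suffix_prefix_word; rewrite -(size_prefix_word dg (size u) x) Usize.
  by rewrite lerDl sumr_ge0.
have theta_gt0 : 0 < theta by exact: lt_trans rho_theta.
have h2 := energy_cover (K := n0.+1) theta_gt0 b0 E0_gt0 (undup_uniq _) Usize (Enu n0.+1) bU.
have : \sum_(v <- U) theta ^+ size v <= (3 ^ d)%:R * c.
  apply: (weight_le_neighbours theta01 Cc); first exact: undup_uniq.
  move=> v /UP[u]; rewrite usP => uD vu; exists u => //.
  by have := DC _ uD; rewrite inE.
move=> h1; have := le_trans h2 (ler_wpM2l (ltW E0_gt0) h1).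
rewrite mulrA [_ * c]mulrC => h3; move: cb; rewrite ltr_pdivlMr// => h4; have := lt_le_trans h4 h3; by rewrite ltxx.
Qed.

End lower_bound.

(** * Content and Hausdorff dimension *)

Section scales.
Context (R : realType).
Implicit Types (x s t c : R).

Lemma half_powR k s : (2^-1 ^+ k) `^ s = (2^-1 `^ s) ^+ k :> R.
Proof.
have h : 0 <= 2^-1 :> R by rewrite invr_ge0.
by rewrite -powR_mulrn// powRAC powR_mulrn// powR_ge0.
Qed.

Lemma half_powR_lt s t : s < t -> 2^-1 `^ t < 2^-1 `^ s :> R.
Proof.
move=> st; have h : 0 < (2^-1 : R) <= 1 by apply/andP; split; lra.
rewrite lt_neqAle (ger_powR h (ltW st)) andbT; apply/eqP => E.
have : (2^-1 : R) `^ (t - s) = 1.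
  by rewrite powRB ?E ?divff ?gt_eqF ?powR_gt0 ?invr_gt0//; apply/implyP => _; rewrite invr_neq0.
move/eqP; rewrite powR_eq1 => /or3P[/eqP h1|h1|/eqP h1]; lra.
Qed.

Lemma half_powR01 s : 0 < s -> 0 < (2^-1 : R) `^ s < 1.
Proof.
by move=> s0; rewrite powR_gt0 ?invr_gt0//= -[ltRHS](powRr0 2^-1) half_powR_lt.
Qed.

(** The last power of 1/2 above [x]. *)
Lemma dyadic_scale x : 0 < x < 1 -> exists k, x < 2^-1 ^+ k <= 2 * x.
Proof.
move=> /andP[x0 x1].
have ex : exists k, (2^-1 : R) ^+ k <= x.
  have /cvgrPdist_lt/(_ x x0) : (fun n => 2^-1 ^+ n : R) @ \oo --> 0.
    by apply: cvg_expr; rewrite ger0_norm; lra.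
  move=> [k _ /(_ k (leqnn k))]; rewrite /= sub0r normrN ger0_norm ?exprn_ge0 ?invr_ge0//.
  by move=> /ltW; exists k.
case: (ex_minnP ex) => -[|k]; first by rewrite expr0 leNgt x1.
move=> kx /(_ k) kmin; exists k; apply/andP; split.
  by rewrite ltNge; apply/negP => /kmin; rewrite ltnn.
by move: kx; rewrite exprS; lra.
Qed.

Lemma nneseries_le (f : nat -> \bar R) (c : \bar R) : (forall i, (0 <= f i)%E) ->
  (forall n, (\sum_(0 <= i < n) f i <= c)%E) -> (\sum_(0 <= i <oo) f i <= c)%E.
Proof.
move=> f0 fc; apply: lime_le; last exact: nearW.
by apply: is_cvg_nneseries => n _ _; exact: f0.
Qed.

Lemma sum_uniq_nneseries (f : nat -> \bar R) (s : seq nat) : (forall i, (0 <= f i)%E) ->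
  uniq s -> (\sum_(i <- s) f i <= \sum_(0 <= i <oo) f i)%E.
Proof.
move=> f0 us; pose n := (\max_(i <- s) i).+1.
apply: (@le_trans _ _ (\sum_(0 <= i < n) f i)%E); last first.
  by apply: nneseries_lim_ge => k _ _; exact: f0.
rewrite [leRHS](bigID (fun i => i \in s))/=.
rewrite (perm_big [seq i <- index_iota 0 n | i \in s]).
  by rewrite big_filter leeDl//; apply: sume_ge0 => i _; exact: f0.
apply: uniq_perm => //; first by rewrite filter_uniq ?iota_uniq.
move=> i; rewrite mem_filter mem_index_iota; have [is_|]//= := boolP (i \in s).
by rewrite ltnS; apply/esym; exact: leq_bigmax_seq.
Qed.
End scales.

Section hausdorff_monotone.
Context (R : realType) (T : metricType R).
Implicit Types (A U : set T) (s t : R).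
Local Open Scope ereal_scope.

Lemma diam_ge0 U : 0 <= diam U.
Proof. by apply: ereal_sup_ubound; left. Qed.

Lemma diam_le U (c : R) : (0 <= c)%R ->
  (forall x y, U x -> U y -> (mdist x y <= c)%R) -> diam U <= c%:E.
Proof.
move=> c0 Uc; apply: ge_ereal_sup => _ [->|[x Ux [y Uy <-]]]; first by rewrite lee_fin.
by rewrite lee_fin Uc.
Qed.

Lemma mdist_le_diam U x y : U x -> U y -> (mdist x y)%:E <= diam U.
Proof. by move=> Ux Uy; apply: ereal_sup_ubound; right; exists x => //; exists y. Qed.

Lemma diam_pow_ge0 s U : 0 <= diam_pow s U.
Proof. by rewrite /diam_pow; case: ifP => // _; exact: poweR_ge0. Qed.

Lemma diam_fin U (c : R) : diam U <= c%:E -> diam U = (fine (diam U))%:E.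
Proof.
move=> Uc; rewrite fineK// ge0_fin_numE ?diam_ge0//.
exact: le_lt_trans Uc (ltry _).
Qed.

Lemma diam_pow_mono s t U : (0 <= s <= t)%R -> diam U <= 1%:E -> diam_pow t U <= diam_pow s U.
Proof.
move=> /andP[s0 st] U1; rewrite /diam_pow; case: ifP => // _.
rewrite (diam_fin U1) !poweR_EFin lee_fin.
move: (U1) (diam_ge0 U); rewrite (diam_fin U1) !lee_fin.
move: (fine _) => x x1; rewrite le_eqVlt => /orP[/eqP <-|x0].
  have [t0|t0] := eqVneq t 0%R; last by rewrite [X in (X <= _)%R]powR0// powR_ge0.
  have s00 : s = 0%R by apply/eqP; rewrite eq_le s0 andbT -t0.
  by rewrite t0 s00.
by rewrite ger_powR// x0.
Qed.

Lemma hausdorff_premeasure_ge0 s (e : R) A : 0 <= hausdorff_premeasure s e A.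
Proof.
apply: le_ereal_inf_tmp => _ [U _ <-]; apply: nneseries_ge0 => i _ _; exact: diam_pow_ge0.
Qed.

Lemma hausdorff_measure_ge0 s A : 0 <= hausdorff_measure s A.
Proof.
apply: le_trans (hausdorff_premeasure_ge0 s 1%R A) _.
by apply: ereal_sup_ubound; exists 1%R => //=; rewrite ltr01.
Qed.

Lemma hausdorff_measure0P s A : hausdorff_measure s A = 0 <->
  forall e d : R, (0 < e)%R -> (0 < d)%R -> exists U : nat -> set T,
    [/\ A `<=` \bigcup_i U i, forall i, diam (U i) <= e%:E &
       \sum_(0 <= i <oo) diam_pow s (U i) <= d%:E].
Proof.
split=> [H0 e d e0 d0|h].
  have : hausdorff_premeasure s e A < d%:E.
    apply: (@le_lt_trans _ _ 0); last by rewrite lte_fin.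
    by rewrite -H0; apply: ereal_sup_ubound; exists e.
  move=> /ereal_inf_lt[_ [U [AU Ue] <-]] Ud; exists U; split=> //; exact: ltW.
apply/eqP; rewrite eq_le hausdorff_measure_ge0 andbT.
apply: ge_ereal_sup => _ [e e0 <-]; apply/lee_addgt0Pr => d d0; rewrite add0e.
have [U [AU Ue Ud]] := h e d e0 d0; apply: le_trans Ud.
by apply: ereal_inf_lbound; exists U.
Qed.

Lemma hausdorff_measure0_mono s t A : (0 <= s <= t)%R ->
  hausdorff_measure s A = 0 -> hausdorff_measure t A = 0.
Proof.
move=> st /hausdorff_measure0P h; apply/hausdorff_measure0P => e d e0 d0.
have [|U [AU Ue Ud]] := h (Num.min e 1%R) d _ d0; first by rewrite lt_min e0 ltr01.
have U1 i : diam (U i) <= e%:E /\ diam (U i) <= 1%:E.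
  by split; apply: le_trans (Ue i) _; rewrite lee_fin ge_min lexx ?orbT.
exists U; split=> //; first by move=> i; case: (U1 i).
apply: le_trans Ud; apply: lee_nneseries => [i _ _|i _]; first exact: diam_pow_ge0.
by apply: diam_pow_mono => //; case: (U1 i).
Qed.

Lemma le_hausdorff_dim s A : (0 <= s)%R -> hausdorff_measure s A <> 0 ->
  s%:E <= hausdorff_dim A.
Proof.
move=> s0 HA; apply: le_ereal_inf_tmp => _ [r [r0 Hr] <-]; rewrite lee_fin leNgt.
apply/negP => rs; apply: HA; apply: hausdorff_measure0_mono Hr.
by rewrite r0 ltW.
Qed.

Lemma hausdorff_dim_le s A : (0 <= s)%R -> hausdorff_measure s A = 0 ->
  hausdorff_dim A <= s%:E.
Proof. by move=> s0 HA; apply: ereal_inf_lbound; exists s. Qed.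

Lemma hausdorff_dim_ge0 A : 0 <= hausdorff_dim A.
Proof. by apply: le_ereal_inf_tmp => _ [r [r0 Hr] <-]; rewrite lee_fin. Qed.
End hausdorff_monotone.

Section content_dimension.
Context (R : realType) (d : nat).
Hypothesis d_gt0 : (0 < d)%N.
Local Notation T := (torus R d).
Local Notation B := {ffun 'I_d -> bool}.
Local Notation word := (seq B).
Local Notation dg := (@digit R d).
Implicit Types (A : set T) (s t : R).

(** A cover by cells of small total weight consists of small cells, hence is
    also fine. *)
Lemma hausdorff_measure0_of_content s A : 0 < s -> content dg (2^-1 `^ s) A <= 0 ->
  hausdorff_measure s A = 0%E.
Proof.
move=> s0 A0; apply/hausdorff_measure0P => e c e0 c0.
have d0 : 0 < d%:R :> R by rewrite ltr0n.
(* The first bound makes the cells of the cover finer than [e], the second one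
   makes their sum at most [c]. *)
pose h := Num.min ((e / d%:R) `^ s) (c / d%:R `^ s).
have h0 : 0 < h by rewrite lt_min powR_gt0 ?divr_gt0 ?powR_gt0.
have [C [c' [CA Cc c'h]]] := content_lt_cover (half_powR01 s0) (le_lt_trans A0 h0).
move: c'h; rewrite lt_min => /andP[c'e c'c].
pose U (i : nat) : set T := if choice.pickle_inv i is Some u then
  if u \in C then cell dg u else set0 else set0.
have diam_cell u : (diam (cell dg u : set T) <= (d%:R * 2^-1 ^+ size u)%:E)%E.
  by apply: diam_le => [|x y xu yu]; [rewrite mulr_ge0 ?exprn_ge0 ?invr_ge0|exact: cell_mdist].
exists U; split.
- move=> x /CA[u Cu xu]; exists (choice.pickle u) => //.
  by rewrite /U choice.pickleK_inv mem_set.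
- have e1 : (diam (set0 : set T) <= e%:E)%E by apply: diam_le => //; exact: ltW.
  move=> i; rewrite /U; case: choice.pickle_inv => [u|//]; case: ifPn => // uC.
  apply: le_trans (diam_cell u) _; rewrite lee_fin mulrC -ler_pdivlMr// leNgt; apply/negP => eu.
  have : (e / d%:R) `^ s < (2^-1 ^+ size u) `^ s.
    by apply: gt0_ltr_powR; rewrite ?nnegrE ?divr_ge0 ?exprn_ge0 ?invr_ge0 ?ltW.
  rewrite half_powR ltNge => /negP; apply; apply: ltW; apply: le_lt_trans c'e.
  have := Cc [:: u] isT; rewrite big_seq1; apply => v; rewrite inE => /eqP ->.
  exact: set_mem.
apply: nneseries_le => [i|n]; first exact: diam_pow_ge0.
have U0 : (diam_pow s (set0 : set T) = 0)%E by rewrite /diam_pow eqxx.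
pose w (u : word) : R := d%:R `^ s * (2^-1 `^ s) ^+ size u.
have w_cell u : (diam_pow s (cell dg u : set T) <= (w u)%:E)%E.
  rewrite /diam_pow; case: ifP => _; first by rewrite lee_fin mulr_ge0 ?powR_ge0 ?exprn_ge0 ?powR_ge0.
  have := diam_cell u; rewrite (diam_fin (diam_cell u)) poweR_EFin !lee_fin => du.
  rewrite /w -half_powR -powRM ?exprn_ge0 ?invr_ge0//.
  apply: ge0_ler_powR => //; rewrite ?nnegrE ?mulr_ge0 ?exprn_ge0 ?invr_ge0 ?(ltW s0)//.
  by rewrite -lee_fin -(diam_fin (diam_cell u)) diam_ge0.
pose us : seq word := pmap (@choice.pickle_inv word) (index_iota 0 n).
apply: (@le_trans _ _ (\sum_(u <- us) (if u \in C then (w u)%:E else 0))%E).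
  rewrite big_pmap; apply: lee_sum => i _; rewrite /U.
  case: choice.pickle_inv => [u|] /=; last by rewrite U0.
  by case: ifP => _ //; rewrite U0.
rewrite -big_mkcond/= -big_filter sumEFin lee_fin -mulr_sumr mulrC -ler_pdivlMr ?powR_gt0//.
apply: le_trans (ltW c'c); apply: Cc.
  rewrite filter_uniq// (pmap_uniq (@choice.pickle_invK word))// iota_uniq//.
by move=> u; rewrite mem_filter => /andP[/set_mem].
Qed.

(** Each set of a cover is replaced by the neighbours of one cell whose side is
    just larger than its diameter; sets reduced to a point have diameter 0 and
    receive a cell of summable weight [q i] instead. *)
Lemma content_le0_of_hausdorff t A : 0 < t -> hausdorff_measure t A = 0%E ->
  content dg (2^-1 `^ t) A <= 0.
Proof.
move=> t0 /hausdorff_measure0P HA.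
pose M : R := (3 ^ d)%:R * (2 `^ t + 1).
have M0 : 0 < M by rewrite mulr_gt0 ?ltr0n ?expn_gt0// ltr_wpDl// powR_ge0.
apply/ler_addgt0Pr => c c0; rewrite add0r.
pose e := c / M; have e0 : 0 < e by rewrite divr_gt0.
have h0 : 0 < 2^-1 :> R by rewrite invr_gt0.
have [U [AU Ud Ue]] := HA 2^-1 e h0 e0.
pose D i := fine (diam (U i)).
have DE i : diam (U i) = (D i)%:E := diam_fin (Ud i).
have D0 i : 0 <= D i by rewrite -lee_fin -DE diam_ge0.
have D2 i : D i <= 2^-1 by rewrite -lee_fin -DE.
pose q (i : nat) : R := e * 2^-1 ^+ (choice.pickle i).+1.
have q0 i : 0 < q i by rewrite mulr_gt0// exprn_gt0.
have /choice[k kP] : forall i, exists k, D i < 2^-1 ^+ k /\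
    (2^-1 `^ t) ^+ k <= 2 `^ t * D i `^ t + q i.
  move=> i; have [Di0|Dn0] := eqVneq (D i) 0; last first.
    have Dgt : 0 < D i by rewrite lt_def Dn0 D0.
    have [|k /andP[k1 k2]] := @dyadic_scale R (D i).
      by rewrite Dgt (le_lt_trans (D2 i))//; lra.
    exists k; split=> //; rewrite -half_powR -powRM//.
    apply: (@le_trans _ _ ((2 * D i) `^ t)); last by rewrite lerDl ltW.
    by apply: ge0_ler_powR => //; rewrite ?nnegrE ?mulr_ge0 ?exprn_ge0 ?invr_ge0 ?(ltW t0).
  pose x := Num.min 2^-1 (q i `^ t^-1 / 2).
  have x0 : 0 < x by rewrite lt_min h0 divr_gt0 ?powR_gt0.
  have [|k /andP[k1 k2]] := @dyadic_scale R x.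
    by rewrite x0/= gt_min; apply/orP; left; lra.
  exists k; split; first by rewrite Di0 exprn_gt0.
  rewrite -half_powR Di0 powR0 ?gt_eqF// mulr0 add0r.
  have -> : q i = (q i `^ t^-1) `^ t by rewrite -powRrM mulVf ?gt_eqF// powRr1// ltW.
  apply: ge0_ler_powR => //; rewrite ?nnegrE ?exprn_ge0 ?invr_ge0 ?(ltW t0) ?powR_ge0//.
  apply: le_trans k2 _; rewrite -ler_pdivlMl// mulrC.
  by rewrite ge_min lexx orbT.
have /choice[x xP] : forall i, exists x, U i !=set0 -> U i x.
  move=> i; have [[x Ux]|nU] := pselect (U i !=set0); first by exists x.
  by exists point => /nU.
have powD i : U i !=set0 -> ((D i `^ t)%:E <= diam_pow t (U i))%E.
  move=> /set0P/negbTE Ui; by rewrite /diam_pow Ui DE poweR_EFin.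
pose C : set word := \bigcup_(i in [set i | U i !=set0]) [set prefix_word dg (k i) (x i)].
have rho01 := half_powR01 t0.
have wC : weight_le (2^-1 `^ t) C (2 `^ t * e + e).
  apply: (weight_le_bigcup (c := fun i => (2^-1 `^ t) ^+ k i)).
    by move=> i _; rewrite -[X in _ ^+ X](size_prefix_word dg (k i) (x i)); exact: weight_le_set1.
  move=> s us sU; apply: (@le_trans _ _ (\sum_(i <- s) (2 `^ t * D i `^ t + q i))).
    by apply: ler_sum => i _; case: (kP i).
  rewrite big_split/= -mulr_sumr; apply: lerD.
    rewrite ler_wpM2l ?powR_ge0// -lee_fin; apply: le_trans Ue.
    apply: le_trans (sum_uniq_nneseries _ us); last by move=> i; exact: diam_pow_ge0.
    rewrite -sumEFin big_seq [leRHS]big_seq; apply: lee_sum => i si.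
    by apply: powD; exact: sU.
  by rewrite -mulr_sumr ler_piMr ?(ltW e0)//; exact: sum_half_pickle.
have AC : covers dg (neighbour_cells C) A.
  move=> y /AU[i _ Uiy]; have Ui : U i !=set0 by exists y.
  have xy : mdist (x i) y < 2^-1 ^+ k i.
    have [kD _] := kP i; apply: le_lt_trans kD.
    by rewrite -lee_fin -DE; apply: mdist_le_diam => //; exact: xP.
  exists (prefix_word dg (k i) y); last exact: cell_prefix_word.
  by exists (prefix_word dg (k i) (x i)); [exists i|exact: neighbours_prefix_word].
apply: le_trans (_ : (3 ^ d)%:R * (2 `^ t * e + e) <= _).
  apply: content_le_cover => //; exists (neighbour_cells C) => //; exact: weight_le_neighbours.
by rewrite -[X in _ + X]mul1r -mulrDl mulrA -/M /e mulrCA divff ?mulr1// gt_eqF.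
Qed.

Lemma content_gt0_of_dim s A : 0 < s -> (s%:E < hausdorff_dim A)%E ->
  0 < content dg (2^-1 `^ s) A.
Proof.
move=> s0 sA; rewrite ltNge; apply/negP => c0; move: sA; rewrite ltNge => /negP; apply.
by apply: hausdorff_dim_le; [exact: ltW|exact: hausdorff_measure0_of_content].
Qed.

Lemma dim_ge_of_content t A : 0 < t -> 0 < content dg (2^-1 `^ t) A ->
  (t%:E <= hausdorff_dim A)%E.
Proof.
move=> t0 cA; apply: le_hausdorff_dim; first exact: ltW.
by move=> /(content_le0_of_hausdorff t0); rewrite leNgt cA.
Qed.
End content_dimension.

(** * Packing dimension and box counting *)

Section box_counting.
Context (R : realType) (d : nat).
Local Notation T := (torus R d).
Local Notation B := {ffun 'I_d -> bool}.
Local Notation word := (seq B).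
Local Notation dg := (@digit R d).
Implicit Types (A : set T) (s t : R).

(** The upper box-counting dimension of [A] is at most [s], with a constant
    valid at all scales. *)
Definition box_counted s A (C : R) := forall k, exists L : seq word,
  [/\ forall u, u \in L -> size u = k, (size L)%:R <= C * (2^-1 ^+ k) `^ (- s) &
      forall y, A y -> prefix_word dg k y \in L].

Let half_gt0 : 0 < 2^-1 :> R. Proof. by rewrite invr_gt0. Qed.

Lemma packing_card s e A (c : R) (r : R) (xs : seq T) :
  (packing_premeasure_at s e A <= c%:E)%E -> 0 < r <= e ->
  (forall i, (i < size xs)%N -> A (nth point xs i)) ->
  trivIset `I_(size xs) (fun i => metric_closed_ball (nth point xs i) r) ->
  (size xs)%:R * (2 * r) `^ s <= c.
Proof.
move=> Ac re xsA tr; rewrite -lee_fin; apply: le_trans Ac.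
apply: ereal_sup_ubound; exists `I_(size xs), (nth point xs), (fun=> r); split.
  by split=> // i /xsA.
rewrite esum_fset//; last by move=> i _; rewrite lee_fin powR_ge0.
by rewrite -fsbig_ord/= sumEFin sumr_const card_ord mulr_natl.
Qed.

Lemma packing_premeasure_at_ge0 s e A : (0 <= packing_premeasure_at s e A)%E.
Proof.
apply: ereal_sup_ubound; exists set0, (fun=> point), (fun=> 0); split; last by rewrite esum_set0.
by split=> // i j.
Qed.

(** The centres of a packing by balls of radius [r] with the largest possible
    number of balls. *)
Lemma exists_net s e A (c r : R) : (packing_premeasure_at s e A <= c%:E)%E -> 0 < r <= e ->
  exists xs : seq T, (size xs)%:R * (2 * r) `^ s <= c /\
    forall y, A y -> exists2 x, x \in xs & mdist x y <= 2 * r.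
Proof.
move=> Ac re; have /andP[r0 _] := re.
pose P n := `[< exists xs : seq T, [/\ size xs = n, forall i, (i < size xs)%N -> A (nth point xs i) &
  trivIset `I_(size xs) (fun i => metric_closed_ball (nth point xs i) r)] >].
have P0 : exists n, P n by exists 0%N; apply/asboolP; exists [::]; split.
have w0 : 0 < (2 * r) `^ s by rewrite powR_gt0// mulr_gt0.
have Pub n : P n -> (n <= Num.truncn (c / (2 * r) `^ s))%N.
  move=> /asboolP[xs [<- xsA tr]].
  have h : (size xs)%:R <= c / (2 * r) `^ s.
    by rewrite ler_pdivlMr//; exact: packing_card Ac re xsA tr.
  by rewrite truncn_ge_nat// (le_trans _ h).
case: (ex_maxnP P0 Pub) => n /asboolP[xs [xsn xsA tr]] nmax.
exists xs; split; first exact: packing_card Ac re xsA tr.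
move=> y Ay; apply: contrapT => ny.
suff : P n.+1 by move=> /nmax; rewrite ltnn.
apply/asboolP; exists (rcons xs y); split; first by rewrite size_rcons xsn.
  move=> i; rewrite size_rcons nth_rcons ltnS leq_eqVlt => /orP[/eqP ->|ixs].
    by rewrite ltnn eqxx.
  by rewrite ixs; exact: xsA.
have ydisj i z : (i < size xs)%N -> metric_closed_ball (nth point xs i) r z ->
    metric_closed_ball y r z -> False.
  move=> ixs xz yz; apply: ny; exists (nth point xs i); first exact: mem_nth.
  apply: le_trans (metric_triangle _ z _) _; rewrite (metric_sym z y) mulr_natl mulr2n.
  exact: lerD.
move=> i j; rewrite /= size_rcons !nth_rcons !ltnS (leq_eqVlt i) (leq_eqVlt j).
case/orP=> [/eqP ->|ixs]; case/orP=> [/eqP ->|jxs] //.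
- by rewrite ltnn eqxx jxs => -[z [yz xz]]; exfalso; exact: ydisj jxs xz yz.
- by rewrite ltnn eqxx ixs => -[z [xz yz]]; exfalso; exact: ydisj ixs xz yz.
- by rewrite ixs jxs; exact: tr.
Qed.

Lemma box_counted_of_packing s A : 0 <= s -> (packing_premeasure s A < +oo)%E ->
  exists2 C, 0 <= C & box_counted s A C.
Proof.
move=> s0 /ereal_inf_lt[_ [e e0 <-] Ae].
have Ac : (packing_premeasure_at s e A <= (fine (packing_premeasure_at s e A))%:E)%E.
  by rewrite fineK// ge0_fin_numE// packing_premeasure_at_ge0.
have c0 : 0 <= fine (packing_premeasure_at s e A) by rewrite fine_ge0// packing_premeasure_at_ge0.
move: (fine _) c0 Ac => c c0 Ac.
have [k0 k0e] : exists k0, (2^-1 : R) ^+ k0 <= e.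
  have [|k /andP[_ k2]] := @dyadic_scale R (Num.min 2^-1 (e / 2)).
    by rewrite lt_min half_gt0 divr_gt0//= gt_min; apply/orP; left; lra.
  exists k; apply: le_trans k2 _; rewrite -ler_pdivlMl// mulrC.
  by rewrite ge_min lexx orbT.
pose C1 : R := (3 ^ d)%:R * (c * 2 `^ s); pose C2 : R := (#|{: B}| ^ k0)%:R.
have C10 : 0 <= C1 by rewrite !mulr_ge0// powR_ge0.
exists (C1 + C2); first by rewrite addr_ge0.
move=> k; have [kk|kk] := leqP k0 k; last first.
  exists (words B k); split; first by move=> u; rewrite mem_words => /eqP.
    rewrite size_words; apply: (@le_trans _ _ C2).
      by rewrite ler_nat leq_pexp2l ?(ltnW kk)// card_ffun card_bool expn_gt0.
    apply: (@le_trans _ _ (C1 + C2)); first by rewrite lerDr.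
    rewrite ler_peMr ?addr_ge0// powRN invf_ge1 ?powR_gt0 ?exprn_gt0//.
    have E1 : 1 `^ s = 1 :> R by rewrite powR1.
    rewrite -[leRHS]E1; apply: ge0_ler_powR; rewrite ?nnegrE ?exprn_ge0 ?(ltW half_gt0)//.
    by rewrite exprn_ile1//; lra.
  by move=> y _; rewrite mem_words size_prefix_word.
(* Every point of [A] is within [2 * 2^-(k+2)] of the net, and a ball of radius
   [2^-k] meets only the neighbours of the cell of its centre. *)
have r0 : 0 < (2^-1 : R) ^+ k.+2 <= e.
  rewrite exprn_gt0//=; apply: le_trans k0e; apply: ler_wiXn2l; first exact: ltW.
    by lra.
  by apply: leq_trans kk _; rewrite -addn2 leq_addr.
have [xs [xsc xsA]] := exists_net Ac r0.
exists (flatten [seq neighbours (prefix_word dg k x) | x <- xs]); split.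
- by move=> u /flatten_mapP[x _ /size_in_neighbours ->]; rewrite size_prefix_word.
- rewrite size_flatten /shape -map_comp sumnE big_map.
  rewrite (eq_bigr (fun=> (3 ^ d)%N)); last by move=> x _; rewrite /= size_neighbours.
  rewrite big_const_seq count_predT iter_addn_0 natrM.
  apply: (@le_trans _ _ (C1 * (2^-1 ^+ k) `^ (- s))); last first.
    by rewrite ler_wpM2r ?powR_ge0// lerDl.
  rewrite /C1 -!mulrA ler_wpM2l//.
  have -> : c * (2 `^ s * (2^-1 ^+ k) `^ (- s)) = c / (2 * 2^-1 ^+ k.+2) `^ s.
    congr (_ * _); have -> : 2 * 2^-1 ^+ k.+2 = 2^-1 * 2^-1 ^+ k :> R.
      by rewrite !exprS; field.
    rewrite powRM ?exprn_ge0 ?(ltW half_gt0)// invfM powRN; congr (_ * _).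
    apply: (mulIf (x := 2^-1 `^ s)); first by rewrite gt_eqF ?powR_gt0.
    rewrite mulVf ?gt_eqF ?powR_gt0// -powRM ?(ltW half_gt0)//.
    by rewrite divff ?powR1.
  by rewrite ler_pdivlMr// powR_gt0// mulr_gt0// exprn_gt0.
move=> y Ay; have [x xxs yx] := xsA y Ay; apply/flatten_mapP; exists x => //.
apply: neighbours_prefix_word; apply: le_lt_trans yx _.
by have := exprn_gt0 k half_gt0; rewrite !exprS; lra.
Qed.

Lemma content_box_counted s t A C : box_counted s A C -> 0 <= C -> s < t -> 0 < t ->
  content dg (2^-1 `^ t) A <= 0.
Proof.
move=> bA C0 st t0; apply/ler_addgt0Pr => e e0; rewrite add0r.
have q1 := @half_powR01 R (t - s) ltac:(by rewrite subr_gt0); have /andP[q0 q1'] := q1.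
have e1 : 0 < e / (C + 1) by rewrite divr_gt0// ltr_wpDl.
have /cvgrPdist_lt/(_ _ e1) : (fun n => (2^-1 `^ (t - s)) ^+ n : R) @ \oo --> 0.
  by apply: cvg_expr; rewrite ger0_norm ?(ltW q0).
move=> [k _ /(_ k (leqnn k))]; rewrite /= sub0r normrN ger0_norm ?exprn_ge0 ?(ltW q0)// => ke.
have [L [Lk Lc AL]] := bA k.
have t01 := half_powR01 t0.
apply: (@le_trans _ _ ((size L)%:R * (2^-1 `^ t) ^+ k)).
  apply: content_le_cover => //; exists [set u | u \in L].
    by move=> y /AL yL; exists (prefix_word dg k y) => //; exact: cell_prefix_word.
  move=> s0 us sL; rewrite big_seq (eq_bigr (fun=> (2^-1 `^ t) ^+ k)); last first.
    by move=> u /sL/Lk ->.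
  rewrite -big_seq big_const_seq count_predT iter_addr_0 -(mulr_natl ((_ `^ t) ^+ k)).
  rewrite ler_wpM2r ?exprn_ge0 ?powR_ge0// ler_nat.
  exact: uniq_leq_size.
apply: (@le_trans _ _ (C * (2^-1 ^+ k) `^ (- s) * (2^-1 `^ t) ^+ k)).
  by rewrite ler_wpM2r ?exprn_ge0 ?powR_ge0.
rewrite -half_powR -mulrA -powRD; last by apply/implyP => _; rewrite gt_eqF ?exprn_gt0.
rewrite addrC half_powR.
apply: (@le_trans _ _ (C * (e / (C + 1)))); first by rewrite ler_wpM2l// ltW.
rewrite mulrCA ler_piMr ?(ltW e0)// ler_pdivrMr ?ltr_wpDl// mul1r lerDl//.
Qed.

(** A null set for the packing measure is covered by countably many sets of
    finite packing premeasure. *)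
Lemma packing_dim_box_counted (F : set T) s : (packing_dim F < s%:E)%E ->
  exists s' (A : nat -> set T), [/\ 0 <= s', s' < s, F `<=` \bigcup_i A i &
    forall i, exists2 C, 0 <= C & box_counted s' (A i) C].
Proof.
move=> /ereal_inf_lt[_ [r [r0 Hr] <-]]; rewrite lte_fin => rs.
have : (packing_measure r F < 1)%E by rewrite Hr lte_fin.
move=> /ereal_inf_lt[_ [A FA <-] A1]; exists r, A; split=> // i.
apply: box_counted_of_packing => //; apply: le_lt_trans (_ : _ <= 1)%E (ltry _).
have ge0 j : (0 <= packing_premeasure r (A j))%E.
  by apply: le_ereal_inf_tmp => _ [e e0 <-]; exact: packing_premeasure_at_ge0.
apply: le_trans (ltW A1).
by have := sum_uniq_nneseries (s := [:: i]) ge0 isT; rewrite big_seq1.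
Qed.
End box_counting.

(** * Cells hit by the random balls *)

Section hits.
Context (R : realType) (d : nat) (disp : measure_display) (Omega : measurableType disp)
  (P : probability Omega R).

(** Markov inequality applied to the increasing partial sums. *)
Lemma bounded_sums_ae (H : nat -> set Omega) (q : nat -> R) (b : R) :
  (forall n, measurable (H n)) -> (forall n, 0 <= q n) ->
  (forall K, \sum_(0 <= n < K) q n * fine (P (H n)) <= b) ->
  P.-negligible [set w | forall M : R, exists K, M <= \sum_(0 <= n < K) q n * \1_(H n) w].
Proof.
move=> mH q0 qb; apply: negligible_small => e e0.
have b0 : 0 <= b by have := qb 0%N; rewrite big_geq.
pose S K w := \sum_(0 <= n < K) q n * \1_(H n) w.
have meanS K : mean P (S K) (\sum_(0 <= n < K) q n * fine (P (H n))).
  apply: mean_sum => n _; apply: meanZ; apply: mean_indic => //.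
  by rewrite fineK// fin_num_measure.
pose M := (b + 1) / e; have M0 : 0 < M by rewrite divr_gt0// ltr_wpDl.
have mS K : measurable [set w | M <= S K w].
  have -> : [set w | M <= S K w] = setT `&` S K @^-1` `[M, +oo[%classic.
    by rewrite setTI; apply/seteqP; split=> w /=; rewrite in_itv/= andbT.
  by apply: (mean_measurable (meanS K)) => //; exact: measurable_itv.
exists (\bigcup_K [set w | M <= S K w]).
  split; first exact: bigcupT_measurable.
  by move=> w /(_ M)[K MK]; exists K.
have S0 K w : 0 <= S K w.
  by apply: sumr_ge0 => n _; rewrite mulr_ge0// indicE.
apply: measure_bigcup_le => //.
  move=> n k nk w /= /le_trans; apply.
  rewrite /S [leRHS](big_cat_nat (leq0n n) nk)/= lerDl sumr_ge0// => i _.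
  by rewrite mulr_ge0// indicE.
move=> K; apply: le_trans (mean_markov M0 (meanS K) (S0 K)) _.
rewrite lee_fin /M ler_pdivrMr// mulrCA divff ?mulr1 ?gt_eqF//.
by rewrite (le_trans (qb K))// lerDl.
Qed.

Lemma bounded_sum_tail (f : nat -> R) (M : R) : (forall n, 0 <= f n) ->
  (forall K, \sum_(0 <= n < K) f n <= M) ->
  forall e, 0 < e -> exists n0, forall K, \sum_(n0 <= n < K) f n <= e.
Proof.
move=> f0 fM e e0; pose S := range (fun K => \sum_(0 <= n < K) f n).
have supS : has_sup S.
  by split; [exists (\sum_(0 <= n < 0) f n); exists 0%N|exists M => _ [K _ <-]].
have [_ [n0 _ <-] n0S] := sup_adherent e0 supS; exists n0 => K.
have [Kn|nK] := leqP K n0; first by rewrite big_geq// ltW.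
have : \sum_(0 <= n < K) f n <= sup S by apply: sup_upper_bound => //; exists K.
rewrite (big_cat_nat (leq0n n0) (ltnW nK))/=; lra.
Qed.

Variables (l : nat -> R) (xi : nat -> {RV P >-> torus R d}).
Hypothesis xi_unif : forall n, uniform_on_torus (xi n).
Hypothesis l_gt0 : forall n, 0 < l n.
Local Notation T := (torus R d).
Local Notation B := {ffun 'I_d -> bool}.
Local Notation word := (seq B).
Local Notation dg := (@digit R d).
Local Notation N := (#|{: B}|%:R : R).

(** [H n] is the event that the cell of the n-th centre, at the scale of the
    n-th ball, is a neighbour of a cell that meets [A]. Almost surely the sum of
    the t-th powers of the scales over the events that occur is finite, and the
    intersection with [A] is covered by neighbours of the cells in its tail. *)
Lemma hits_ae (A : set T) (s t C b : R) (n0 : nat) : box_counted s A C -> 0 <= C -> 0 <= t ->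
  0 <= d%:R - s + t -> (forall n, (n0 <= n)%N -> l n < 1) ->
  (forall K, \sum_(0 <= n < K) l n `^ (d%:R - s + t) <= b) ->
  P.-negligible [set w | ~ ((0 < t -> content dg (2^-1 `^ t) (covering_set l xi w `&` A) <= 0) /\
     (t = 0 -> covering_set l xi w `&` A = set0))].
Proof.
move=> bA C0 t0 u0 l1 lb.
have h0 : 0 < 2^-1 :> R by rewrite invr_gt0.
have /choice[k kP] : forall n, exists k, (n0 <= n)%N -> l n / 2 < 2^-1 ^+ k <= l n.
  move=> n; have [nn|nn] := leqP n0 n; last by exists 0%N.
  have [|k kP] := @dyadic_scale R (l n / 2).
    by have := l1 n nn; have := l_gt0 n => *; apply/andP; split; lra.
  by exists k => _; move: kP; rewrite [2 * _]mulrC divfK.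
have [L LP] := choice bA.
pose V n := undup (flatten [seq neighbours u | u <- L (k n)]).
have Vsize n v : v \in V n -> size v = k n.
  rewrite mem_undup => /flatten_mapP[u uL /size_in_neighbours ->].
  by case: (LP (k n)) => /(_ u uL).
have sizeV n : (size (V n))%:R <= (3 ^ d)%:R * (C * (2^-1 ^+ k n) `^ (- s)).
  apply: (@le_trans _ _ ((3 ^ d)%:R * (size (L (k n)))%:R)); last first.
    by rewrite ler_wpM2l//; case: (LP (k n)).
  rewrite -natrM ler_nat; apply: leq_trans (size_undup _) _.
  rewrite size_flatten /shape -map_comp sumnE big_map.
  rewrite (eq_bigr (fun=> (3 ^ d)%N)); last by move=> x _; rewrite /= size_neighbours.
  by rewrite big_const_seq count_predT iter_addn_0.
pose H n : set Omega := \bigcup_(v in [set` V n]) (xi n @^-1` cell dg v).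
have mH n : measurable (H n).
  by apply: fin_bigcup_measurable; [exact: finite_seq|move=> v _; exact: measurable_xi_cell].
have PH n : fine (P (H n)) = (size (V n))%:R * N ^- k n.
  rewrite /H measure_fin_bigcup//=.
  - rewrite -fsbig_seq ?undup_uniq// big_seq (eq_bigr (fun=> (N ^- k n)%:E)); last first.
      by move=> v /Vsize vk; rewrite prob_xi_cell// vk.
    rewrite -big_seq sumEFin /= big_const_seq count_predT iter_addr_0.
    by rewrite -(mulr_natl (N ^- k n)).
  - move=> v v' /= vV v'V [w []]; rewrite /preimage/= /cell/= => <- <-.
    by rewrite (Vsize _ _ vV) (Vsize _ _ v'V).
  - by move=> v _; exact: measurable_xi_cell.
pose q n := if (n < n0)%N then 0 else (2^-1 ^+ k n) `^ t.
have q0 n : 0 <= q n by rewrite /q; case: ifP => // _; exact: powR_ge0.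
have qPH K : \sum_(0 <= n < K) q n * fine (P (H n)) <= (3 ^ d)%:R * C * b.
  apply: (@le_trans _ _ (\sum_(0 <= n < K) (3 ^ d)%:R * C * l n `^ (d%:R - s + t))); last first.
    by rewrite -mulr_sumr ler_wpM2l ?mulr_ge0.
  apply: ler_sum => n _; rewrite PH /q; case: ltnP => nn.
    by rewrite mul0r !mulr_ge0// powR_ge0.
  have /andP[_ kl] := kP n nn; have p0 : 0 < 2^-1 ^+ k n :> R by rewrite exprn_gt0.
  apply: (@le_trans _ _ ((2^-1 ^+ k n) `^ t * ((3 ^ d)%:R * (C * (2^-1 ^+ k n) `^ (- s)) * N ^- k n))).
    by rewrite ler_wpM2l ?powR_ge0// ler_wpM2r ?invr_ge0 ?exprn_ge0.
  have -> : N ^- k n = (2^-1 ^+ k n) `^ d%:R.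
    by rewrite card_digits powR_mulrn ?(ltW p0)// -!exprVn exprAC.
  have pn0 : (2^-1 ^+ k n : R) != 0 by rewrite gt_eqF.
  have -> : (2^-1 ^+ k n) `^ t * ((3 ^ d)%:R * (C * (2^-1 ^+ k n) `^ (- s)) * (2^-1 ^+ k n) `^ d%:R) =
      (3 ^ d)%:R * C * (2^-1 ^+ k n) `^ (d%:R - s + t).
    rewrite powRD; last by apply/implyP.
    rewrite (powRD (x := 2^-1 ^+ k n) (r := d%:R)); last by apply/implyP.
    ring.
  rewrite ler_wpM2l ?mulr_ge0//; apply: ge0_ler_powR => //.
    by rewrite nnegrE ltW.
  by rewrite nnegrE ltW.
apply: negligibleS (bounded_sums_ae mH q0 qPH) => w nw.
apply: contrapT => /existsNP[M MS]; apply: nw.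
have SM K : \sum_(0 <= n < K) q n * \1_(H n) w <= M.
  by rewrite leNgt; apply/negP => MK; apply: MS; exists K; exact: ltW.
have qH0 n : 0 <= q n * \1_(H n) w by rewrite mulr_ge0// indicE.
have tail := bounded_sum_tail qH0 SM.
have hit x n1 : (covering_set l xi w `&` A) x -> exists n, [/\ (n0 <= n)%N, (n1 <= n)%N, H n w &
    prefix_word dg (k n) x \in neighbours (prefix_word dg (k n) (xi n w))].
  move=> [Ex Ax]; have [n /= nn] := Ex (maxn n0 n1) Logic.I.
  rewrite ballEmdist/= => xn; move: nn; rewrite geq_max => /andP[nn0 nn1].
  have /andP[kl _] := kP n nn0; have xk := lt_trans xn kl.
  exists n; split => //; last exact: neighbours_prefix_word.
  exists (prefix_word dg (k n) (xi n w)); last exact: cell_prefix_word.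
  rewrite /= mem_undup; apply/flatten_mapP; exists (prefix_word dg (k n) x).
    by case: (LP (k n)) => _ _; apply.
  by apply: neighbours_prefix_word; rewrite metric_sym.
split=> [t_gt0|tE].
  have t01 := half_powR01 t_gt0.
  have D0 : 0 < (3 ^ d)%:R :> R by rewrite ltr0n expn_gt0.
  apply/ler_addgt0Pr => e e0; rewrite add0r.
  have [n1 n1e] := tail (e / (3 ^ d)%:R) ltac:(by rewrite divr_gt0).
  pose D := [set n | [/\ (n0 <= n)%N, (n1 <= n)%N & H n w]].
  pose CC : set word := \bigcup_(n in D) [set prefix_word dg (k n) (xi n w)].
  have wC : weight_le (2^-1 `^ t) CC (e / (3 ^ d)%:R).
    apply: (weight_le_bigcup (c := fun n => (2^-1 `^ t) ^+ k n)).
      by move=> n _; rewrite -[X in _ ^+ X](size_prefix_word dg (k n) (xi n w)); exact: weight_le_set1.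
    move=> ns us sD; apply: le_trans (n1e (\max_(n <- ns) n).+1).
    apply: (@le_trans _ _ (\sum_(n <- ns) q n * \1_(H n) w)).
      rewrite big_seq [leRHS]big_seq; apply: ler_sum => n /sD[nn _ Hn].
      by rewrite indicE mem_set// mulr1 /q ltnNge nn half_powR.
    apply: ler_sum_uniq_sub => //; rewrite ?iota_uniq// => n nns.
    have [_ nn _] := sD n nns; rewrite mem_index_iota nn/=.
    exact: leq_bigmax_seq.
  apply: (@le_trans _ _ ((3 ^ d)%:R * (e / (3 ^ d)%:R))).
    apply: content_le_cover => //; exists (neighbour_cells CC); last exact: weight_le_neighbours.
    move=> x /(hit x n1)[n [nn0 nn1 Hn xn]]; exists (prefix_word dg (k n) x); last exact: cell_prefix_word.
    by exists (prefix_word dg (k n) (xi n w)) => //; exists n.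
  by rewrite mulrCA divff ?mulr1// gt_eqF.
rewrite -subset0 => x /hit xh; have [n1 n1e] := tail 2^-1 h0.
have [n [nn0 nn1 Hn _]] := xh n1.
have qn : q n = 1 by rewrite /q ltnNge nn0/= tE powRr0.
have := n1e n.+1; rewrite big_nat_recr//= indicE mem_set// mulr1 qn.
have : 0 <= \sum_(n1 <= i < n) q i * \1_(H i) w by apply: sumr_ge0.
lra.
Qed.
End hits.

(** * The covering exponent *)

Section exponent.
Context (R : realType) (d : nat) (l : nat -> R).
Hypothesis l_gt0 : forall n, 0 < l n.
Hypothesis l_decr : nonincreasing_seq l.
Local Notation alpha := (covering_exponent d l).

Lemma nneseries_unbounded (f : nat -> R) : (forall n, 0 <= f n) ->
  (\sum_(0 <= n <oo) (f n)%:E = +oo)%E <-> forall M, exists K, M <= \sum_(0 <= n < K) f n.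
Proof.
move=> f0; split=> [foo M|h].
  apply: contrapT => nK; suff : (\sum_(0 <= n <oo) (f n)%:E <= M%:E)%E by rewrite foo.
  apply: nneseries_le => [i|n]; rewrite ?sumEFin lee_fin// leNgt; apply/negP => Mn.
  by apply: nK; exists n; exact: ltW.
apply: eq_infty => M; have [K MK] := h M.
apply: (@le_trans _ _ (\sum_(0 <= n < K) (f n)%:E)%E); first by rewrite sumEFin lee_fin.
by apply: nneseries_lim_ge => n _ _; rewrite lee_fin.
Qed.

Let S := [set s | 0 <= s <= d%:R /\ (\sum_(0 <= n <oo) (l n `^ s)%:E = +oo)%E].

Let powl_ge0 s n : 0 <= l n `^ s. Proof. exact: powR_ge0. Qed.

Let S0 : S 0.
Proof.
split; first by rewrite lexx ler0n.
apply/nneseries_unbounded => // M; exists (Num.bound `|M|).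
rewrite (eq_bigr (fun=> 1)); last by move=> n _; rewrite powRr0.
by rewrite sumr_const_nat subn0 (le_trans (ler_norm M))// ltW// archi_boundP.
Qed.

Let supS : has_sup S.
Proof. by split; [exists 0|exists d%:R => s [/andP[]]]. Qed.

Lemma exponent_ge0 : 0 <= alpha.
Proof. by apply: sup_upper_bound; [exact: supS|exact: S0]. Qed.

(** The bound [u <= d] matters: when [alpha = d], the series may diverge at
    all larger exponents too, because [l] may tend to 0 very slowly. *)
Lemma exponent_convergence u : alpha < u -> u <= d%:R ->
  exists b, forall K, \sum_(0 <= n < K) l n `^ u <= b.
Proof.
move=> au ud; apply: contrapT => nb.
have : S u.
  split; first by rewrite ud (le_trans exponent_ge0)// ltW.
  apply/nneseries_unbounded => // M; apply: contrapT => nK; apply: nb.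
  by exists M => K; rewrite leNgt; apply/negP => /ltW h; apply: nK; exists K.
by move=> /(sup_upper_bound supS); rewrite leNgt au.
Qed.

Lemma exponent_divergence y : y < alpha -> exists v, [/\ y < v, 0 <= v, v <= d%:R &
  forall M, exists K, M <= \sum_(0 <= n < K) l n `^ v].
Proof.
move=> /(sup_gt supS.1)[v [/andP[v0 vd] vS] yv]; exists v; split=> //.
exact/nneseries_unbounded.
Qed.

Lemma eventually_small u b : 0 <= u -> (forall K, \sum_(0 <= n < K) l n `^ u <= b) ->
  exists n0, forall n, (n0 <= n)%N -> l n < 1.
Proof.
move=> u0 lb; apply: contrapT => nn.
have l1 n : 1 <= l n.
  rewrite leNgt; apply/negP => ln; apply: nn; exists n => k nk.
  exact: le_lt_trans (l_decr nk) ln.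
have b0 : 0 <= b by have := lb 0%N; rewrite big_geq.
have := lb (Num.bound b); rewrite leNgt => /negP; apply.
apply: lt_le_trans (archi_boundP b0) _.
apply: (@le_trans _ _ (\sum_(0 <= n < Num.bound b) 1)).
  by rewrite sumr_const_nat subn0.
apply: ler_sum => n _; have E1 : 1 `^ u = 1 :> R by rewrite powR1.
by rewrite -[leLHS]E1; apply: ge0_ler_powR; rewrite ?nnegrE// ltW.
Qed.
End exponent.

(** * Almost sure bounds *)

Section almost_sure_dimensions.
Context (R : realType) (d : nat) (disp : measure_display) (Omega : measurableType disp)
  (P : probability Omega R) (l : nat -> R) (xi : nat -> {RV P >-> torus R d})
  (F : set (torus R d)).
Hypothesis d_gt0 : (0 < d)%N.
Hypothesis l_gt0 : forall n, 0 < l n.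
Hypothesis l_decr : nonincreasing_seq l.
Hypothesis xi_indep : independent_seq xi.
Hypothesis xi_unif : forall n, uniform_on_torus (xi n).
Local Notation alpha := (covering_exponent d l).
Local Notation E := (covering_set l xi).
Local Notation T := (torus R d).
Local Notation B := {ffun 'I_d -> bool}.
Local Notation dg := (@digit R d).
Local Notation N := (#|{: B}|%:R : R).

(** The cells around the centres are taken of side between constant multiples of
    [l n] and small enough to lie in the balls, so that the weights of
    [content_of_intersection] dominate a multiple of [l n ^ v] for some [v] at
    which the series diverges. *)
Lemma lower_ae t : analytic_set F -> 0 < t ->
  (t%:E < hausdorff_dim F + alpha%:E - d%:R%:E)%E ->
  P.-negligible [set w | ~ 0 < content dg (2^-1 `^ t) (E w `&` F)].
Proof.
move=> anF t0 tF.
have [s sF ts] : exists2 s : R, (s%:E < hausdorff_dim F)%E & t + d%:R - alpha < s.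
  move: tF; case: (hausdorff_dim F) => [r| |]//=.
    rewrite lte_fin => tr; exists ((t + d%:R - alpha + r) / 2); rewrite ?lte_fin; lra.
  by move=> _; exists (t + d%:R - alpha + 1); [rewrite ltry|rewrite ltrDl].
have [v [sv v0 vd ldiv]] := @exponent_divergence R d l (t + d%:R - s) ltac:(lra).
have st : t < s by lra.
have s0 : 0 < s by exact: lt_trans st.
have d0 : 0 < d%:R :> R by rewrite ltr0n.
have h0 : 0 < 2^-1 :> R by rewrite invr_gt0.
have lle n : l n <= l 0%N by exact: l_decr.
pose x n := Num.min (l n) 1 / (8 * d%:R).
have x0 n : 0 < x n by rewrite divr_gt0 ?lt_min ?l_gt0 ?ltr01 ?mulr_gt0.
have d1 : 1 <= d%:R :> R by rewrite ler1n.
have /choice[m mP] : forall n, exists m, x n < 2^-1 ^+ m <= 2 * x n.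
  move=> n; apply: dyadic_scale; rewrite x0/= ltr_pdivrMr ?mulr_gt0//.
  by apply: (@le_lt_trans _ _ 1); [rewrite ge_min lexx orbT|lra].
have ml j : d%:R * 2^-1 ^+ m j < l j / 2.
  have /andP[_ h] := mP j; apply: le_lt_trans (_ : d%:R * (2 * x j) < _).
    by rewrite ler_pM2l.
  have -> : d%:R * (2 * x j) = Num.min (l j) 1 / 4 by rewrite /x; field; rewrite gt_eqF.
  have : Num.min (l j) 1 <= l j by rewrite ge_min lexx.
  by have := l_gt0 j; lra.
pose c := (8 * d%:R * (1 + l 0%N))^-1.
have c0 : 0 < c by rewrite invr_gt0 !mulr_gt0// addr_gt0.
have cm j : c * l j <= 2^-1 ^+ m j.
  have /andP[h _] := mP j; apply: le_trans (ltW h).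
  have l00 := l_gt0 0%N; have lj := l_gt0 j; have ljl := lle j.
  have -> : c * l j = l j / (1 + l 0%N) / (8 * d%:R).
    by rewrite /c; field; rewrite !gt_eqF//= addr_gt0.
  rewrite /x ler_pM2r ?invr_gt0 ?mulr_gt0// ler_pdivrMr ?addr_gt0//.
  by case: (leP (l j) 1) => l1; nra.
pose rho : R := 2^-1 `^ s; pose theta : R := 2^-1 `^ t.
have rho_gt0 : 0 < rho by rewrite powR_gt0.
have theta_gt0 : 0 < theta by rewrite powR_gt0.
have rho_theta : rho < theta by exact: half_powR_lt.
have theta_lt1 : theta < 1 by case/andP: (half_powR01 t0).
apply: (content_of_intersection xi_indep xi_unif ml rho_gt0 rho_theta theta_lt1 _ anF); last first.
  exact: content_gt0_of_dim.
pose u := d%:R - s + t.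
have uv : u <= v by rewrite /u; lra.
have kapE j : (N * rho / theta) ^- m j = (2^-1 ^+ m j) `^ u.
  rewrite half_powR -exprVn; congr (_ ^+ _).
  have h0' : (2^-1 : R) != 0 by rewrite gt_eqF.
  rewrite /u powRD; last by apply/implyP.
  rewrite powRB; last by apply/implyP.
  rewrite powR_mulrn ?(ltW h0)// card_digits -/rho -/theta exprVn; field.
  by rewrite !gt_eqF// exprn_gt0.
have cl j : c `^ v * l j `^ v <= (N * rho / theta) ^- m j.
  rewrite kapE -powRM ?(ltW c0) ?(ltW (l_gt0 j))//.
  apply: (@le_trans _ _ ((2^-1 ^+ m j) `^ v)).
    apply: ge0_ler_powR => //; rewrite ?nnegrE ?exprn_ge0 ?(ltW h0)//.
    by rewrite mulr_ge0 ?ltW.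
  apply: ger_powR => //; rewrite exprn_gt0//= exprn_ile1 ?(ltW h0)//; lra.
have cv0 : 0 < c `^ v by rewrite powR_gt0.
move=> M n0; have [K KM] := ldiv (M / c `^ v + \sum_(0 <= j < n0) l j `^ v).
exists (maxn n0 K).
apply: (@le_trans _ _ (\sum_(n0 <= j < maxn n0 K) c `^ v * l j `^ v)); last first.
  by apply: ler_sum => j _; exact: cl.
rewrite -mulr_sumr mulrC -ler_pdivrMr// -(lerD2r (\sum_(0 <= j < n0) l j `^ v)).
apply: le_trans KM _; rewrite [leRHS]addrC -(big_cat_nat (leq0n n0) (leq_maxl _ _))/=.
rewrite [leRHS](big_cat_nat (leq0n K) (leq_maxr _ _))/= lerDl.
by apply: sumr_ge0 => j _; exact: powR_ge0.
Qed.

(** If [d - s + t] exceeds [d] the series of [hits_ae] may diverge, but then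
    [s < t] and box counting alone shows that [F] has null content. *)
Lemma upper_ae t s : 0 <= t -> (packing_dim F < s%:E)%E -> alpha < d%:R - s + t ->
  P.-negligible [set w | ~ ((0 < t -> content dg (2^-1 `^ t) (E w `&` F) <= 0) /\
     (t = 0 -> E w `&` F = set0))].
Proof.
move=> t0 /packing_dim_box_counted[s' [A [s'0 s's FA Abox]]] st.
have al0 := exponent_ge0 d l.
have [ud|du] := leP (d%:R - s' + t) d%:R.
  have u0 : 0 <= d%:R - s' + t by lra.
  have [|b lb] := @exponent_convergence R d l (d%:R - s' + t) _ ud; first by lra.
  have [n0 n0P] := eventually_small l_gt0 l_decr u0 lb.
  have Aneg i := let: ex_intro2 C C0 bC := Abox i in
    hits_ae xi_unif l_gt0 bC C0 t0 u0 n0P lb.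
  apply: negligibleS (negligible_bigcup Aneg) => w nw; apply: contrapT => nA; apply: nw.
  have {}nA i : (0 < t -> content dg (2^-1 `^ t) (E w `&` A i) <= 0) /\
      (t = 0 -> E w `&` A i = set0).
    by apply: contrapT => h; apply: nA; exists i.
  split=> [t_gt0|tE].
    have t01 := half_powR01 t_gt0.
    apply: le_trans (content_mono dg t01 (_ : _ `<=` \bigcup_i (E w `&` A i))) _.
      by move=> x [Ex /FA[i _ Ax]]; exists i.
    by apply: content_null_bigcup => // i; case: (nA i) => /(_ t_gt0).
  rewrite -subset0 => x [Ex /FA[i _ Ax]].
  by have [_ /(_ tE) <-] := nA i.
apply: negligibleS (negligible_set0 P) => w; apply.
have t_gt0 : 0 < t by lra.
split=> [_|tE]; last by rewrite tE ltxx in t_gt0.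
have t01 := half_powR01 t_gt0.
apply: le_trans (content_mono dg t01 (_ : _ `<=` \bigcup_i A i)) _.
  by move=> x [_ /FA].
apply: content_null_bigcup => // i; have [C C0 bC] := Abox i.
by apply: (content_box_counted bC) => //; lra.
Qed.

Lemma negligible_completed1 (A : set Omega) : P.-negligible (~` A) -> completed_prob P A 1%E.
Proof.
move=> [N0 [mN N00 AN]]; exists (~` N0), (A `&` N0); split.
- exact: measurableC.
- by exists N0; split=> // w [].
- apply/seteqP; split=> [w Aw|w [Nw|[]//]].
    by have [h|h] := pselect (N0 w); [right|left].
  by apply: contrapT => /AN.
- by rewrite probability_setC// N00 sube0.
Qed.

Lemma negligible_completed0 (A : set Omega) : P.-negligible A -> completed_prob P A 0%E.
Proof. by move=> nA; exists set0, A; split; rewrite ?set0U. Qed.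

Lemma packing_dim_ge0 : (0 <= packing_dim F)%E.
Proof. by apply: le_ereal_inf_tmp => _ [r [r0 Hr] <-]; rewrite lee_fin. Qed.

Lemma missed_ae : (packing_dim F < (d%:R - alpha)%:E)%E ->
  P.-negligible [set w | E w `&` F !=set0].
Proof.
move=> pF; have [s ps sa] : exists2 s : R, (packing_dim F < s%:E)%E & s < d%:R - alpha.
  move: pF packing_dim_ge0; case: (packing_dim F) => [r| |]//=; rewrite lte_fin => rd _.
  exists ((r + (d%:R - alpha)) / 2); rewrite ?lte_fin; lra.
apply: negligibleS (upper_ae (lexx 0) ps _); last by lra.
by move=> w /set0P/eqP Ew [_ /(_ erefl)].
Qed.

Lemma hit_ae : analytic_set F -> ((d%:R - alpha)%:E < hausdorff_dim F)%E ->
  P.-negligible (~` [set w | E w `&` F !=set0]).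
Proof.
move=> anF dF; have [t t0 tF] : exists2 t : R, 0 < t &
    (t%:E < hausdorff_dim F + alpha%:E - d%:R%:E)%E.
  move: dF; case: (hausdorff_dim F) => [r| |]//=; last by (move=> _; exists 1; [exact: ltr01|rewrite /= ltry]).
  rewrite lte_fin => rd; exists ((r + alpha - d%:R) / 2); rewrite ?lte_fin; lra.
apply: negligibleS (lower_ae anF t0 tF) => w nE c0; apply: nE.
apply/set0P/eqP => E0; move: c0; rewrite E0 content0 ?ltxx//.
exact: half_powR01.
Qed.

(** The exceptional set depends on the exponent, so only rational exponents are
    used. *)
Lemma dim_lower_ae : analytic_set F -> P.-negligible [set w |
  ~ (hausdorff_dim F + alpha%:E - d%:R%:E <= hausdorff_dim (E w `&` F))%E].
Proof.
move=> anF; set X := (_ - _)%E.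
pose bad n : set Omega := if choice.unpickle n is Some q then
  if (0 < ratr q :> R) && ((ratr q : R)%:E < X)%E then
    [set w | ~ 0 < content dg (2^-1 `^ (ratr q : R)) (E w `&` F)] else set0 else set0.
apply: (@negligibleS _ _ _ _ (\bigcup_n bad n)); last first.
  apply: negligible_bigcup => n; rewrite /bad; case: choice.unpickle => [q|]; last exact: negligible_set0.
  by case: ifPn => [/andP[q0 qX]|_]; [exact: lower_ae|exact: negligible_set0].
move=> w /negP; rewrite -ltNge => dX.
have [q q0 [dq qX]] : exists2 q : rat, 0 < ratr q :> R &
    (hausdorff_dim (E w `&` F) < (ratr q : R)%:E)%E /\ ((ratr q : R)%:E < X)%E.
  move: dX (hausdorff_dim_ge0 (E w `&` F)); clear bad.
  case: (hausdorff_dim _) => [r| |]//; case: X => [x| |]//.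
    rewrite lte_fin lee_fin => /rat_in_itvoo[q]; rewrite in_itv/= => /andP[rq qx] r0.
    by exists q; [exact: le_lt_trans r0 rq|rewrite !lte_fin].
  rewrite lee_fin => _ r0; have /rat_in_itvoo[q] : r < r + 1 by rewrite ltrDl.
  rewrite in_itv/= => /andP[rq qx].
  by exists q; [exact: le_lt_trans r0 rq|rewrite lte_fin ltry].
exists (choice.pickle q); first exact: Logic.I.
rewrite /bad choice.pickleK q0 qX/= => c0.
by move: dq; rewrite ltNge dim_ge_of_content.
Qed.

Lemma dim_upper_ae : P.-negligible [set w | ~ (E w `&` F !=set0 ->
  (hausdorff_dim (E w `&` F) <= packing_dim F + alpha%:E - d%:R%:E)%E)].
Proof.
have : (packing_dim F < (d%:R - alpha)%:E)%E \/ packing_dim F = +oo%E \/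
    exists2 p : R, packing_dim F = p%:E & 0 <= p + alpha - d%:R.
  move: packing_dim_ge0; case: (packing_dim F) => [p| |]// p0; last by right; left.
  have [h|h] := ltP p (d%:R - alpha); first by left; rewrite lte_fin.
  by right; right; exists p => //; lra.
case=> [/missed_ae|[pE|[p pE pa]]].
- by apply: negligibleS => w nE; apply: contrapT => h; apply: nE => /h.
- apply: negligibleS (negligible_set0 P) => w; apply => _.
  by rewrite pE /= leey.
pose t n : R := p + alpha - d%:R + n.+1%:R^-1.
have t0 n : 0 < t n by rewrite ltr_wpDl// invr_gt0.
have tneg n : P.-negligible [set w | ~ ((0 < t n -> content dg (2^-1 `^ t n) (E w `&` F) <= 0) /\
     (t n = 0 -> E w `&` F = set0))].
  have i0 : 0 < n.+1%:R^-1 :> R by rewrite invr_gt0.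
  apply: (@upper_ae (t n) (p + n.+1%:R^-1 / 2)); first exact: ltW.
    by rewrite pE lte_fin ltrDl divr_gt0.
  by rewrite /t; move: (n.+1%:R^-1) i0 => i i0; lra.
apply: negligibleS (negligible_bigcup tneg) => w nw; apply: contrapT => nA; apply: nw => _.
rewrite pE; apply/lee_addgt0Pr => e e0.
have [n _ /(_ n (leqnn n)) ne] := near_infty_natSinv_lt (PosNum e0).
apply: (@le_trans _ _ (t n)%:E); last by rewrite lee_fin /t lerD2l ltW.
have tn0 := t0 n.
apply: hausdorff_dim_le; first exact: ltW.
apply: hausdorff_measure0_of_content => //; rewrite leNgt; apply/negP => c0.
by apply: nA; exists n => // -[/(_ tn0)]; rewrite leNgt c0.
Qed.
End almost_sure_dimensions.

Theorem corollary1p2 (R : realType) (d : nat) (disp : measure_display)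
    (Omega : measurableType disp) (P : probability Omega R)
    (l : nat -> R) (xi : nat -> {RV P >-> torus R d}) (F : set (torus R d))
    (d_ge1 : (1 <= d)%N)
    (l_gt0 : forall n, 0 < l n)
    (l_decr : nonincreasing_seq l)
    (xi_indep : independent_seq xi)
    (xi_unif : forall n, uniform_on_torus (xi n))
    (F_analytic : analytic_set F) :
  let E := covering_set l xi in
  let alpha := covering_exponent d l in
  [/\ ((packing_dim F < (d%:R - alpha)%:E)%E ->
        completed_prob P [set w | E w `&` F !=set0] 0%E),
      (((d%:R - alpha)%:E < hausdorff_dim F)%E ->
        completed_prob P [set w | E w `&` F !=set0] 1%E) &
      {ae P, forall w,
        (hausdorff_dim F + alpha%:E - d%:R%:E <= hausdorff_dim (E w `&` F))%E /\
        (E w `&` F !=set0 ->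
          (hausdorff_dim (E w `&` F) <= packing_dim F + alpha%:E - d%:R%:E)%E)}].
Proof.
move=> E alpha; split.
- by move=> pF; apply: negligible_completed0; exact: missed_ae.
- by move=> dF; apply: negligible_completed1; exact: hit_ae.
have := negligibleU
  (dim_lower_ae d_ge1 l_gt0 l_decr xi_indep xi_unif F_analytic)
  (dim_upper_ae F d_ge1 l_gt0 l_decr xi_unif).
apply: negligibleS => w /= /not_andP[h|h]; [by left|by right].
Qed.
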